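(* Let $M$ be a connected manifold and let $H$ be a smooth bracket generating distribution on $M$. Then any two points of $M$ can be connected by a horizontal curve.
   Context: Manifolds are smooth, finite-dimensional and paracompact; vectorfields are smooth. A distribution $H$ on $M$ is an assignment of a linear subspace $H_x\subset T_xM$ to each $x\in M$ (the dimension may vary with $x$). A local vectorfield is a smooth vectorfield defined on some open subset of $M$; it is horizontal if its values lie in $H$ at every point where it is defined. A set $\mathcal V$ of local vectorfields spans $H$ if for all $x$, $H_x$ is the linear hull of $\{X(x):X\in\mathcal V,\ x\in\text{domain of }X\}$. $H$ is smooth if it is spanned by the set of all local horizontal vectorfields. A set of local vectorfields is involutive if it is closed under Lie brackets (taken on the intersection of the domains). The Lie hull of a set $\mathcal V$ of local vectorfields is the smallest involutive set of local vectorfields containing $\mathcal V$. $H$ is bracket generating if the Lie hull of the set of all local horizontal vectorfields spans $TM$. A curve in $M$ is absolutely continuous if it is so in every chart. A curve $\gamma:[a,b]\to M$ is controlled by local vectorfields $X_1,\dots,X_k$ defined near $\gamma([a,b])$ if it is absolutely continuous and there are $L^1$-functions $u_1,\dots,u_k:[a,b]\to\mathbb R$ with $\dot\gamma(t)=\sum_{i=1}^k u_i(t)X_i(\gamma(t))$ for almost every $t$. A curve is horizontal if it is a (finite) concatenation of curves each controlled by local horizontal vectorfields. *)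

(* Defs.v *)
From mathcomp Require Import all_boot all_order all_algebra.
From mathcomp Require Import all_classical all_reals all_analysis.

Set Implicit Arguments.
Unset Strict Implicit.
Unset Printing Implicit Defensive.

Import Order.TTheory GRing.Theory Num.Theory.
Import numFieldNormedType.Exports.

Local Open Scope classical_set_scope.
Local Open Scope ring_scope.

(* The set [U] is meant to be open; [f] is arbitrary outside [U].  For        *)
(* finite-dimensional [V] this is the usual notion: all iterated directional  *)
(* derivatives up to order [k] exist and are continuous on [U].               *)
Fixpoint Ck_on (R : realType) (V W : normedModType R) (k : nat)
    (U : set V) (f : V -> W) : Prop :=
  if k is k'.+1 then
    (forall x, U x -> differentiable f x) /\
    (forall v : V, Ck_on k' U ('D_v f))
  else forall x, U x -> {for x, continuous f}.

Definition smooth_on (R : realType) (V W : normedModType R)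
    (U : set V) (f : V -> W) : Prop :=
  forall k, Ck_on k U f.

Definition paracompact (T : topologicalType) : Prop :=
  forall C : set (set T),
    C `<=` open -> \bigcup_(U in C) U = [set: T] ->
  exists D : set (set T),
    [/\ D `<=` open,
        \bigcup_(V in D) V = [set: T],
        (forall V, D V -> exists2 U, C U & V `<=` U) &
        forall x : T, exists2 W, nbhs x W &
          finite_set [set V | D V /\ V `&` W !=set0]].

(* A homeomorphism between open subsets of [T] and R^n.  Both [cmap] and      *)
(* [cinv] are total functions; their values off [cdom], respectively off      *)
(* [cmap @` cdom], are irrelevant.                                            *)
Record chart (R : realType) (n : nat) (T : topologicalType) := Chart {
  cdom : set T;
  cmap :> T -> 'rV[R]_n;
  cinv : 'rV[R]_n -> T;
  cdom_open : open cdom;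
  cimg_open : open (cmap @` cdom);
  cmapK : forall x, cdom x -> cinv (cmap x) = x;
  cmap_continuous : forall x, cdom x -> {for x, continuous cmap};
  cinv_continuous : forall y, (cmap @` cdom) y -> {for y, continuous cinv}
}.

Definition transition_smooth (R : realType) (n : nat) (T : topologicalType)
    (p q : chart R n T) : Prop :=
  smooth_on (p @` (cdom p `&` cdom q)) (q \o cinv p).

Record manifold (R : realType) (n : nat) := Manifold {
  mcarrier :> topologicalType;
  atlas : set (chart R n mcarrier);
  manifold_hausdorff : hausdorff_space mcarrier;
  manifold_paracompact : paracompact mcarrier;
  atlas_cover : forall x : mcarrier, exists2 p, atlas p & cdom p x;
  atlas_compatible : forall p q, atlas p -> atlas q -> transition_smooth p q;
  atlas_maximal : forall p : chart R n mcarrier,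
    (forall q, atlas q -> transition_smooth p q /\ transition_smooth q p) ->
    atlas p
}.

(* A tangent vector is encoded by the family of its coordinate vectors in all *)
(* charts.  The tangent spaces at the various points are thus subspaces of    *)
(* one ambient vector space.                                                  *)
Definition tvector (R : realType) (n : nat) (M : manifold R n) : Type :=
  chart R n M -> 'rV[R]_n.

Definition chart_at (R : realType) (n : nat) (M : manifold R n)
    (x : M) (p : chart R n M) : Prop :=
  atlas p /\ cdom p x.

(* The first condition normalizes the irrelevant components, so that equality *)
(* in [tvector M] is equality of tangent vectors.                             *)
Definition tangent_space (R : realType) (n : nat) (M : manifold R n)
    (x : M) : set (tvector M) :=
  [set v | (forall p, ~ chart_at x p -> v p = 0) /\
           (forall p q, chart_at x p -> chart_at x q ->
              v q = 'd (q \o cinv p) (p x) (v p))].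

Definition linear_subspace (R : realType) (V : lmodType R) (S : set V) : Prop :=
  S 0 /\ forall (c : R) (v w : V), S v -> S w -> S (c *: v + w).

Definition linear_hull (R : realType) (V : lmodType R) (S : set V) : set V :=
  smallest (@linear_subspace R V) S.

Record tangent_distribution (R : realType) (n : nat) (M : manifold R n) :=
  TangentDistribution {
    dist :> M -> set (tvector M);
    dist_tangent : forall x, dist x `<=` tangent_space x;
    dist_subspace : forall x, linear_subspace (dist x)
  }.

Definition in_chart (R : realType) (n : nat) (M : manifold R n)
    (X : M -> tvector M) (p : chart R n M) : 'rV[R]_n -> 'rV[R]_n :=
  fun y => X (cinv p y) p.

(* [lfield] is normalized to be 0 off the domain, so that two local           *)
(* vectorfields are equal iff they have the same domain and the same values   *)
(* on it.                                                                     *)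
Record local_vfield (R : realType) (n : nat) (M : manifold R n) := LocalVfield {
  ldom : set M;
  lfield :> M -> tvector M;
  ldom_open : open ldom;
  lfield_tangent : forall x, ldom x -> tangent_space x (lfield x);
  lfield_out : forall x, ~ ldom x -> lfield x = 0;
  lfield_smooth : forall p, atlas p ->
    smooth_on (p @` (cdom p `&` ldom)) (in_chart lfield p)
}.

(* [Z] is the Lie bracket [X, Y]: it is defined exactly on the intersection   *)
(* of the domains and has the usual expression DY.X - DX.Y in every chart.    *)
(* Existence and uniqueness of such a [Z] is the classical chart independence *)
(* of this formula.                                                           *)
Definition is_lie_bracket (R : realType) (n : nat) (M : manifold R n)
    (X Y Z : local_vfield M) : Prop :=
  ldom Z = ldom X `&` ldom Y /\
  forall (x : M) (p : chart R n M), ldom Z x -> chart_at x p ->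
    Z x p = 'd (in_chart Y p) (p x) (X x p) - 'd (in_chart X p) (p x) (Y x p).

Definition involutive_fields (R : realType) (n : nat) (M : manifold R n)
    (V : set (local_vfield M)) : Prop :=
  forall X Y Z, V X -> V Y -> is_lie_bracket X Y Z -> V Z.

Definition lie_hull (R : realType) (n : nat) (M : manifold R n)
    (V : set (local_vfield M)) : set (local_vfield M) :=
  smallest (@involutive_fields R n M) V.

Definition spans (R : realType) (n : nat) (M : manifold R n)
    (V : set (local_vfield M)) (H : M -> set (tvector M)) : Prop :=
  forall x, H x = linear_hull [set X x | X in V `&` [set X | ldom X x]].

Definition horizontal_fields (R : realType) (n : nat) (M : manifold R n)
    (H : tangent_distribution M) : set (local_vfield M) :=
  [set X | forall x, ldom X x -> H x (X x)].

Definition smooth_distribution (R : realType) (n : nat) (M : manifold R n)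
    (H : tangent_distribution M) : Prop :=
  spans (horizontal_fields H) H.

Definition bracket_generating (R : realType) (n : nat) (M : manifold R n)
    (H : tangent_distribution M) : Prop :=
  spans (lie_hull (horizontal_fields H)) (@tangent_space R n M).

Definition absolutely_continuous (R : realType) (V : normedModType R)
    (a b : R) (f : R -> V) : Prop :=
  forall e : R, 0 < e -> exists2 d : R, 0 < d &
    forall (k : nat) (s r : 'I_k -> R),
      (forall i, [/\ a <= s i, s i <= r i & r i <= b]) ->
      trivIset [set: 'I_k] (fun i => `]s i, r i[%classic) ->
      \sum_(i < k) (r i - s i) < d ->
      \sum_(i < k) `|f (r i) - f (s i)| < e.

(* A curve on [a, b] is given by a total function g : R -> M of which only    *)
(* the restriction to [a, b] matters.                                         *)
Definition ac_curve (R : realType) (n : nat) (M : manifold R n)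
    (a b : R) (g : R -> M) : Prop :=
  {within `[a, b], continuous g} /\
  forall (p : chart R n M) (c d : R), atlas p -> a <= c -> c <= d -> d <= b ->
    (forall t, t \in `[c, d] -> cdom p (g t)) ->
    absolutely_continuous c d (p \o g).

Definition velocity (R : realType) (n : nat) (M : manifold R n)
    (g : R -> M) (t : R) (v : tvector M) : Prop :=
  tangent_space (g t) v /\
  forall p, chart_at (g t) p -> is_derive t (1 : R) (p \o g) (v p).

(* The endpoints form a null set; they are left out because the derivative    *)
(* there would see values of [g] outside [a, b].                              *)
Definition controlled (R : realType) (n : nat) (M : manifold R n)
    (a b : R) (g : R -> M) (k : nat) (X : 'I_k -> local_vfield M) : Prop :=
  [/\ (forall i t, t \in `[a, b] -> ldom (X i) (g t)),
      ac_curve a b g &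
      exists u : 'I_k -> R -> R,
        (forall i, (@lebesgue_measure R).-integrable `[a, b] (EFin \o u i)) /\
        {ae @lebesgue_measure R, forall t, t \in `]a, b[ ->
           velocity g t (\sum_(i < k) u i t *: X i (g t))}].

Inductive horizontal (R : realType) (n : nat) (M : manifold R n)
    (H : tangent_distribution M) (g : R -> M) : R -> R -> Prop :=
| horizontal_controlled (a b : R) (k : nat) (X : 'I_k -> local_vfield M) :
    a < b -> (forall i, horizontal_fields H (X i)) ->
    controlled a b g X -> horizontal H g a b
| horizontal_concat (a c b : R) :
    horizontal H g a c -> horizontal H g c b -> horizontal H g a b.

(* Main.v *)
Require Import Defs.
From mathcomp Require Import all_boot all_order all_algebra.
From mathcomp Require Import all_classical all_reals all_analysis.
From mathcomp Require Import lra ring.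

Set Implicit Arguments.
Unset Strict Implicit.
Unset Printing Implicit Defensive.

Import Order.TTheory GRing.Theory Num.Theory.
Import numFieldNormedType.Exports.

Local Open Scope classical_set_scope.
Local Open Scope ring_scope.

(* A curve whose controls switch infinitely often is still controlled by the same finite family of
   fields, provided its total length is finite.  Hence a target only has to be hit approximately:
   from a point at distance s^N of the target one moves to a point at distance (s/2)^N along a curve
   of length O(s), and the concatenation of these curves reaches the target exactly.  This replaces
   the inverse function theorem, and no smooth dependence of flows on the initial point is needed.

   In a chart, call a field Y accessible if, for some N, one can move from any nearby point z by
   c s^N Y(z) + O(s^(N+1)), |c| <= 1, along a curve of length O(s).  Horizontal fields are accessible
   (N = 1), and if X is horizontal and Y accessible of order N, then the commutator of the flow of X
   for time s with the displacement along Y of parameter s^2 shows that [X, Y] is accessible of order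
   2N + 1.  Accessible fields form a linear space, so by the Jacobi identity the fields whose brackets
   with accessible fields are accessible are closed under brackets and contain the whole Lie hull.
   All directions are thus accessible, so each point has a neighbourhood in which any two points can
   be joined, and connectedness concludes. *)

(** * Smooth maps and Lie brackets *)

(** The order count behind the bracket step: a displacement along [Y] with parameter [t ^+ 2] has
    size [S = t ^+ (2N)] and error [O(S t ^+ 2)], while its commutator with the flow of [X] for time
    [t] has size [S t]. With parameter [t] the error would be as large as the commutator itself. The
    step is asymmetric: [X] must have a flow, whose effect on the difference of two nearby points is
    known to first order, whereas an accessible [Y] provides displacements with an error and no
    control on how the end point varies with the starting point. So the step does not cover brackets
    of two accessible fields, and the induction over the Lie hull goes through the normalizing
    fields. The coefficient [lam], of either sign, provides the way back along [Y]; the bounds are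
    uniform in the starting point because the way back starts elsewhere. Curves in a chart carry
    bounds that survive infinite concatenation: speed and controls at most 1, and a countable set of
    exceptional times. *)

Section row_norm.
Context {R : realType} {m : nat}.
Implicit Types v : 'rV[R]_m.

Lemma norm_coord_le v j : `|v 0 j| <= `|v|.
Proof.
rewrite [leRHS]/Num.Def.normr/= mx_normrE.
exact: (le_bigmax _ (fun ij : 'I_1 * 'I_m => `|v ij.1 ij.2|) (0, j)).
Qed.

Lemma norm_row_le v (B : R) : 0 <= B -> (forall j, `|v 0 j| <= B) -> `|v| <= B.
Proof.
move=> B0 vB; rewrite [leLHS]/Num.Def.normr/= mx_normrE.
by apply: bigmax_le => // -[i j] _ /=; rewrite ord1.
Qed.

End row_norm.

(** * Mean value inequalities for vector-valued functions *)

Section mean_value.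
Context {R : realType} {m : nat}.
Implicit Types p dp : R -> 'rV[R]_m.

Lemma is_derive_coord (V : normedModType R) (p : V -> 'rV[R]_m) x v (dp : 'rV[R]_m) j :
  is_derive x v p dp -> is_derive x v (fun x => p x 0 j) (dp 0 j).
Proof.
move=> [pv <-]; rewrite derive_mx// mxE.
by apply: derivableP; move/derivable_mxP : pv; apply.
Qed.

Lemma is_derive_row (V : normedModType R) (p : V -> 'rV[R]_m) x v (dp : 'rV[R]_m) :
  (forall j, is_derive x v (fun x => p x 0 j) (dp 0 j)) -> is_derive x v p dp.
Proof.
move=> pv; have dpv : derivable p x v.
  by apply/derivable_mxP => i j; rewrite ord1; have [] := pv j.
split=> //; rewrite derive_mx//; apply/rowP => j; rewrite mxE.
by have [_] := pv j.
Qed.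

Lemma continuous_coord_within p j (A : set R) :
  {within A, continuous p} -> {within A, continuous (fun t => p t 0 j)}.
Proof.
move=> cp x; apply: (@cvg_comp _ _ _ p (fun v : 'rV_m => v 0 j)).
  exact: cp.
exact: coord_continuous.
Qed.

(** The scalar mean value theorem is applied to each coordinate, with its own intermediate point.
    Since the norm of a row is the maximum of its entries, no factor depending on the dimension
    appears. *)
Lemma mean_value_le p dp (a b B : R) : a <= b -> 0 <= B ->
  {within `[a, b], continuous p} ->
  (forall t, t \in `]a, b[ -> is_derive t 1 p (dp t)) ->
  (forall t, t \in `]a, b[ -> `|dp t| <= B) ->
  `|p b - p a| <= B * (b - a).
Proof.
move=> ab B0 cp dpP dpB; have [->|anb] := eqVneq a b.
  by rewrite !subrr normr0 mulr0.
have {anb}ab : a < b by rewrite lt_neqAle anb.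
apply: norm_row_le => [|j]; first by rewrite mulr_ge0// subr_ge0 ltW.
have [c cab] := MVT ab (fun t tab => is_derive_coord j (dpP t tab))
  (@continuous_coord_within _ j _ cp).
rewrite !mxE => ->; rewrite normrM (@ger0_norm _ (b - a)) ?subr_ge0 ?(ltW ab)//.
apply: ler_wpM2r; first by rewrite subr_ge0 ltW.
exact: le_trans (norm_coord_le _ _) (dpB _ cab).
Qed.

Lemma mean_value_linear_le p dp (w : 'rV[R]_m) (a b B : R) : a <= b -> 0 <= B ->
  {within `[a, b], continuous p} ->
  (forall t, t \in `]a, b[ -> is_derive t 1 p (dp t)) ->
  (forall t, t \in `]a, b[ -> `|dp t - w| <= B) ->
  `|p b - p a - (b - a) *: w| <= B * (b - a).
Proof.
move=> ab B0 cp dpP dpB.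
have -> : p b - p a - (b - a) *: w = (p b - b *: w) - (p a - a *: w).
  by rewrite scalerBl; apply/rowP => j; rewrite !mxE; lra.
apply: (@mean_value_le (fun t => p t - t *: w) (fun t => dp t - w)) => //.
  move=> t; apply: (@continuousB _ _ (subspace `[a, b]) p (fun t => t *: w)); first exact: cp.
  by apply: continuous_subspaceT => x; exact: scalel_continuous.
move=> t tab; have pt := dpP t tab.
apply: (@is_deriveB _ _ _ p (fun t => t *: w)).
apply: DeriveDef; first exact/diff_derivable/ex_diff.
by rewrite deriveE; [rewrite diff_val scale1r|exact: ex_diff].
Qed.

End mean_value.

Lemma near_eq_differentiable (R : realType) (V W : normedModType R)
    (f g : V -> W) (x : V) :
  {near x, f =1 g} -> differentiable f x -> differentiable g x.
Proof.
move=> fg df; have gE : g \o shift x = cst (g x) + 'd f x +o_ 0 id.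
  apply/eqaddoP; have /eqaddoP fo := diff_locally df.
  move=> e e0; have := fo e e0; rewrite (nbhs_singleton fg).
  have : \forall h \near (0 : V), f (h + x) = g (h + x).
    by move: fg; rewrite (near_shift 0 x); apply: filterS => h /=; rewrite subr0.
  apply: filterS2 => h fgh; rewrite /=.
  have -> : (f \o +%R^~ x - (cst (g x) + 'd f x)) h =
      (g \o +%R^~ x - (cst (g x) + 'd f x)) h; last by [].
  by rewrite /GRing.add/= fgh.
have dg : 'd g x = 'd f x :> (V -> W).
  by apply: diff_unique gE; exact: diff_continuous.
by apply/diff_locallyP; rewrite dg; split=> //; exact: diff_continuous.
Qed.

Lemma near_eq_open (T : topologicalType) (T' : Type) (U : set T) (f g : T -> T') x :
  open U -> U x -> (forall x, U x -> f x = g x) -> {near x, f =1 g}.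
Proof.
move=> oU Ux fg; have : nbhs x U by exact: open_nbhs_nbhs.
by apply: filterS => z; exact: fg.
Qed.

(** * Stability of C^k maps under algebraic operations *)

Section Ck_algebra.
Context {R : realType} {V : normedModType R}.
Implicit Types (W : normedModType R) (U : set V) (k : nat).

Lemma Ck_on_ext W k U (f g : V -> W) : open U -> (forall x, U x -> f x = g x) ->
  Ck_on k U f -> Ck_on k U g.
Proof.
elim: k f g => [|k IH] f g oU fg /=.
  move=> cf x Ux; rewrite /prop_for /continuous_at -(fg _ Ux).
  apply: cvg_trans (cf x Ux); apply: near_eq_cvg.
  exact: near_eq_open fg.
move=> [df Df]; split=> [x Ux|v].
  apply: near_eq_differentiable (df x Ux); exact: near_eq_open fg.
apply: IH (Df v) => // x Ux; apply: near_eq_derive; exact: near_eq_open fg.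
Qed.

(** [Ck_on] speaks of the function ['D_v f] itself, which is arbitrary off [U]. This form lets a
    derivative formula valid only on [U] stand for it, as the inductions on [k] below require. *)
Lemma Ck_on_intro W k U (f : V -> W) (df : V -> V -> W) : open U ->
  (forall x, U x -> differentiable f x) ->
  (forall v x, U x -> 'D_v f x = df v x) ->
  (forall v, Ck_on k U (df v)) -> Ck_on k.+1 U f.
Proof.
move=> oU df' Df Cdf; split=> // v; apply: Ck_on_ext (Cdf v) => // x Ux.
by rewrite Df.
Qed.

Lemma Ck_on_subset W k U U' (f : V -> W) : U' `<=` U -> Ck_on k U f -> Ck_on k U' f.
Proof.
elim: k f => [|k IH] f U'U /=; first by move=> cf x /U'U; exact: cf.
move=> [df Df]; split=> [x /U'U|v]; [exact: df|exact: IH].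
Qed.

Lemma Ck_onW W k U (f : V -> W) : Ck_on k.+1 U f -> Ck_on k U f.
Proof.
elim: k f => [|k IH] f [df Df].
  by move=> x Ux; exact: differentiable_continuous (df x Ux).
by split=> // v; exact: IH (Df v).
Qed.

Lemma Ck_on_cst W k U (c : W) : open U -> Ck_on k U (cst c : V -> W).
Proof.
move=> oU; elim: k c => [|k IH] c; first by move=> x _; exact: cst_continuous.
apply: (@Ck_on_intro _ _ _ _ (fun v => cst 0)) => // v x _; exact: derive_cst.
Qed.

Lemma Ck_onD W k U (f g : V -> W) : open U -> Ck_on k U f -> Ck_on k U g ->
  Ck_on k U (f \+ g).
Proof.
move=> oU; elim: k f g => [|k IH] f g.
  by move=> cf cg x Ux; apply: cvgD; [exact: cf|exact: cg].
move=> [df Df] [dg Dg].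
apply: (@Ck_on_intro _ _ _ _ (fun v => 'D_v f \+ 'D_v g)) => //.
- by move=> x Ux; apply: differentiableD; [exact: df|exact: dg].
- by move=> v x Ux; apply: deriveD; apply: diff_derivable; [exact: df|exact: dg].
- by move=> v; exact: (IH _ _ (Df v) (Dg v)).
Qed.

Lemma Ck_onZ W k U (c : R) (f : V -> W) : open U -> Ck_on k U f ->
  Ck_on k U (c \*: f).
Proof.
move=> oU; elim: k f => [|k IH] f.
  by move=> cf x Ux; apply: cvgZl_tmp; exact: cf.
move=> [df Df].
apply: (@Ck_on_intro _ _ _ _ (fun v => c \*: 'D_v f)) => //.
- by move=> x Ux; apply: differentiableZ; exact: df.
- by move=> v x Ux; apply: deriveZ; apply: diff_derivable; exact: df.
- by move=> v; exact: (IH _ (Df v)).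
Qed.

Lemma Ck_onM k U (f g : V -> R) : open U -> Ck_on k U f -> Ck_on k U g ->
  Ck_on k U (f \* g).
Proof.
move=> oU; elim: k f g => [|k IH] f g.
  by move=> cf cg x Ux; apply: cvgM; [exact: cf|exact: cg].
move=> Cf Cg; have [df Df] := Cf; have [dg Dg] := Cg.
apply: (@Ck_on_intro _ _ _ _ (fun v => (f \* 'D_v g) \+ (g \* 'D_v f))) => //.
- by move=> x Ux; apply: differentiableM; [exact: df|exact: dg].
- by move=> v x Ux; apply: deriveM; apply: diff_derivable; [exact: df|exact: dg].
- move=> v; apply: Ck_onD => //.
    exact: IH (Ck_onW Cf) (Dg v).
  exact: IH (Ck_onW Cg) (Df v).
Qed.

Lemma Ck_on_sum W k U (I : Type) (s : seq I) (F : I -> V -> W) : open U ->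
  (forall i, Ck_on k U (F i)) -> Ck_on k U (fun x => \sum_(i <- s) F i x).
Proof.
move=> oU CF; elim: s => [|i s IH].
  by apply: Ck_on_ext (Ck_on_cst k (0 : W) oU) => // x _; rewrite big_nil.
apply: Ck_on_ext (Ck_onD oU (CF i) IH) => // x _; by rewrite big_cons.
Qed.

Lemma Ck_onZl W k U (f : V -> R) (w : W) : open U -> Ck_on k U f ->
  Ck_on k U (fun x => f x *: w).
Proof.
move=> oU; elim: k f => [|k IH] f.
  by move=> cf x Ux; apply: cvgZr_tmp; exact: cf.
move=> [df Df].
apply: (@Ck_on_intro _ _ _ _ (fun v x => 'D_v f x *: w)) => //.
- by move=> x Ux; apply: differentiableZl; exact: df.
- move=> v x Ux; rewrite !deriveE ?diffZl//; try exact: df.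
  exact/differentiableZl/df.
- by move=> v; exact: (IH _ (Df v)).
Qed.

Lemma Ck_on_coord m k U (f : V -> 'rV[R]_m) j : open U -> Ck_on k U f ->
  Ck_on k U (fun x => f x 0 j).
Proof.
move=> oU; elim: k f => [|k IH] f.
  move=> cf x Ux; apply: (@cvg_comp _ _ _ f (fun v : 'rV_m => v 0 j)).
    exact: cf.
  exact: coord_continuous.
move=> [df Df].
apply: (@Ck_on_intro _ _ _ _ (fun v x => 'D_v f x 0 j)) => //.
- move=> x Ux; apply: (@differentiable_comp _ _ _ _ f (fun v : 'rV_m => v 0 j)).
    exact: df.
  exact: differentiable_coord.
- move=> v x Ux; have /derivableP := diff_derivable (v := v) (df x Ux).
  by move=> /(is_derive_coord j)[].
- by move=> v; exact: (IH _ (Df v)).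
Qed.

Lemma Ck_on_row m k U (f : V -> 'rV[R]_m) : open U ->
  (forall j, Ck_on k U (fun x => f x 0 j)) -> Ck_on k U f.
Proof.
move=> oU Cf.
apply: (@Ck_on_ext _ _ _ (fun x => \sum_(j < m) f x 0 j *: delta_mx 0 j)) => //.
  by move=> x _; rewrite -row_sum_delta.
by apply: Ck_on_sum => // j; exact: Ck_onZl.
Qed.

End Ck_algebra.
Lemma is_derive_line (R : realType) (V W : normedModType R) (f : V -> W) y v (t : R) :
  differentiable f (y + t *: v) ->
  is_derive t 1 (fun t : R => f (y + t *: v)) ('D_v f (y + t *: v)).
Proof.
move=> df; pose l : R -> V := fun t => y + t *: v.
have dl : is_diff t l (fun s => 0 + s *: v).
  have := @is_diffD R _ V (cst y) (fun s : R => s *: v) 0 (fun s : R => s *: v) t _ _.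
  exact.
have dfl : differentiable (f \o l) t by apply: differentiable_comp.
split; first exact: diff_derivable.
have dE : 'd (f \o l) t = 'd f (l t) \o 'd l t :> (R -> W) by apply: diff_comp.
have lE := @diff_val _ _ _ _ _ _ _ dl.
rewrite -[fun t => _]/(f \o l) deriveE// dE/= lE/= add0r scale1r.
by rewrite -deriveE.
Qed.

Lemma near_normP (R : realType) (V : normedModType R) (x : V) (P : set V) :
  (\forall z \near x, P z) -> exists2 r : R, 0 < r & forall z, `|x - z| < r -> P z.
Proof.
move=> Px; have /nbhs_ballP[r /= r0 rP] : nbhs x P by [].
by exists r => // z xz; apply: rP; rewrite -ball_normE.
Qed.

(** * Symmetry of second derivatives *)

Section clairaut.
Context {R : realType} {V : normedModType R}.
Implicit Types (U : set V) (f : V -> R).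

(** The mean value theorem is used twice: in direction [u] for the difference of [f] along two
    parallel segments, then in direction [v] for ['D_u f]. *)
Lemma second_difference U f (x u v : V) (s : R) : 0 < s -> Ck_on 2 U f ->
  (forall a b, 0 <= a <= s -> 0 <= b <= s -> U (x + a *: u + b *: v)) ->
  exists a b, [/\ 0 <= a <= s, 0 <= b <= s &
    f (x + s *: u + s *: v) - f (x + s *: u) - f (x + s *: v) + f x =
    s * s * 'D_v ('D_u f) (x + a *: u + b *: v)].
Proof.
move=> s0 [df /(_ u)[ddf _]] Uab; have sge0 := ltW s0.
pose G a := f ((x + s *: v) + a *: u) - f (x + a *: u).
pose dG a := 'D_u f ((x + s *: v) + a *: u) - 'D_u f (x + a *: u).
have U1 a : 0 <= a <= s -> U (x + a *: u).
  by move=> /(Uab a 0); rewrite lexx sge0 scale0r addr0; exact.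
have U2 a : 0 <= a <= s -> U ((x + s *: v) + a *: u).
  by move=> /(Uab a s); rewrite lexx sge0 addrAC; exact.
have GdG (a : R) : 0 <= a <= s -> is_derive a 1 G (dG a).
  move=> a0s; apply: is_deriveB; apply: is_derive_line; apply: df.
    exact: U2.
  exact: U1.
have cont (h dh : R -> R) : (forall a : R, 0 <= a <= s -> is_derive a 1 h (dh a)) ->
    {within `[0, s], continuous h}.
  move=> hdh; apply: derivable_within_continuous => a.
  by rewrite in_itv/= => /hdh[].
have oo (a : R) : a \in `]0, s[ -> 0 <= a <= s.
  by rewrite in_itv/= => /andP[/ltW -> /ltW ->].
have [a aos GE] := MVT s0 (fun a aos => GdG a (oo a aos)) (cont _ _ GdG).
pose K b := 'D_u f (x + a *: u + b *: v).
have KdK (b : R) : 0 <= b <= s -> is_derive b 1 K ('D_v ('D_u f) (x + a *: u + b *: v)).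
  by move=> b0s; apply: is_derive_line; apply: ddf; apply: Uab => //; exact: oo.
have [b bos KE] := MVT s0 (fun b bos => KdK b (oo b bos)) (cont _ _ KdK).
exists a, b; split; [exact: oo|exact: oo|].
move: GE KE; rewrite /G /K /dG !scale0r !addr0 subr0 !(addrAC x (s *: v)).
move=> GE KE; have -> : s * s * 'D_v ('D_u f) (x + a *: u + b *: v) =
  ('D_v ('D_u f) (x + a *: u + b *: v) * s) * s by ring.
by rewrite -KE -GE; ring.
Qed.

Lemma near_continuous2 U (A B : V -> R) x d : open U -> U x ->
  {for x, continuous A} -> {for x, continuous B} -> 0 < d ->
  exists2 r : R, 0 < r &
    forall z, `|x - z| < r -> [/\ U z, `|A x - A z| < d & `|B x - B z| < d].
Proof.
move=> oU Ux cA cB d0; have nU : nbhs x U by exact: open_nbhs_nbhs.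
move/cvgrPdist_lt : cA => /(_ d d0) cA; move/cvgrPdist_lt : cB => /(_ d d0) cB.
apply: near_normP.
by apply: filterS (filterI nU (filterI cA cB)) => z [? [? ?]].
Qed.

Lemma eq_of_near_values U (A B : V -> R) x u v : open U -> U x ->
  {for x, continuous A} -> {for x, continuous B} ->
  (forall s : R, 0 < s ->
    (forall a b, 0 <= a <= s -> 0 <= b <= s -> U (x + a *: u + b *: v)) ->
    exists a b a' b', [/\ 0 <= a <= s, 0 <= b <= s, 0 <= a' <= s, 0 <= b' <= s &
      B (x + a *: u + b *: v) = A (x + a' *: v + b' *: u)]) ->
  A x = B x.
Proof.
move=> oU Ux cA cB AB.
apply/eqP; rewrite -subr_eq0 -normr_le0; apply/ler_addgt0Pl => e e0.
rewrite addr0; pose d := e / 2; have d0 : 0 < d by rewrite divr_gt0.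
have [r r0 rP] := near_continuous2 oU Ux cA cB d0.
(* The summand 1 keeps [N] positive when [u = v = 0]; the parallelogram with parameters up to
   [r / N] lies in the ball of radius [r]. *)
pose N := `|u| + `|v| + 1; have N0 : 0 < N by rewrite ltr_wpDl// addr_ge0.
pose s := r / N; have s0 : 0 < s by rewrite divr_gt0.
have close a b : 0 <= a <= s -> 0 <= b <= s -> `|x - (x + a *: u + b *: v)| < r.
  move=> /andP[a0 as_] /andP[b0 bs].
  have -> : x - (x + a *: u + b *: v) = - (a *: u + b *: v).
    by rewrite -addrA opprD addrA subrr add0r.
  rewrite normrN (le_lt_trans (ler_normD _ _))// !normrZ (ger0_norm a0) (ger0_norm b0).
  have -> : r = s * N by rewrite /s divfK// gt_eqF.
  apply: (@le_lt_trans _ _ (s * (`|u| + `|v|))).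
    by rewrite mulrDr lerD// ler_wpM2r.
  by rewrite ltr_pM2l// /N ltrDl.
have Uab a b : 0 <= a <= s -> 0 <= b <= s -> U (x + a *: u + b *: v).
  by move=> a0s b0s; have [] := rP _ (close a b a0s b0s).
have [a [b [a' [b' [a0s b0s a0s' b0s' E]]]]] := AB s s0 Uab.
have [_ _ P1] := rP _ (close a b a0s b0s).
have := close b' a' b0s' a0s'; rewrite (addrAC x (b' *: u)) => /rP[_ P2 _].
rewrite -E in P2; have -> : e = d + d by rewrite /d; lra.
apply: ltW; apply: le_lt_trans (ltrD P2 P1); rewrite (distrC (B x)).
exact: ler_distD.
Qed.

(** The second difference is symmetric in [u] and [v], so on each small parallelogram the two mixed
    derivatives have a common value, possibly at different points; continuity at [x] does the
    rest. *)
Lemma clairaut U f (x u v : V) : open U -> Ck_on 2 U f -> U x ->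
  'D_u ('D_v f) x = 'D_v ('D_u f) x.
Proof.
move=> oU Cf Ux; have [df Df] := Cf.
refine (@eq_of_near_values U ('D_u ('D_v f)) ('D_v ('D_u f)) x u v oU Ux _ _ _).
- by have [_ /(_ u)] := Df v; apply.
- by have [_ /(_ v)] := Df u; apply.
move=> s s0 Uab.
have [a [b [a0s b0s Eab]]] := second_difference s0 Cf Uab.
have [|a' [b' [a0s' b0s' Eab']]] := @second_difference U f x v u s s0 Cf.
  by move=> a' b' a0s' b0s'; rewrite addrAC; exact: Uab.
exists a, b, a', b'; split; [exact: a0s|exact: b0s|exact: a0s'|exact: b0s'|].
have ss : s * s != 0 by rewrite mulf_neq0// gt_eqF.
have sym : f (x + s *: u + s *: v) - f (x + s *: u) - f (x + s *: v) + f x =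
    f (x + s *: v + s *: u) - f (x + s *: v) - f (x + s *: u) + f x.
  by rewrite (addrAC x (s *: v)); congr (_ + _); rewrite -!addrA; congr (_ + _); rewrite addrC.
exact: (mulfI ss (etrans (esym Eab) (etrans sym Eab'))).
Qed.

End clairaut.
(* Otherwise unification unfolds derivatives to limits and diverges. *)
Opaque derive diff.

(** * Lie derivatives, commutators and the Jacobi identity *)

Definition lie (R : realType) (n : nat) (W : normedModType R)
    (f : 'rV[R]_n -> 'rV[R]_n) (g : 'rV[R]_n -> W) : 'rV[R]_n -> W :=
  fun x => 'd g x (f x).

Definition br (R : realType) (n : nat) (f g : 'rV[R]_n -> 'rV[R]_n) :
    'rV[R]_n -> 'rV[R]_n :=
  fun x => lie f g x - lie g f x.

Section lie_derivative.
Context {R : realType} {n : nat}.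
Local Notation V := 'rV[R]_n.
Local Notation e_ i := (delta_mx (0 : 'I_1) i : V).
Implicit Types (U : set V) (f g h : V -> V).

(** Regularity is assumed for derivatives in fixed directions; the expansion along the basis reaches
    directions that vary with the point, as in [lie]. *)
Lemma diff_row_sum (W : normedModType R) (g : V -> W) x (v : V) :
  differentiable g x -> 'd g x v = \sum_i v 0 i *: 'D_(e_ i) g x.
Proof.
move=> dg; rewrite {1}(row_sum_delta v) linear_sum.
by apply: eq_bigr => i _; rewrite linearZ deriveE.
Qed.

Lemma lie_coord m f (g : V -> 'rV[R]_m) x j : differentiable g x ->
  lie f g x 0 j = lie f (fun x => g x 0 j) x.
Proof.
move=> dg; have dgj : differentiable (fun x => g x 0 j) x.
  apply: (@differentiable_comp _ _ _ _ g (fun v : 'rV_m => v 0 j)) => //.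
  exact: differentiable_coord.
rewrite /lie -!deriveE//.
have /derivableP := diff_derivable (v := f x) dg.
by move=> /(is_derive_coord j)[].
Qed.

Lemma Ck_on_lie m k U f (g : V -> 'rV[R]_m) : open U -> Ck_on k U f -> Ck_on k.+1 U g ->
  Ck_on k U (lie f g).
Proof.
move=> oU Cf [dg Dg].
apply: (@Ck_on_ext _ _ _ _ _ (fun x => \sum_i f x 0 i *: 'D_(e_ i) g x)) => //.
  by move=> x Ux; rewrite -diff_row_sum//; exact: dg.
apply: Ck_on_sum => // i; apply: Ck_on_row => // j.
apply: (@Ck_on_ext _ _ _ _ _ ((fun x => f x 0 i) \* (fun x => 'D_(e_ i) g x 0 j))) => //.
  by move=> x Ux; rewrite mxE.
by apply: Ck_onM => //; apply: Ck_on_coord => //; exact: Dg.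
Qed.

Lemma smooth_on_lie m U f (g : V -> 'rV[R]_m) : open U -> smooth_on U f -> smooth_on U g ->
  smooth_on U (lie f g).
Proof. by move=> oU sf sg k; apply: Ck_on_lie. Qed.

Lemma smooth_on_br U f g : open U -> smooth_on U f -> smooth_on U g ->
  smooth_on U (br f g).
Proof.
move=> oU sf sg k.
have Cfg := smooth_on_lie oU sf sg k.
have Cgf := smooth_on_lie oU sg sf k.
apply: (@Ck_on_ext _ _ _ _ _ (lie f g \+ (-1 \*: lie g f))) => //.
  by move=> x _; rewrite /= scaleN1r.
by apply: Ck_onD => //; exact: Ck_onZ.
Qed.

Lemma smooth_differentiable (W : normedModType R) U (g : V -> W) x :
  smooth_on U g -> U x -> differentiable g x.
Proof. by move=> /(_ 1%N)[dg _]; exact: dg. Qed.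

Lemma lie_lie U f g (phi : V -> R) x : open U -> U x -> smooth_on U f ->
  smooth_on U g -> smooth_on U phi ->
  lie f (lie g phi) x = 'd ('D_(f x) phi) x (g x) + 'd phi x (lie f g x).
Proof.
move=> oU Ux sf sg sphi.
have [dphi Dphi] := sphi 2.
have dDphi v : differentiable ('D_v phi) x by have [dD _] := Dphi v; exact: dD.
pose F i := (fun x => g x 0 i) \* 'D_(e_ i) phi.
have dgi i : differentiable (fun x => g x 0 i) x.
  have [+ _] := Ck_on_coord i oU (sg 1%N); exact.
have lieE : {near x, lie g phi =1 \sum_i F i}.
  apply: near_eq_open oU Ux _ => z Uz.
  by rewrite fct_sumE /lie diff_row_sum//; exact: dphi.
have dF i : is_derive x (f x) (F i)
    (g x 0 i *: 'D_(f x) ('D_(e_ i) phi) x + 'D_(e_ i) phi x *: 'D_(f x) (fun x => g x 0 i) x).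
  apply: is_deriveM.
    exact/derivableP/diff_derivable.
  exact/derivableP/diff_derivable.
have dlie : differentiable (lie g phi) x.
  apply: (@near_eq_differentiable _ _ _ (\sum_i F i)).
    by apply: filterS lieE => z ->.
  by apply: differentiable_sum => i; exact: differentiableM.
rewrite {1}/lie -deriveE// (near_eq_derive _ lieE).
have -> := @derive_val _ _ _ _ _ _ _ (is_derive_sum dF).
rewrite big_split/= (diff_row_sum _ (dDphi _)) (diff_row_sum _ (dphi x Ux)).
refine (f_equal2 (fun a b => a + b) (eq_bigr _ _) (eq_bigr _ _)) => i _.
  exact: (f_equal2 (fun a b => a *: b) erefl (clairaut _ _ oU (sphi 2) Ux)).
rewrite [LHS]mulrC lie_coord; last exact: smooth_differentiable sg Ux.
by rewrite (deriveE _ (dgi i)).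
Qed.

Lemma lie_commutator U f g m (phi : V -> 'rV[R]_m) x : open U -> U x ->
  smooth_on U f -> smooth_on U g -> smooth_on U phi ->
  lie f (lie g phi) x - lie g (lie f phi) x = lie (br f g) phi x.
Proof.
move=> oU Ux sf sg sphi; apply/rowP => j.
have dphi z : U z -> differentiable phi z by exact: smooth_differentiable.
have sj : smooth_on U (fun x => phi x 0 j) by move=> k; exact: Ck_on_coord.
have E f' g' : smooth_on U f' -> smooth_on U g' ->
    lie f' (lie g' phi) x 0 j = lie f' (lie g' (fun x => phi x 0 j)) x.
  move=> sf' sg'; rewrite lie_coord; last first.
    exact: smooth_differentiable (smooth_on_lie oU sg' sphi) Ux.
  have dl : {near x, (fun x => lie g' phi x 0 j) =1 lie g' (fun x => phi x 0 j)}.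
    by apply: near_eq_open oU Ux _ => z Uz; rewrite lie_coord//; exact: dphi.
  have d1 : differentiable (fun x => lie g' phi x 0 j) x.
    apply: smooth_differentiable Ux => k; apply: Ck_on_coord => //.
    exact: smooth_on_lie.
  have d2 := near_eq_differentiable dl d1.
  exact: etrans (esym (deriveE (f' x) d1)) (etrans (near_eq_derive (f' x) dl) (deriveE (f' x) d2)).
rewrite !mxE !E// (lie_lie oU Ux sf sg sj) (lie_lie oU Ux sg sf sj).
rewrite lie_coord; last exact: dphi.
have dj : differentiable (fun x => phi x 0 j) x by exact: smooth_differentiable sj Ux.
have [_ Dj] := sj 2.
have dDj v : differentiable ('D_v (fun x => phi x 0 j)) x by have [+ _] := Dj v; exact.
have sym : 'd ('D_(f x) (fun x => phi x 0 j)) x (g x) =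
           'd ('D_(g x) (fun x => phi x 0 j)) x (f x).
  have C := clairaut (f x) (g x) oU (sj 2) Ux.
  exact: etrans (esym (deriveE (g x) (dDj (f x)))) (etrans (esym C) (deriveE (f x) (dDj (g x)))).
have cancel (a b c d : R) : a = c -> (a + b) - (c + d) = b - d by move=> ->; ring.
have rhs : lie (br f g) (fun x => phi x 0 j) x =
  'd (fun x => phi x 0 j) x (lie f g x) - 'd (fun x => phi x 0 j) x (lie g f x).
  exact: linearB.
exact: etrans (cancel _ _ _ _ sym) (esym rhs).
Qed.

(** The terms [lie (br _ _) _] expand by [lie_commutator], the terms [lie _ (br _ _)] by linearity;
    the six expressions of the form [lie a (lie b c)] then cancel. *)
Lemma br_jacobi U f g h x : open U -> U x ->
  smooth_on U f -> smooth_on U g -> smooth_on U h ->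
  br (br f g) h x = br f (br g h) x - br g (br f h) x.
Proof.
move=> oU Ux sf sg sh.
have lieB (a b c : V -> V) : smooth_on U b -> smooth_on U c ->
    lie a (br b c) x = lie a (lie b c) x - lie a (lie c b) x.
  move=> sb sc; rewrite /lie; have := @diffB _ _ _ (lie b c) (lie c b) x
     (smooth_differentiable (smooth_on_lie oU sb sc) Ux)
     (smooth_differentiable (smooth_on_lie oU sc sb) Ux).
  by move=> /(congr1 (fun u => u (a x))).
pose sub2 (a b : V) := a - b.
have c1 := lie_commutator oU Ux sf sg sh.
have c2 := lie_commutator oU Ux sg sh sf.
have c3 := lie_commutator oU Ux sf sh sg.
have l1 := lieB h f g sf sg.
have l2 := lieB f g h sg sh.
have l3 := lieB g f h sf sh.
refine (etrans (f_equal2 sub2 (esym c1) l1) _).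
refine (etrans _ (esym (f_equal2 sub2 (f_equal2 sub2 l2 (esym c2))
  (f_equal2 sub2 l3 (esym c3))))).
rewrite /sub2.
move: (lie f (lie g h) x) (lie g (lie f h) x) (lie h (lie f g) x) (lie h (lie g f) x)
  (lie f (lie h g) x) (lie g (lie h f) x) => u1 u2 u3 u4 u5 u6.
by apply/rowP => j; rewrite !mxE; ring.
Qed.

End lie_derivative.

(** * Uniform second-order bounds *)

Section tame_fields.
Context {R : realType} {n : nat}.
Local Notation V := 'rV[R]_n.
Local Notation e_ i := (delta_mx (0 : 'I_1) i : V).

(** What the flow and commutator estimates use of smoothness, on one ball and with a single
    constant, so that errors become monomials in [C]. Bounds on the differential are stated on
    vectors, without an operator norm. *)
Record tame (z0 : V) (r C : R) (f : V -> V) : Prop := Tame {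
  tame_differentiable : forall x, `|x - z0| < r -> differentiable f x;
  tame_bounded : forall x, `|x - z0| < r -> `|f x| <= C;
  tame_lipschitz : forall x y, `|x - z0| < r -> `|y - z0| < r ->
    `|f y - f x| <= C * `|y - x|;
  tame_diff_bounded : forall x h, `|x - z0| < r -> `|'d f x h| <= C * `|h|;
  tame_diff_lipschitz : forall x y h, `|x - z0| < r -> `|y - z0| < r ->
    `|'d f y h - 'd f x h| <= C * `|y - x| * `|h|;
  tame_taylor : forall x y, `|x - z0| < r -> `|y - z0| < r ->
    `|f y - f x - 'd f x (y - x)| <= C * `|y - x| ^+ 2
}.

Lemma tame_weaken z0 r r' C C' f : r' <= r -> 0 <= C -> C <= C' -> tame z0 r C f -> tame z0 r' C' f.
Proof.
move=> rr C0 CC [df bf lf bdf ldf tf].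
have B x : `|x - z0| < r' -> `|x - z0| < r by move=> /lt_le_trans; exact.
split=> [x /B/df//|x /B/bf/le_trans|x y /B bx /B by_|x h /B bx|x y h /B bx /B by_|x y /B bx /B by_].
- exact.
- by apply: le_trans (lf _ _ bx by_) _; rewrite ler_wpM2r.
- by apply: le_trans (bdf _ _ bx) _; rewrite ler_wpM2r.
- by apply: le_trans (ldf _ _ _ bx by_) _; rewrite !ler_wpM2r.
- by apply: le_trans (tf _ _ bx by_) _; rewrite ler_wpM2r// exprn_ge0.
Qed.

Lemma segment_ball (z0 x y : V) (r t : R) :
  `|x - z0| < r -> `|y - z0| < r -> 0 <= t <= 1 -> `|x + t *: (y - x) - z0| < r.
Proof.
move=> xr yr /andP[t0 t1].
have -> : x + t *: (y - x) - z0 = (1 - t) *: (x - z0) + t *: (y - z0).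
  by apply/rowP => j; rewrite !mxE; ring.
apply: le_lt_trans (ler_normD _ _) _; rewrite !normrZ (ger0_norm t0) ger0_norm ?subr_ge0//.
have [->|tn0] := eqVneq t 0; first by rewrite mul0r addr0 subr0 mul1r.
have t0' : 0 < t by rewrite lt_neqAle eq_sym tn0.
have -> : r = (1 - t) * r + t * r by ring.
by apply: ler_ltD; [rewrite ler_wpM2l ?subr_ge0// ltW|rewrite ltr_pM2l].
Qed.

Lemma diff_le_partial m (f : V -> 'rV[R]_m) x (B : R) h : differentiable f x ->
  (forall i, `|'D_(e_ i) f x| <= B) -> `|'d f x h| <= n%:R * B * `|h|.
Proof.
move=> df fB; rewrite diff_row_sum//; apply: le_trans (ler_norm_sum _ _ _) _.
apply: (@le_trans _ _ (\sum_(i < n) B * `|h|)); last first.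
  by rewrite sumr_const card_ord -mulrA mulr_natl.
apply: ler_sum => i _; rewrite normrZ mulrC.
by apply: ler_pM => //; exact: norm_coord_le.
Qed.

(** The free vector serves two purposes: [w = 0] gives Lipschitz bounds, [w = 'd f x (y - x)] gives
    the Taylor bound. *)
Lemma segment_mean_value m (f : V -> 'rV[R]_m) z0 r x y (w : 'rV[R]_m) B : 0 <= B ->
  (forall x, `|x - z0| < r -> differentiable f x) ->
  `|x - z0| < r -> `|y - z0| < r ->
  (forall t : R, 0 <= t <= 1 -> `|'d f (x + t *: (y - x)) (y - x) - w| <= B) ->
  `|f y - f x - w| <= B.
Proof.
move=> B0 df xr yr dB; pose v := y - x.
have line (t : R) : 0 <= t <= 1 -> is_derive t 1 (fun t => f (x + t *: v)) ('d f (x + t *: v) v).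
  move=> t01; have dft : differentiable f (x + t *: v) by apply: df; exact: segment_ball.
  by rewrite -(deriveE v dft); exact: is_derive_line.
have oo (t : R) : t \in `]0, 1[ -> 0 <= t <= 1.
  by rewrite in_itv/= => /andP[/ltW -> /ltW ->].
have := @mean_value_linear_le _ _ (fun t => f (x + t *: v)) _ w 0 1 B ler01 B0 _
  (fun t t01 => line t (oo t t01)) (fun t t01 => dB t (oo t t01)).
rewrite scale1r subr0 scale1r scale0r addr0 mulr1 /v subrKC; apply.
apply: derivable_within_continuous => t; rewrite in_itv/= => t01.
by have [] := line t t01.
Qed.

Lemma lipschitz_of_partial m (f : V -> 'rV[R]_m) z0 r B x y : 0 <= B ->
  (forall x, `|x - z0| < r -> differentiable f x) ->
  (forall x i, `|x - z0| < r -> `|'D_(e_ i) f x| <= B) ->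
  `|x - z0| < r -> `|y - z0| < r -> `|f y - f x| <= n%:R * B * `|y - x|.
Proof.
move=> B0 df fB xr yr; rewrite -[X in `|X|]subr0.
apply: (segment_mean_value _ df) => //; first by rewrite !mulr_ge0.
move=> t t01; rewrite subr0; have xt := segment_ball xr yr t01.
by apply: diff_le_partial => [|i]; [exact: df|exact: fB].
Qed.

Lemma near_bound (W : normedModType R) (f : V -> W) z0 : {for z0, continuous f} ->
  \forall z \near z0, `|f z| <= `|f z0| + 1.
Proof.
move=> /cvgrPdist_lt/(_ 1 ltr01); apply: filterS => z fz.
rewrite -lerBlDl; apply: ltW; apply: le_lt_trans fz.
by rewrite distrC; exact: lerB_dist.
Qed.

Lemma le_sum_term (I : finType) (F : I -> R) i : (forall i, 0 <= F i) -> F i <= \sum_i F i.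
Proof. by move=> F0; rewrite (bigD1 i)//= lerDl sumr_ge0. Qed.

(** Continuity at [z0] bounds the finitely many first and second partial derivatives near [z0]. The
    second ones make the first ones, hence the differential, Lipschitz; the Taylor bound follows
    along segments. *)
Lemma smooth_tame U (f : V -> V) z0 : open U -> U z0 -> smooth_on U f ->
  exists r C, [/\ 0 < r, 1 <= C, (forall x, `|x - z0| < r -> U x) & tame z0 r C f].
Proof.
move=> oU Uz0 sf.
have [df Df] := sf 2.
have dDf v x : U x -> differentiable ('D_v f) x by have [+ _] := Df v; exact.
have cDD v w : {for z0, continuous ('D_w ('D_v f))} by have [_ /(_ w)] := Df v; apply.
pose B1 := \sum_i (`|'D_(e_ i) f z0| + 1).
pose B2 := \sum_i \sum_j (`|'D_(e_ j) ('D_(e_ i) f) z0| + 1).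
have B1ge i : `|'D_(e_ i) f z0| + 1 <= B1.
  by apply: (le_sum_term (F := fun i => `|'D_(e_ i) f z0| + 1)) => k; rewrite addr_ge0.
have B2ge i j : `|'D_(e_ j) ('D_(e_ i) f) z0| + 1 <= B2.
  pose F i j := `|'D_(e_ j) ('D_(e_ i) f) z0| + 1.
  have F0 i' j' : 0 <= F i' j' by rewrite addr_ge0.
  apply: (@le_trans _ _ (\sum_j F i j)).
    exact: (le_sum_term (F := F i)).
  by apply: (le_sum_term (F := fun i => \sum_j F i j)) => k; exact: sumr_ge0.
have B10 : 0 <= B1 by apply: sumr_ge0 => i _; exact: addr_ge0 (normr_ge0 _) ler01.
have B20 : 0 <= B2.
  by apply: sumr_ge0 => i _; apply: sumr_ge0 => j _; exact: addr_ge0 (normr_ge0 _) ler01.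
move: B1 B2 B1ge B2ge B10 B20 => B1 B2 B1ge B2ge B10 B20.
have n1 : \forall z \near z0, forall i, `|'D_(e_ i) f z| <= B1.
  apply: (@filter_forall _ _ (fun i z => `|'D_(e_ i) f z| <= B1) (nbhs z0)) => i.
  have := near_bound (differentiable_continuous (dDf (e_ i) z0 Uz0)).
  by apply: filterS => z /le_trans; apply; exact: B1ge.
have n2 : \forall z \near z0, forall i j, `|'D_(e_ j) ('D_(e_ i) f) z| <= B2.
  apply: (@filter_forall _ _ (fun i z => forall j, `|'D_(e_ j) ('D_(e_ i) f) z| <= B2) (nbhs z0)) => i.
  apply: (@filter_forall _ _ (fun j z => `|'D_(e_ j) ('D_(e_ i) f) z| <= B2) (nbhs z0)) => j.
  have := near_bound (cDD (e_ i) (e_ j)).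
  by apply: filterS => z /le_trans; apply; exact: B2ge.
have n0 := near_bound (differentiable_continuous (df z0 Uz0)).
have nU : nbhs z0 U by exact: open_nbhs_nbhs.
have [r r0 rP] := near_normP (filterI (filterI nU n0) (filterI n1 n2)).
have rP' x : `|x - z0| < r -> (U x /\ `|f x| <= `|f z0| + 1) /\
   ((forall i, `|'D_(e_ i) f x| <= B1) /\ (forall i j, `|'D_(e_ j) ('D_(e_ i) f) x| <= B2)).
  by rewrite distrC => /rP[[? ?] [? ?]].
have rU x : `|x - z0| < r -> U x by move=> /rP'[[]].
pose C1 := n%:R * B1; pose C2 := n%:R * (n%:R * B2).
have C10 : 0 <= C1 by rewrite mulr_ge0.
have C20 : 0 <= C2 by rewrite !mulr_ge0.
pose C := (`|f z0| + 1) + C1 + C2.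
have CC1 : C1 <= C by rewrite /C; have := normr_ge0 (f z0); lra.
have CC2 : C2 <= C by rewrite /C; have := normr_ge0 (f z0); lra.
have CC0 : `|f z0| + 1 <= C by rewrite /C; have := normr_ge0 (f z0); lra.
have ld x y h : `|x - z0| < r -> `|y - z0| < r ->
    `|'d f y h - 'd f x h| <= C2 * `|y - x| * `|h|.
  move=> xr yr; have dx := df _ (rU _ xr); have dy := df _ (rU _ yr).
  have E := f_equal2 (fun a b : V => a - b) (diff_row_sum h dy) (diff_row_sum h dx).
  rewrite E; move: E => _.
  rewrite -sumrB; apply: le_trans (ler_norm_sum _ _ _) _.
  apply: (@le_trans _ _ (\sum_(i < n) (n%:R * B2 * `|y - x|) * `|h|)); last first.
    by rewrite sumr_const card_ord -[leLHS]mulr_natl /C2 !mulrA.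
  apply: ler_sum => i _; rewrite -scalerBr normrZ mulrC.
  apply: ler_pM => //; last exact: norm_coord_le.
  refine (@lipschitz_of_partial _ ('D_(e_ i) f) z0 r B2 x y B20 _ _ xr yr) => [z|z j] zr.
    exact: dDf (rU z zr).
  by have [_ [_ fB]] := rP' z zr; exact: fB.
exists r, C; split=> //.
  by rewrite (le_trans _ CC0)// lerDr.
split.
- by move=> x /rU/df.
- by move=> x /rP'[[_ h] _]; exact: le_trans h CC0.
- move=> x y xr yr; apply: (@le_trans _ _ (C1 * `|y - x|)); last by rewrite ler_wpM2r.
  refine (@lipschitz_of_partial _ f z0 r B1 x y B10 _ _ xr yr) => [z|z j] zr.
    exact: df (rU z zr).
  by have [_ [fB _]] := rP' z zr; exact: fB.
- move=> x h xr; apply: (@le_trans _ _ (C1 * `|h|)); last by rewrite ler_wpM2r.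
  by apply: diff_le_partial (df x (rU x xr)) _; have [_ [+ _]] := rP' _ xr.
- by move=> x y h xr yr; apply: le_trans (ld _ _ _ xr yr) _; rewrite !ler_wpM2r.
- move=> x y xr yr; apply: (@le_trans _ _ (C2 * `|y - x| ^+ 2)); last first.
    by rewrite ler_wpM2r// exprn_ge0.
  apply: (segment_mean_value _ (fun x xr => df x (rU x xr)) xr yr).
    by rewrite mulr_ge0// exprn_ge0.
  move=> t t01; apply: le_trans (ld _ _ _ xr (segment_ball xr yr t01)) _.
  have -> : x + t *: (y - x) - x = t *: (y - x) by rewrite [LHS]addrAC subrr add0r.
  case/andP: t01 => t0 t1; rewrite normrZ (ger0_norm t0) expr2 [leRHS]mulrA.
  by apply: ler_wpM2r => //; apply: ler_wpM2l => //; exact: ler_piMl.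
Qed.

End tame_fields.
(** * Ordinary differential equations *)

Lemma geometric_cvg (R : realType) n (u : nat -> 'rV[R]_n) (M : R) :
  (forall k, `|u k.+1 - u k| <= M / 2 ^+ k) ->
  exists l, forall k, `|l - u k| <= 2 * M / 2 ^+ k.
Proof.
move=> uM; have p2 k : (0 : R) < 2 ^+ k by rewrite exprn_gt0.
have M0 : 0 <= M by have := le_trans (normr_ge0 _) (uM 0); rewrite expr0 divr1.
have pos k : 0 <= 2 * M / 2 ^+ k by apply: divr_ge0; [exact: mulr_ge0|exact: ltW].
(* Subtracting the tail makes the geometric bound inductive in [m]. *)
have um m k : `|u (k + m)%N - u k| <= 2 * M / 2 ^+ k - 2 * M / 2 ^+ (k + m).
  elim: m => [|m IH]; first by rewrite addn0 !subrr normr0.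
  rewrite addnS; apply: le_trans (ler_distD (u (k + m)%N) _ _) _.
  apply: le_trans (lerD (uM _) IH) _.
  rewrite exprS; have := p2 (k + m)%N => q0.
  have -> : 2 * M / (2 * 2 ^+ (k + m)) = M / 2 ^+ (k + m).
    by rewrite -mulf_div divff ?mul1r.
  lra.
have um' m k : (k <= m)%N -> `|u m - u k| <= 2 * M / 2 ^+ k.
  move=> km; rewrite -(subnKC km); apply: le_trans (um _ _) _.
  by rewrite gerBl; exact: pos.
have small (e : R) : 0 < e -> exists k, 2 * M / 2 ^+ k < e.
  move=> e0; have : (fun k => 2 * M / 2 ^+ k) @ \oo --> (0 : R).
    rewrite -[X in _ --> X](mulr0 (2 * M)).
    apply: cvgZl_tmp; under eq_fun do rewrite -exprVn.
    by apply: cvg_expr; rewrite ger0_norm ?invr_ge0// invf_lt1// ltr1n.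
  move=> /cvgrPdist_lt/(_ e e0)[k _ /(_ k (leqnn _))].
  by rewrite sub0r normrN (ger0_norm (pos k)); exists k.
have cu : cvg (u @ \oo).
  apply: cauchy_cvg; apply: cauchy_exP => e e0.
  have [k ke] := small e e0; exists (u k).
  exists k => // m /= km; rewrite -ball_normE /= distrC.
  exact: le_lt_trans (um' _ _ km) ke.
exists (lim (u @ \oo)) => k; apply/ler_addgt0Pl => e e0.
move/cvgrPdist_le : cu => /(_ e e0)[m _ mP].
apply: le_trans (ler_distD (u (maxn m k)) _ _) _; apply: lerD.
  by apply: mP => /=; exact: leq_maxl.
by apply: um'; exact: leq_maxr.
Qed.

Lemma cvg_row (R : realType) m (T : Type) (F : set_system T) (FF : Filter F)
    (f : T -> 'rV[R]_m) (l : 'rV[R]_m) :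
  (forall j, (f x 0 j) @[x --> F] --> l 0 j) -> f @ F --> l.
Proof.
move=> fl; apply/cvgrPdist_le => e e0.
have : \forall x \near F, forall j, `|l 0 j - f x 0 j| <= e.
  apply: (@filter_forall _ _ (fun j x => `|l 0 j - f x 0 j| <= e) F) => j.
  by have /cvgrPdist_le/(_ e e0) := fl j.
apply: filterS => x fx; apply: norm_row_le; first exact: ltW.
by move=> j; rewrite !mxE.
Qed.

(** * Primitives of vector-valued functions *)

Section primitive.
Context {R : realType} {n : nat}.
Local Notation V := 'rV[R]_n.
Local Notation mu := (@lebesgue_measure R).

(** The integral from [c] to [t], taken as a difference of integrals from [a] so that [t] may lie on
    either side of [c]; Picard iteration takes [a = - T] and [c = 0]. *)
Definition primitive (a c : R) (f : R -> V) (t : R) : V :=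
  \row_j (parameterized_integral mu a t (fun s => f s 0 j) -
          parameterized_integral mu a c (fun s => f s 0 j)).

Lemma primitive0 a c f : primitive a c f c = 0.
Proof. by apply/rowP => j; rewrite !mxE subrr. Qed.

Variables (a b c : R) (f : R -> V).
Hypotheses (ab : a < b) (cf : {within `[a, b], continuous f}).

Let intf j : mu.-integrable `[a, b] (EFin \o (fun s => f s 0 j)).
Proof.
apply: continuous_compact_integrable; first exact: segment_compact.
exact: continuous_coord_within.
Qed.

Lemma primitive_derive t : t \in `]a, b[ -> is_derive t 1 (primitive a c f) (f t).
Proof.
move=> tab; apply: is_derive_row => j.
have := tab; rewrite in_itv/= => /andP[a_t tb].
have [] := continuous_FTC1_closed tb (intf j) a_t
  (within_continuous_continuous ab (@continuous_coord_within _ _ _ j _ cf) tab).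
rewrite derive1E => dF FE.
rewrite (_ : (fun x => _) = (fun x => parameterized_integral mu a x (fun s => f s 0 j)) -
   cst (parameterized_integral mu a c (fun s => f s 0 j))); last first.
  by apply/funext => s; rewrite mxE.
rewrite -FE -[X in is_derive _ _ _ X]subr0.
by apply: is_deriveB; exact: derivableP.
Qed.

Lemma primitive_continuous : {within `[a, b], continuous (primitive a c f)}.
Proof.
move=> t; apply: cvg_row => j.
rewrite (_ : (fun x => _) = (fun x => parameterized_integral mu a x (fun s => f s 0 j)
   - parameterized_integral mu a c (fun s => f s 0 j))); last first.
  by apply/funext => s; rewrite mxE.
rewrite [X in _ --> X]mxE; apply: cvgB; last exact: cvg_cst.
exact: (parameterized_integral_continuous (ltW ab) (intf j)).
Qed.

End primitive.

(** * Picard iteration *)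

Section picard.
Context {R : realType} {n : nat}.
Local Notation V := 'rV[R]_n.

(** Solutions are followed forward and backward from [s]. The derivative is bounded only at times no
    further from [s] than [t], which is what yields quadratic remainders. *)
Lemma mean_value_linear_sym (p dp : R -> V) (w : V) (a b B s t : R) : 0 <= B ->
  {within `[a, b], continuous p} ->
  (forall r, r \in `]a, b[ -> is_derive r 1 p (dp r)) ->
  s \in `[a, b] -> t \in `[a, b] ->
  (forall r, r \in `]a, b[ -> `|r - s| <= `|t - s| -> `|dp r - w| <= B) ->
  `|p t - p s - (t - s) *: w| <= B * `|t - s|.
Proof.
move=> B0 cp dpP; rewrite !in_itv/= => /andP[sa sb] /andP[ta tb] dpB.
have sub (c d : R) : a <= c -> d <= b -> {within `[c, d], continuous p} /\
    forall r, r \in `]c, d[ -> (c < r < d) /\ (r \in `]a, b[).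
  move=> ac db; split.
    by apply: continuous_subspaceW cp; apply: subset_itv; rewrite bnd_simp.
  move=> r; rewrite !in_itv/= => /andP[cr rd].
  by rewrite (le_lt_trans ac cr) (lt_le_trans rd db) cr rd.
have [st|/ltW ts] := leP s t.
  have [cst ost] := sub s t sa tb; rewrite (@ger0_norm _ (t - s)) ?subr_ge0//.
  have dst r : r \in `]s, t[ -> is_derive r 1 p (dp r) by move=> /ost[_ /dpP].
  have Bst r : r \in `]s, t[ -> `|dp r - w| <= B.
    move=> /ost[/andP[sr rt] rab].
    apply: dpB => //; rewrite (@ger0_norm _ (r - s)) ?subr_ge0 ?(ltW sr)//.
    by rewrite (@ger0_norm _ (t - s)) ?subr_ge0// lerD2r ltW.
  by apply (mean_value_linear_le st B0 cst dst Bst).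
have [cst ost] := sub t s ta sb; rewrite [`|t - s|]distrC (@ger0_norm _ (s - t)) ?subr_ge0//.
have -> : p t - p s - (t - s) *: w = - (p s - p t - (s - t) *: w).
  by apply/rowP => j; rewrite !mxE; ring.
rewrite normrN.
have dst r : r \in `]t, s[ -> is_derive r 1 p (dp r) by move=> /ost[_ /dpP].
have Bst r : r \in `]t, s[ -> `|dp r - w| <= B.
  move=> /ost[/andP[tr rs] rab].
  apply: dpB => //; rewrite distrC (distrC t) (@ger0_norm _ (s - r)) ?subr_ge0 ?(ltW rs)//.
  by rewrite (@ger0_norm _ (s - t)) ?subr_ge0// lerD2l lerN2 ltW.
by apply (mean_value_linear_le ts B0 cst dst Bst).
Qed.

Lemma mulr_ratio_le (C e : R) : 0 <= C -> 0 < e -> C * (e / (C + 1)) <= e.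
Proof.
move=> C0 e0; have C1 : 0 < C + 1 by rewrite ltr_wpDl.
rewrite mulrCA; apply: ler_piMr; first exact: ltW.
by rewrite ler_pdivrMr// mul1r lerDl.
Qed.

Lemma is_derive_of_quadratic (p : R -> V) (t : R) (v : V) (C r : R) : 0 < r ->
  (forall h : R, `|h| < r -> `|p (h + t) - p t - h *: v| <= C * `|h| ^+ 2) ->
  is_derive t 1 p v.
Proof.
move=> r0 pC.
have C0 : 0 <= C.
  have r2 : 0 < r / 2 by rewrite divr_gt0.
  have := pC (r / 2); rewrite ger0_norm ?(ltW r2)//.
  have -> : r / 2 < r by rewrite ltr_pdivrMr// mulr2n mulrDr mulr1 ltrDl.
  by move=> /(_ isT)/(le_trans (normr_ge0 _)); rewrite pmulr_lge0// exprn_gt0.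
have cv : (fun h => h^-1 *: ((p \o shift t) (h *: 1) - p t)) @ 0^' --> v.
  apply/cvgrPdist_le => e e0.
  have e' : 0 < e / (C + 1) by rewrite divr_gt0// ltr_wpDl.
  near=> h; have h0 : h != 0 by near: h; exact: nbhs_dnbhs_neq.
  have hr : `|h| < r by near: h; exact: dnbhs0_lt.
  have he : `|h| < e / (C + 1) by near: h; exact: dnbhs0_lt.
  have -> : v - h^-1 *: ((p \o shift t) (h *: 1) - p t) =
      - (h^-1 *: (p (h + t) - p t - h *: v)).
    rewrite [h *: 1]mulr1 /= [in RHS]scalerBr scalerA mulVf// scale1r opprB.
    by [].
  rewrite normrN normrZ normfV mulrC.
  apply: (@le_trans _ _ (C * `|h|)).
    rewrite ler_pdivrMr ?normr_gt0// -mulrA -expr2.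
    exact: pC.
  apply: (@le_trans _ _ (C * (e / (C + 1)))); first by rewrite ler_wpM2l// ltW.
  exact: mulr_ratio_le.
split; last exact: cvg_lim cv.
by apply/cvg_ex; exists v.
Unshelve. all: by end_near. Qed.

Lemma continuous_of_lipschitz (F : V -> V) (L : R) : 0 <= L ->
  (forall x y, `|F x - F y| <= L * `|x - y|) -> continuous F.
Proof.
move=> L0 FL x.
apply: (proj2 (@cvgrPdist_le R V V (nbhs x) (nbhs_filter x) F (F x))) => e e0.
have e' : 0 < e / (L + 1) by rewrite divr_gt0// ltr_wpDl.
apply/nbhs_ballP; exists (e / (L + 1)) => //= y; rewrite -ball_normE /= => xy.
apply: le_trans (FL _ _) _.
apply: (@le_trans _ _ (L * (e / (L + 1)))); first by apply: ler_wpM2l => //; exact: ltW.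
exact: mulr_ratio_le.
Qed.

Variables (F : V -> V) (B L T : R).
Hypotheses (B0 : 0 <= B) (L0 : 0 <= L) (T0 : 0 < T) (LT : L * T <= 2^-1).
Hypothesis FB : forall x, `|F x| <= B.
Hypothesis FL : forall x y, `|F x - F y| <= L * `|x - y|.

Fixpoint picard (z : V) (k : nat) : R -> V :=
  if k is k'.+1 then fun t => z + primitive (- T) 0 (F \o picard z k') t
  else fun _ => z.

Let NT : - T < T. Proof. by rewrite gtrN. Qed.
Let T00 : (0 : R) \in `[- T, T].
Proof. by rewrite in_itv/= oppr_le0 !ltW. Qed.
Let absT t : t \in `[- T, T] -> `|t| <= T.
Proof. by rewrite in_itv/= ler_norml. Qed.

Lemma picard_continuous z k : {within `[- T, T], continuous (picard z k)}.
Proof.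
elim: k => [|k IH] /=; first by move=> x; exact: cvg_cst.
have cF : {within `[- T, T], continuous (F \o picard z k)}.
  move=> x; apply: (@cvg_comp _ _ _ (picard z k) F); first exact: IH.
  exact: (continuous_of_lipschitz L0 FL).
move=> x; apply: cvgD; first exact: cvg_cst.
exact: primitive_continuous.
Qed.

Lemma picard_derive z k t : t \in `]- T, T[ ->
  is_derive t 1 (picard z k.+1) (F (picard z k t)).
Proof.
move=> tT; have cF : {within `[- T, T], continuous (F \o picard z k)}.
  move=> x; apply: (@cvg_comp _ _ _ (picard z k) F); first exact: picard_continuous.
  exact: (continuous_of_lipschitz L0 FL).
rewrite -[X in is_derive _ _ _ X]add0r.
exact (@is_deriveD _ _ _ (cst z) _ t 1 0 _ (is_derive_cst z t 1)
  (primitive_derive 0 NT cF tT)).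
Qed.

Lemma picard_start z k : picard z k 0 = z.
Proof. by case: k => //= k; rewrite primitive0 addr0. Qed.

(** Each iteration contracts by the factor [L * T <= 2^-1]. *)
Lemma picard_cauchy z k t : t \in `[- T, T] ->
  `|picard z k.+1 t - picard z k t| <= (B * T) / 2 ^+ k.
Proof.
have BT : 0 <= B * T by rewrite mulr_ge0// ltW.
elim: k t => [|k IH] t tT.
  rewrite expr0 divr1.
  have := @mean_value_linear_sym (picard z 1) _ 0 (- T) T B 0 t B0
    (@picard_continuous _ _) (@picard_derive z 0) T00 tT.
  rewrite scaler0 !subr0 picard_start => h.
  apply: le_trans (h _) _; first by move=> r _ _; rewrite subr0.
  by rewrite ler_wpM2l// absT.
have p2 : (0 : R) <= 2 ^+ k by rewrite exprn_ge0.
have M0 : 0 <= L * ((B * T) / 2 ^+ k) by rewrite !(mulr_ge0, invr_ge0)// ltW.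
have oc r : r \in `]- T, T[ -> r \in `[- T, T].
  by rewrite !in_itv/= => /andP[/ltW -> /ltW ->].
have := @mean_value_linear_sym (fun t => picard z k.+2 t - picard z k.+1 t)
  (fun t => F (picard z k.+1 t) - F (picard z k t)) 0 (- T) T _ 0 t M0 _ _ T00 tT.
rewrite scaler0 !subr0 !picard_start subrr subr0 => h.
apply: le_trans (h _ _ _) _.
- move=> x; apply: cvgB; exact: picard_continuous.
- by move=> r rT; apply: is_deriveB; exact: picard_derive.
- move=> r rT _; rewrite subr0; apply: le_trans (FL _ _) _.
  by rewrite ler_wpM2l//; apply: IH; exact: oc.
apply: (@le_trans _ _ (L * ((B * T) / 2 ^+ k) * T)).
  by rewrite ler_wpM2l// absT.
have -> : L * (B * T / 2 ^+ k) * T = (L * T) * (B * T / 2 ^+ k) by ring.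
rewrite exprS invfM [leRHS]mulrCA ler_wpM2r//.
by rewrite mulr_ge0// invr_ge0.
Qed.

(* This bound survives in the limit, where it gives the differential equation. *)
Lemma picard_quadratic z k s t : s \in `[- T, T] -> t \in `[- T, T] ->
  `|picard z k.+2 t - picard z k.+2 s - (t - s) *: F (picard z k.+1 s)|
    <= L * B * `|t - s| ^+ 2.
Proof.
move=> sT tT; have oc r : r \in `]- T, T[ -> r \in `[- T, T].
  by rewrite !in_itv/= => /andP[/ltW -> /ltW ->].
have lip r : r \in `[- T, T] -> `|picard z k.+1 r - picard z k.+1 s| <= B * `|r - s|.
  move=> rT; have := @mean_value_linear_sym (picard z k.+1) _ 0 (- T) T B s r B0
    (@picard_continuous _ _) (@picard_derive z k) sT rT.
  by rewrite scaler0 subr0; apply => r' _ _; rewrite subr0.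
rewrite expr2 mulrA; apply: (mean_value_linear_sym _ _ (@picard_derive z k.+1)) => //.
- by rewrite !mulr_ge0.
- exact: picard_continuous.
move=> r /oc rT rs; apply: le_trans (FL _ _) _; rewrite -!mulrA ler_wpM2l//.
by apply: le_trans (lip _ rT) _; rewrite ler_wpM2l.
Qed.

(** Both estimates hold for the iterates with constants independent of [k], so they pass to the
    pointwise limit; no derivative or integral is exchanged with the limit. *)
Lemma ode_solution z : exists p : R -> V, p 0 = z /\
  forall s t, s \in `[- T, T] -> t \in `[- T, T] ->
    `|p t - p s| <= B * `|t - s| /\
    `|p t - p s - (t - s) *: F (p s)| <= L * B * `|t - s| ^+ 2.
Proof.
have arith1 (x y e : R) : x <= y -> 2 * y <= e -> x + x <= e by lra.
have arith2 (x x' y e q : R) : x <= x' -> x' <= y -> (2 + q) * y <= e -> x + x + q * y <= e.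
  by move=> h1 h2; rewrite mulrDl => h3; lra.
(* Membership sits under the existential so that [choice] gives a function on all of [R]; its values
   off [[- T, T]] are irrelevant. *)
have lim_ex t : exists l, t \in `[- T, T] -> forall k, `|l - picard z k t| <= 2 * (B * T) / 2 ^+ k.
  have [tT|_] := boolP (t \in `[- T, T]); last by exists 0.
  have [l lP] := geometric_cvg (fun k => @picard_cauchy z k t tT).
  by exists l.
have [p pP] := choice lim_ex.
pose d k : R := 2 * (B * T) / 2 ^+ k.
have BT : 0 <= B * T by rewrite mulr_ge0// ltW.
have d_small (c e : R) : 0 <= c -> 0 < e -> exists k, c * d k <= e.
  move=> c0 e0; have : (fun k => c * (2 * (B * T)) / 2 ^+ k) @ \oo --> (0 : R).
    rewrite -[X in _ --> X](mulr0 (c * (2 * (B * T)))).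
    apply: cvgZl_tmp; under eq_fun do rewrite -exprVn.
    by apply: cvg_expr; rewrite ger0_norm ?invr_ge0// invf_lt1// ltr1n.
  move=> /cvgrPdist_lt/(_ e e0)[k _ /(_ k (leqnn _))].
  rewrite sub0r normrN => /ltW h; exists k; apply: le_trans h.
  by rewrite /d !mulrA ler_norm.
have d0 k : 0 <= d k.
  by rewrite /d; apply: divr_ge0; [exact: mulr_ge0|exact: exprn_ge0].
have dS k : d k.+1 <= d k.
  rewrite /d ler_wpM2l//; first exact: mulr_ge0.
  by rewrite lef_pV2 ?posrE ?exprn_gt0// exprS ler_peMl ?exprn_ge0// ler1n.
have pos t : t \in `[- T, T] -> forall k, `|p t - picard z k t| <= d k by exact: pP.
exists p; split.
  apply/eqP; rewrite -subr_eq0 -normr_le0; apply/ler_addgt0Pl => e e0; rewrite addr0.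
  have [k] := d_small 1 e ler01 e0; rewrite mul1r; apply: le_trans.
  by have := pos 0 T00 k; rewrite picard_start.
move=> s t sT tT; split.
  apply/ler_addgt0Pl => e e0; have [k ke] := d_small 2 e (ler0n _ 2) e0.
  have lip : `|picard z k.+1 t - picard z k.+1 s| <= B * `|t - s|.
    have := @mean_value_linear_sym (picard z k.+1) _ 0 (- T) T B s t B0
      (@picard_continuous _ _) (@picard_derive z k) sT tT.
    by rewrite scaler0 subr0; apply => r' _ _; rewrite subr0.
  have ps := pos s sT k.+1; have pt := pos t tT k.+1; have dk := dS k.
  have -> : p t - p s = (p t - picard z k.+1 t) - (p s - picard z k.+1 s) +
     (picard z k.+1 t - picard z k.+1 s) by apply/rowP => j; rewrite !mxE; ring.
  apply: le_trans (ler_normD _ _) _; refine (lerD _ lip).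
  apply: le_trans (ler_normB _ _) _; apply: le_trans (lerD pt ps) _.
  exact: arith1 dk ke.
apply/ler_addgt0Pl => e e0.
have [k ke] := d_small (2 + `|t - s| * L) e (addr_ge0 (ler0n _ 2) (mulr_ge0 (normr_ge0 _) L0)) e0.
have ps := pos s sT k.+2; have pt := pos t tT k.+2; have ps' := pos s sT k.+1.
have dk := dS k; have dk' := dS k.+1.
have -> : p t - p s - (t - s) *: F (p s) =
   ((p t - picard z k.+2 t) - (p s - picard z k.+2 s) -
    (t - s) *: (F (p s) - F (picard z k.+1 s))) +
   (picard z k.+2 t - picard z k.+2 s - (t - s) *: F (picard z k.+1 s)).
  by apply/rowP => j; rewrite !mxE; ring.
apply: le_trans (ler_normD _ _) _; refine (lerD _ (picard_quadratic _ _ sT tT)).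
have pF : `|(t - s) *: (F (p s) - F (picard z k.+1 s))| <= `|t - s| * L * d k.
  rewrite normrZ -mulrA; apply: ler_wpM2l => //; apply: le_trans (FL _ _) _.
  by apply: ler_wpM2l => //; exact: le_trans ps' dk.
apply: le_trans (ler_normB _ _) _; refine (le_trans (lerD (ler_normB _ _) (lexx _)) _).
refine (le_trans (lerD (lerD pt ps) pF) _).
exact: arith2 dk' dk ke.
Qed.

End picard.
Section clamp.
Context {R : realType} {n : nat}.
Local Notation V := 'rV[R]_n.

(* Composition with [clamp] turns a locally bounded Lipschitz field into a global one. *)
Definition clamp (z0 : V) (rho : R) (x : V) : V :=
  \row_j (z0 0 j + Num.max (- rho) (Num.min rho (x 0 j - z0 0 j))).

Lemma clamp_near z0 rho x : 0 <= rho -> `|clamp z0 rho x - z0| <= rho.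
Proof.
move=> r0; apply: norm_row_le => // j; rewrite !mxE addrAC subrr add0r ler_norml.
by rewrite le_max lexx/= ge_max ge_min lexx/= andbT lerNl (le_trans _ r0)// oppr_le0.
Qed.

Lemma clamp_id z0 rho x : `|x - z0| <= rho -> clamp z0 rho x = x.
Proof.
move=> xr; apply/rowP => j; rewrite !mxE.
have := le_trans (norm_coord_le (x - z0) j) xr; rewrite !mxE ler_norml => /andP[h1 h2].
by rewrite min_r// max_r// subrKC.
Qed.

(** Truncating one coordinate is 1-Lipschitz and the norm is the maximum norm, so clamping does not
    worsen the Lipschitz constant of a field. *)
Lemma clamp_lipschitz z0 rho x y : `|clamp z0 rho x - clamp z0 rho y| <= `|x - y|.
Proof.
apply: norm_row_le => // j; rewrite !mxE.
apply: le_trans (norm_coord_le (x - y) j); rewrite !mxE.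
have -> : x 0 j - y 0 j = (x 0 j - z0 0 j) - (y 0 j - z0 0 j) by ring.
rewrite opprD addrACA subrr add0r.
move: (x 0 j - z0 0 j) (y 0 j - z0 0 j) => u v.
have maxl (a x' y' : R) : `|Num.max a x' - Num.max a y'| <= `|x' - y'|.
  have [h1|h1] := leP a x'; have [h2|h2] := leP a y' => //;
  rewrite ler_norml; have := ler_norm (x' - y'); have := ler_norm (y' - x');
  rewrite (distrC y' x') => ? ?; apply/andP; split; lra.
have minl (a x' y' : R) : `|Num.min a x' - Num.min a y'| <= `|x' - y'|.
  have [h1|h1] := leP a x'; have [h2|h2] := leP a y' => //;
  rewrite ler_norml; have := ler_norm (x' - y'); have := ler_norm (y' - x');
  rewrite (distrC y' x') => ? ?; apply/andP; split; lra.
exact: le_trans (maxl _ _ _) (minl _ _ _).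
Qed.

End clamp.

(** * Local flows and their dependence on the initial point *)

Section flow.
Context {R : realType} {n : nat}.
Local Notation V := 'rV[R]_n.

(** An integral curve encoded by integrated estimates instead of a derivative: they hold up to the
    end points [- T] and [T] and enter the expansions directly. [solution_derive] recovers the
    differential equation in the interior. *)
Record solution (X : V -> V) (z0 : V) (r C T : R) (p : R -> V) : Prop := Solution {
  solution_ball : forall t, `|t| <= T -> `|p t - z0| < r;
  solution_lipschitz : forall s t, `|s| <= T -> `|t| <= T -> `|p t - p s| <= C * `|t - s|;
  solution_quadratic : forall s t, `|s| <= T -> `|t| <= T ->
    `|p t - p s - (t - s) *: X (p s)| <= C * C * `|t - s| ^+ 2
}.

Lemma solution_derive (X : V -> V) z0 r C T p (t : R) : solution X z0 r C T p -> `|t| < T ->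
  is_derive t 1 p (X (p t)).
Proof.
move=> sp tT; apply: (@is_derive_of_quadratic _ _ _ _ _ (C * C) (T - `|t|)).
  by rewrite subr_gt0.
move=> h hT; have htT : `|h + t| <= T.
  by apply: le_trans (ler_normD _ _) _; rewrite -lerBrDr ltW.
by have := solution_quadratic sp (ltW tT) htT; rewrite addrK.
Qed.

Lemma solution_shift (X : V -> V) z0 r C T p a T' : `|a| + T' <= T ->
  solution X z0 r C T p -> solution X z0 r C T' (fun t => p (t + a)).
Proof.
move=> aT sp; have le t : `|t| <= T' -> `|t + a| <= T.
  by move=> tT; apply: le_trans (ler_normD _ _) _; apply: le_trans aT; rewrite addrC lerD2l.
have sub (s t : R) : t + a - (s + a) = t - s by rewrite opprD addrACA subrr addr0.
split=> [t tT|s t sT tT|s t sT tT].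
- exact (solution_ball sp (le t tT)).
- by rewrite -(sub s t); exact (solution_lipschitz sp (le s sT) (le t tT)).
- by rewrite -(sub s t); exact (solution_quadratic sp (le s sT) (le t tT)).
Qed.

Lemma tame_flow z0 r C (X : V -> V) : 0 < r -> 1 <= C -> tame z0 r C X ->
  exists T d, [/\ 0 < T, C * T <= 2^-1, 0 < d & forall z, `|z - z0| < d ->
    exists p, p 0 = z /\ solution X z0 r C T p].
Proof.
move=> r0 C1 tX; have C0 : 0 < C by exact: lt_le_trans C1.
pose rho := r / 2; have rho0 : 0 < rho by rewrite divr_gt0.
have rhor : rho < r by rewrite /rho; lra.
pose F := X \o clamp z0 rho.
have cr x : `|clamp z0 rho x - z0| < r by apply: le_lt_trans rhor; exact/clamp_near/ltW.
(* [C * T <= 2^-1] is the contraction condition; [C * T <= r / 8] keeps a curve starting within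
   [r / 4] of [z0] in the ball of radius [rho = r / 2], where the clamped field equals [X]. *)
pose T := Num.min (2^-1 / C) (r / 8 / C).
have T0 : 0 < T by rewrite lt_min !divr_gt0// invr_gt0.
have CT : C * T <= 2^-1.
  by rewrite mulrC -ler_pdivlMr// ge_min lexx.
have CT' : C * T <= r / 8.
  by rewrite mulrC -ler_pdivlMr// ge_min lexx orbT.
have FB x : `|F x| <= C by have := tame_bounded tX (cr x).
have FL x y : `|F x - F y| <= C * `|x - y|.
  apply: le_trans (tame_lipschitz tX (cr y) (cr x)) _.
  by rewrite ler_pM2l//; exact: clamp_lipschitz.
have d0 : 0 < r / 4 by rewrite divr_gt0.
exists T, (r / 4); split => // z zd.
have [p [p0 pP]] := ode_solution (ltW C0) (ltW C0) T0 CT FB FL z.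
have itv t : `|t| <= T -> t \in `[- T, T] by rewrite in_itv/= ler_norml.
have pball t : `|t| <= T -> `|p t - z0| < rho.
  move=> tT; have TT : `|0 : R| <= T by rewrite normr0 ltW.
  have [+ _] := pP 0 t (itv 0 TT) (itv t tT).
  rewrite subr0 p0 => h; have h2 : C * `|t| <= r / 8.
    by apply: le_trans CT'; rewrite ler_pM2l.
  apply: le_lt_trans (ler_distD z _ _) _; rewrite /rho; move: h h2 zd r0.
  move: (`|p t - z|) (C * `|t|) `|z - z0| => a b c; clear; lra.
have FX t : `|t| <= T -> F (p t) = X (p t).
  by move=> tT; rewrite /F /= clamp_id// ltW// pball.
have quad s t : `|s| <= T -> `|t| <= T ->
    `|p t - p s - (t - s) *: X (p s)| <= C * C * `|t - s| ^+ 2.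
  by move=> sT tT; have [_] := pP s t (itv s sT) (itv t tT); rewrite FX.
exists p; split=> //; split=> //.
- by move=> t tT; exact: lt_trans (pball t tT) rhor.
by move=> s t sT tT; have [] := pP s t (itv s sT) (itv t tT).
Qed.

(** First-order dependence on the initial point, for two individual solutions and without
    differentiating a flow: the derivative of [q - p] is compared with the constant
    ['d X (p 0) (q 0 - p 0)]. *)
Lemma solution_compare z0 r C (X : V -> V) T p q t : 1 <= C -> 0 < T -> C * T <= 2^-1 ->
  tame z0 r C X -> solution X z0 r C T p -> solution X z0 r C T q -> `|t| <= T ->
  `|q t - p t - (q 0 - p 0) - t *: 'd X (p 0) (q 0 - p 0)| <=
    4 * C * C * (`|t| * `|q 0 - p 0| ^+ 2 + `|t| ^+ 2 * `|q 0 - p 0|).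
Proof.
move=> C1 T0 CT tX sp sq tT; have C0 : 0 < C by exact: lt_le_trans C1.
pose d t := q t - p t; pose h := d 0; pose dd t := X (q t) - X (p t).
have TT : `|0 : R| <= T by rewrite normr0 ltW.
have oT (s : R) : s \in `]- T, T[ -> `|s| < T by rewrite in_itv/= ltr_norml.
have cT (s : R) : s \in `[- T, T] -> `|s| <= T by rewrite in_itv/= ler_norml.
have itv s : `|s| <= T -> s \in `[- T, T] by rewrite in_itv/= ler_norml.
have ddP s : s \in `]- T, T[ -> is_derive s 1 d (dd s).
  by move=> /oT sT; exact (@is_deriveB _ _ _ q p s 1 _ _ (solution_derive sq sT) (solution_derive sp sT)).
have lip x : solution X z0 r C T x -> {within `[- T, T], continuous x}.
  move=> sx; apply/subspace_continuousP => s /cT sT.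
  apply/cvgrPdist_le => e e0; rewrite near_withinE.
  have e' : 0 < e / (C + 1) by rewrite divr_gt0// ltr_wpDl// ltW.
  apply/nbhs_ballP; exists (e / (C + 1)) => //= u; rewrite -ball_normE /= => su /cT uT.
  apply: le_trans (solution_lipschitz sx uT sT) _.
  apply: (@le_trans _ _ (C * (e / (C + 1)))); first by rewrite ler_pM2l// ltW.
  by apply: mulr_ratio_le => //; exact: ltW.
have cd : {within `[- T, T], continuous d}.
  by move=> x; apply: cvgB; [exact: lip sq x|exact: lip sp x].
have cnd : {within `[- T, T], continuous (fun s => `|d s|)}.
  move=> x; apply: (@cvg_comp _ _ _ d (fun v => `|v|)); first exact: cd.
  exact: norm_continuous.
have NTT : - T <= T by rewrite ge0_cp// ltW.
have [c cc cmax] := EVT_max NTT cnd.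
have lipX s : `|s| <= T -> `|dd s| <= C * `|d s|.
  by move=> sT; exact (tame_lipschitz tX (solution_ball sp sT) (solution_ball sq sT)).
have dh s : `|s| <= T -> `|d s - h| <= C * `|d c| * `|s|.
  move=> sT; have B0 : 0 <= C * `|d c| by rewrite mulr_ge0// ltW.
  have := @mean_value_linear_sym _ _ d dd 0 (- T) T _ 0 s B0 cd ddP (itv 0 TT) (itv s sT).
  rewrite scaler0 !subr0; apply=> u /oT uT _; rewrite subr0.
  apply: le_trans (lipX u (ltW uT)) _; rewrite ler_pM2l//; apply: cmax.
  exact/itv/ltW.
(* In place of Gronwall's inequality: at a maximum [c] of the norm of [d], the growth term is at
   most half of that maximum and is absorbed. *)
have dc : `|d c| <= 2 * `|h|.
  have h1 : `|d c - h| <= 2^-1 * `|d c|.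
    apply: le_trans (dh c (cT c cc)) _; rewrite mulrAC ler_wpM2r//.
    by apply: le_trans CT; rewrite ler_pM2l// cT.
  have := ler_normD (d c - h) h; rewrite subrK.
  move: h1; move: (`|d c - h|) `|d c| `|h| => x y z; clear; lra.
have dle s : `|s| <= T -> `|d s| <= 2 * `|h|.
  by move=> sT; apply: le_trans dc; exact/cmax/itv.
have dh2 s : `|s| <= T -> `|d s - h| <= 2 * C * `|h| * `|s|.
  move=> /dh/le_trans; apply; rewrite ler_wpM2r// -mulrA mulrCA ler_pM2l//.
have B0 : 0 <= 4 * C * `|h| ^+ 2 + 4 * C * C * `|t| * `|h|.
  by rewrite addr_ge0// !mulr_ge0// ltW.
have := @mean_value_linear_sym _ _ d dd ('d X (p 0) h) (- T) T _ 0 t B0 cd ddP (itv 0 TT) (itv t tT).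
rewrite subr0 => H; apply: le_trans (H _) _; last first.
  suff -> : (4 * C * `|h| ^+ 2 + 4 * C * C * `|t| * `|h|) * `|t| =
    4 * C * (`|t| * `|h| ^+ 2) + 4 * C * C * (`|t| ^+ 2 * `|h|).
    rewrite mulrDr lerD2r; apply: ler_wpM2r; first by rewrite mulr_ge0// exprn_ge0.
    by rewrite ler_peMr// mulr_ge0// ltW.
  by move: `|h| `|t| => x y; ring.
move=> u /oT uT; rewrite subr0 => ut; have uT' := ltW uT.
have bq := solution_ball sq uT'; have bp := solution_ball sp uT'.
have bp0 := solution_ball sp TT.
have e1 : `|dd u - 'd X (p u) (d u)| <= C * `|d u| ^+ 2 by exact (tame_taylor tX bp bq).
have e2 : `|'d X (p u) (d u) - 'd X (p 0) (d u)| <= C * `|p u - p 0| * `|d u|.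
  exact (tame_diff_lipschitz tX (d u) bp0 bp).
have e3 : `|'d X (p 0) (d u - h)| <= C * `|d u - h| by exact (tame_diff_bounded tX (d u - h) bp0).
(* Three errors: the Taylor remainder at [p u], the move of the base point from [p 0] to [p u], and
   the change of [d] since time 0. *)
have tele (a b c' e f : V) : f = c' - e -> a - e = (a - b) + (b - c') + f.
  by move=> ->; apply/rowP => j; rewrite !mxE; ring.
rewrite (tele _ ('d X (p u) (d u)) _ _ _ (linearB ('d X (p 0)) (d u) h)).
have lp := solution_lipschitz sp TT uT'; rewrite subr0 in lp.
have h1 := dle u uT'; have h2 := dh2 u uT'.
apply: le_trans (ler_normD _ _) _; refine (le_trans (lerD (ler_normD _ _) (lexx _)) _).
refine (le_trans (lerD (lerD e1 e2) e3) _).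
have f1 : C * `|d u| ^+ 2 <= 4 * C * `|h| ^+ 2.
  have -> : 4 * C * `|h| ^+ 2 = C * (2 * `|h|) ^+ 2 by move: `|h| => x; ring.
  by rewrite ler_pM2l//; apply: lerXn2r; rewrite ?nnegrE ?mulr_ge0.
have f2 : C * `|p u - p 0| * `|d u| <= 2 * C * C * `|t| * `|h|.
  have -> : 2 * C * C * `|t| * `|h| = C * (C * `|t|) * (2 * `|h|) by move: `|h| `|t| => x y; ring.
  apply: ler_pM => //; first by rewrite mulr_ge0// ltW.
  by rewrite ler_pM2l//; apply: le_trans lp _; rewrite ler_pM2l.
have f3 : C * `|d u - h| <= 2 * C * C * `|t| * `|h|.
  have -> : 2 * C * C * `|t| * `|h| = C * (2 * C * `|h| * `|t|) by move: `|h| `|t| => x y; ring.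
  rewrite ler_pM2l//; apply: le_trans h2 _; apply: ler_wpM2l => //.
  by rewrite !mulr_ge0// ltW.
refine (le_trans (lerD (lerD f1 f2) f3) _).
by move: (`|h| ^+ 2) `|h| `|t| => x y z; rewrite le_eqVlt; apply/orP; left; apply/eqP; ring.
Qed.

End flow.
(** * Curves in a chart *)

Section reach.
Context {R : realType} {n : nat}.
Local Notation V := 'rV[R]_n.
Local Notation rmeasurable D f :=
  (measurable_fun (T := measurableTypeR R) (U := measurableTypeR R) D f).
Implicit Types (fs : seq (V -> V)) (z : V).

Definition control_field fs (u : nat -> R -> R) (t : R) (x : V) : V :=
  \sum_(i < size fs) u i t *: nth (fun _ => 0) fs i x.

(** The bounds 1 make elapsed time a bound for the length and persist when infinitely many pieces
    are glued; so does countability of [N], which makes it a null set. [N a] puts every switching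
    time into the exceptional set of the piece that starts there. *)
Record steered fs (a b : R) (g : R -> V) (u : nat -> R -> R) (N : set R) : Prop := Steered {
  steered_lipschitz : forall s t, a <= s -> s <= t -> t <= b -> `|g t - g s| <= t - s;
  steered_measurable : forall i, rmeasurable setT (u i);
  steered_bounded : forall i t, `|u i t| <= 1;
  steered_countable : countable N;
  steered_start : N a;
  steered_derive : forall t, a < t < b -> ~ N t -> is_derive t 1 g (control_field fs u t (g t))
}.

(* [T] bounds the length of the curve, which may start at any time [a]. *)
Definition reach fs (T : R) (z z' : V) : Prop :=
  0 <= T /\ forall a, exists g u N, [/\ steered fs a (a + T) g u N, g a = z & g (a + T) = z'].

Lemma reach_ge0 fs T z z' : reach fs T z z' -> 0 <= T.
Proof. by case. Qed.

Lemma reach_dist fs T z z' : reach fs T z z' -> `|z' - z| <= T.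
Proof.
move=> [T0 /(_ 0)[g [u [N [st g0 gT]]]]]; rewrite -g0 -gT.
have := steered_lipschitz st (lexx _); rewrite add0r => /(_ _ T0 (lexx _)).
by rewrite subr0.
Qed.

Lemma reach_rest fs T z : 0 <= T -> reach fs T z z.
Proof.
move=> T0; split=> // a; exists (fun _ => z), (fun _ _ => 0), [set a].
split=> //; split=> //.
- by move=> s t _ st _; rewrite subrr normr0 subr_ge0.
- by move=> i t; rewrite normr0.
move=> t _ _; rewrite /control_field big1; first exact: is_derive_cst.
by move=> i _; rewrite scale0r.
Qed.

Lemma reach_cat_l fs gs T z z' : reach fs T z z' -> reach (fs ++ gs) T z z'.
Proof.
move=> [T0 r]; split=> // a; have [g [u [N [st ga gT]]]] := r a.
have [li me bo co sa de] := st.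
exists g, (fun i t => if (i < size fs)%N then u i t else 0), N; split=> //; split=> //.
- by move=> i; case: (i < size fs)%N => //; exact: me.
- by move=> i t; case: ifP => _ //; rewrite normr0.
move=> t tab Nt; rewrite [X in is_derive _ _ _ X](_ : _ = control_field fs u t (g t)); first exact: de.
rewrite /control_field size_cat big_split_ord /= [X in _ + X]big1 ?addr0.
  by apply: eq_bigr => i _; rewrite nth_cat ltn_ord.
by move=> i _; rewrite ltnNge leq_addr/= scale0r.
Qed.

Lemma reach_cat_r fs gs T z z' : reach gs T z z' -> reach (fs ++ gs) T z z'.
Proof.
move=> [T0 r]; split=> // a; have [g [u [N [st ga gT]]]] := r a.
have [li me bo co sa de] := st.
exists g, (fun i t => if (i < size fs)%N then 0 else u (i - size fs)%N t), N; split=> //; split=> //.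
- by move=> i; case: (i < size fs)%N => //; exact: me.
- by move=> i t; case: ifP => _ //; rewrite normr0.
move=> t tab Nt; rewrite [X in is_derive _ _ _ X](_ : _ = control_field gs u t (g t)); first exact: de.
rewrite /control_field size_cat big_split_ord /= [X in X + _]big1 ?add0r.
  by apply: eq_bigr => i _; rewrite nth_cat ltnNge leq_addr/= addKn.
by move=> i _; rewrite ltn_ord scale0r.
Qed.

(** The trajectory is slowed down by the factor [C], which brings its speed below 1 and its control
    below [C^-1 <= 1]; the sign of [t] in [c] allows negative times. *)
Lemma reach_flow X z0 r C T p t : 1 <= C -> solution X z0 r C T p -> `|t| <= T ->
  reach [:: X] (C * `|t|) (p 0) (p t).
Proof.
move=> C1 sp tT; have C0 : 0 < C by exact: lt_le_trans C1.
split=> [|a]; first by rewrite mulr_ge0// ltW.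
pose c := Num.sg t / C.
have sg1 : `|Num.sg t| <= 1 by rewrite normr_sg; case: (t != 0).
have cle : `|c| <= C^-1.
  by rewrite normrM normfV (ger0_norm (ltW C0)) ler_piMl// invr_ge0 ltW.
have cT s : a <= s -> s <= a + C * `|t| -> `|c * (s - a)| <= `|t|.
  move=> as_ sb; rewrite normrM (@ger0_norm _ (s - a)) ?subr_ge0//.
  apply: (@le_trans _ _ (C^-1 * (C * `|t|))); last by rewrite mulKf// gt_eqF.
  by apply: ler_pM; rewrite ?subr_ge0// lerBlDl.
exists (fun s => p (c * (s - a))), (fun i _ => if i == 0%N then c else 0), [set a].
split; [split| by rewrite subrr mulr0|].
- move=> s s' as_ ss sb.
  have h1 := le_trans (cT s as_ (le_trans ss sb)) tT.
  have h2 := le_trans (cT s' (le_trans as_ ss) sb) tT.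
  apply: le_trans (solution_lipschitz sp h1 h2) _.
  rewrite -mulrBr normrM opprB addrA subrK (@ger0_norm _ (s' - s)) ?subr_ge0// mulrA.
  by rewrite ler_piMl ?subr_ge0// mulrC -ler_pdivlMr// mul1r.
- by move=> i; case: (i == 0%N).
- move=> i s; case: ifP => _; last by rewrite normr0.
  by apply: le_trans cle _; rewrite invf_le1.
- by [].
- by [].
- move=> s /andP[as_ sb] _; rewrite /control_field big_ord1 /=.
  have csT : `|c * (s - a)| < T.
    have [t0|tn0] := eqVneq t 0.
      by move: sb; rewrite t0 normr0 mulr0 addr0 ltNge (ltW as_).
    apply: lt_le_trans tT; rewrite normrM (@ger0_norm _ (s - a)) ?subr_ge0 ?(ltW as_)//.
    apply: (@le_lt_trans _ _ (C^-1 * (s - a))).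
      by rewrite ler_wpM2r// subr_ge0 ltW.
    by rewrite ltr_pdivrMl// ltrBlDl.
  pose l (s : R) : R := c * (s - a).
  have dl : is_derive s 1 l c.
    have := @is_deriveZ R R R (id - cst a) c s 1 _
      (@is_deriveB R R R id (cst a) s 1 1 0 (is_derive_id s 1) (is_derive_cst a s 1)).
    by rewrite subr0 [c *: 1]mulr1.
  have dp := solution_derive sp csT.
  have dl' : differentiable l s by apply/derivable1_diffP; case: dl.
  have dp' : differentiable p (l s) by apply/derivable1_diffP; case: dp.
  have dpl : differentiable (p \o l) s by exact: differentiable_comp.
  have E : 'd (p \o l) s = 'd p (l s) \o 'd l s :> (R -> V) by exact: diff_comp.
  split; first exact: diff_derivable.
  rewrite -[fun _ => _]/(p \o l) deriveE// E /= -(deriveE _ dl').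
  have [_ ->] := dl; rewrite -[c]mulr1 [in LHS]linearZ /= -(deriveE _ dp').
  by have [_ ->] := dp; rewrite mulr1.
- have -> : c * (a + C * `|t| - a) = t; last by [].
  rewrite addrAC subrr add0r /c -mulrA mulKf ?gt_eqF//.
  by rewrite -numEsg.
Qed.

End reach.

(** * Infinite concatenation *)

Section reach_limit.
Context {R : realType} {n : nat}.
Local Notation V := 'rV[R]_n.
Local Notation rmeasurable D f :=
  (measurable_fun (T := measurableTypeR R) (U := measurableTypeR R) D f).

Variables (fs : seq (V -> V)) (z : nat -> V) (d : nat -> R) (y : V) (T : R).
Hypothesis zr : forall k, reach fs (d k) (z k) (z k.+1).
Hypothesis zy : z @ \oo --> y.
Hypothesis dT : series d @ \oo --> T.

Let d0 k : 0 <= d k := reach_ge0 (zr k).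
Let S k := series d k.
Let SS k : S k.+1 = S k + d k. Proof. exact: seriesSr. Qed.
Let S0 : S 0 = 0. Proof. by rewrite /S /series /= big_geq. Qed.

Let S_mono k m : (k <= m)%N -> S k <= S m.
Proof.
move=> /subnKC <-; elim: (m - k)%N => [|j IH]; first by rewrite addn0.
by rewrite addnS SS; apply: le_trans IH _; rewrite lerDl.
Qed.

Let S_le k : S k <= T.
Proof.
have cS : cvgn S by apply/cvg_ex; exists T.
have <- : limn S = T by exact: cvg_lim dT.
by apply: nondecreasing_cvgn_le => // i j; exact: S_mono.
Qed.

Let T0 : 0 <= T. Proof. by rewrite -S0. Qed.

Let z_dist k m : (k <= m)%N -> `|z m - z k| <= S m - S k.
Proof.
move=> /subnKC <-; elim: (m - k)%N => [|j IH]; first by rewrite addn0 !subrr normr0.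
rewrite addnS SS; apply: le_trans (ler_distD (z (k + j)%N) _ _) _.
by have h := lerD (reach_dist (zr (k + j)%N)) IH; apply: le_trans h _; rewrite addrA (addrC (d _)).
Qed.

Let y_dist k : `|y - z k| <= T - S k.
Proof.
apply/ler_addgt0Pl => e e0; move/cvgrPdist_le : zy => /(_ e e0)[m _ mP].
apply: le_trans (ler_distD (z (maxn m k)) _ _) _.
apply: lerD; first by apply: mP => /=; exact: leq_maxl.
apply: le_trans (z_dist (leq_maxr m k)) _.
by apply: lerB => //; exact: S_le.
Qed.

Let S_gt s : s < T -> exists k, s < S k.
Proof.
move=> sT; have : 0 < T - s by rewrite subr_gt0.
move/cvgrPdist_lt : dT => /[apply] -[k _ /(_ k (leqnn k))] h.
exists k; have := le_lt_trans (ler_norm _) h; rewrite -/(S k); lra.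
Qed.

(** The curves are glued on consecutive time intervals of lengths [d k], with value [y] at the final
    time. The distance from [z k] to [y] is at most the remaining time, so the glued curve is
    1-Lipschitz up to its end. *)
Lemma reach_lim : reach fs T (z 0) y.
Proof.
split=> // a.
have curve k : exists guN : (R -> V) * (nat -> R -> R) * set R,
  [/\ steered fs (a + S k) (a + S k.+1) guN.1.1 guN.1.2 guN.2,
      guN.1.1 (a + S k) = z k & guN.1.1 (a + S k.+1) = z k.+1].
  have [_ /(_ (a + S k))[g [u [N]]]] := zr k.
  by rewrite -addrA -SS => guN; exists (g, u, N).
have [c cP] := choice curve.
(* Half-open intervals are disjoint, and empty when [d k = 0]. *)
pose E k t := a + S k <= t < a + S k.+1.
have Euniq k m t : E k t -> E m t -> k = m.
  move=> /andP[k1 k2] /andP[m1 m2]; apply/eqP; rewrite eqn_leq; apply/andP; split.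
    rewrite -ltnS ltnNge; apply/negP => mk.
    by have := le_lt_trans (le_trans (lerD (lexx a) (S_mono mk)) k1) m2; rewrite ltxx.
  rewrite -ltnS ltnNge; apply/negP => mk.
  by have := le_lt_trans (le_trans (lerD (lexx a) (S_mono mk)) m1) k2; rewrite ltxx.
pose act t := `[< exists k, E k t >].
pose ix t := xget 0%N [set k | E k t].
pose g t := if act t then (c (ix t)).1.1 t else y.
pose u i t := if act t then (c (ix t)).1.2 i t else 0.
have actE k t : E k t -> act t by move=> Ek; apply/asboolP; exists k.
have ixE k t : E k t -> ix t = k.
  move=> Ek; have h : E (ix t) t by apply: (@xgetPex _ 0%N [set k | E k t]); exists k.
  exact: Euniq h Ek.
have gE k t : E k t -> g t = (c k).1.1 t by move=> Ek; rewrite /g (actE _ _ Ek) (ixE _ _ Ek).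
have uE k t i : E k t -> u i t = (c k).1.2 i t.
  by move=> Ek; rewrite /u (actE _ _ Ek) (ixE _ _ Ek).
have act_in t : a <= t -> t < a + T -> exists k, E k t.
  move=> a_t tT; have [|k tS] := @S_gt (t - a); first by rewrite ltrBlDl.
  (* The piece containing [t] is the one that ends at the first node after [t]. *)
  have ex : exists k, t < a + S k by exists k; rewrite -ltrBlDl.
  have := ex_minnP ex; case: ex_minnP => m tm mmin _.
  case: m tm mmin => [|m] tm mmin; first by move: tm; rewrite S0 addr0 ltNge a_t.
  exists m; apply/andP; split=> //; rewrite leNgt; apply/negP => tS'.
  by have := mmin m tS'; rewrite ltnn.
have act_cases t : a <= t -> t <= a + T -> (exists k, E k t) \/ (t = a + T /\ g t = y).
  move=> a_t; rewrite le_eqVlt => /orP[/eqP ->|tT]; last by left; exact: act_in.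
  right; split=> //; rewrite /g; case: ifPn => // /asboolP[k /andP[_]].
  by rewrite ltrD2l ltNge S_le.
(* [up] and [down] compare a point of the curve with an earlier and with a later node; times in
   different pieces are then compared through a node between them. *)
have up k t : a + S k <= t -> t <= a + T -> `|g t - z k| <= t - (a + S k).
  move=> kt tT; have a_t : a <= t by apply: le_trans kt; rewrite lerDl -S0 S_mono.
  have [[j Ej]|[-> ->]] := act_cases t a_t tT; last first.
    by rewrite opprD addrACA subrr add0r y_dist.
  have kj : (k <= j)%N.
    rewrite leqNgt; apply/negP => jk; case/andP: Ej => _; rewrite ltNge => /negP; apply.
    by apply: le_trans kt; rewrite lerD2l S_mono.
  rewrite (gE _ _ Ej); have [st gj _] := cP j; case/andP: Ej => jt tj.
  have h1 := steered_lipschitz st (lexx _) jt (ltW tj); rewrite gj in h1.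
  apply: le_trans (ler_distD (z j) _ _) _; apply: le_trans (lerD h1 (z_dist kj)) _.
  lra.
have down k t : a <= t -> t <= a + S k -> `|z k - g t| <= a + S k - t.
  move=> a_t tk; have tT : t <= a + T by apply: le_trans tk _; rewrite lerD2l S_le.
  have [[j Ej]|[tE ->]] := act_cases t a_t tT; last first.
    rewrite distrC; apply: le_trans (y_dist k) _; rewrite tE.
    by move: tk; rewrite tE; lra.
  rewrite (gE _ _ Ej); have [st gj gj'] := cP j; case/andP: (Ej) => jt tj.
  have [jk|kj] := ltnP j k.
    have h1 := steered_lipschitz st jt (ltW tj) (lexx _); rewrite gj' in h1.
    apply: le_trans (ler_distD (z j.+1) _ _) _; apply: le_trans (lerD (z_dist jk) h1) _.
    lra.
  (* Remaining case: [t] is the node itself, and [z j = z k] because the pieces in between have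
     length 0. *)
  have tE : t = a + S k.
    by apply/eqP; rewrite eq_le tk (le_trans _ jt)// lerD2l S_mono.
  have h1 : E k t -> z k = (c j).1.1 t.
    by move=> Ek; rewrite (Euniq _ _ _ Ej Ek) tE; have [_ -> _] := cP k.
  have Sjk : S j = S k.
    apply/eqP; rewrite eq_le (S_mono kj) andbT.
    by move: jt; rewrite tE lerD2l.
  have [_ gj0 _] := cP j; rewrite tE -Sjk gj0.
  have := z_dist kj; rewrite Sjk !subrr => h; rewrite distrC.
  exact: le_trans h _.
have cN k : countable (c k).2 by have [st _ _] := cP k; exact: steered_countable st.
exists g, u, (a |` \bigcup_k (c k).2); split.
- split.
  + move=> s t a_s st tT.
    have [[j Ej]|[sE _]] := act_cases s a_s (le_trans st tT); last first.
      have -> : t = s by apply/eqP; rewrite eq_le st sE tT.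
      by rewrite !subrr normr0.
    have [tj|jt] := ltP t (a + S j.+1).
      have Ejt : E j t by apply/andP; split=> //; case/andP: Ej => /le_trans h _; exact: h.
      rewrite (gE _ _ Ej) (gE _ _ Ejt); have [stj _ _] := cP j.
      by apply: (steered_lipschitz stj) => //; [case/andP: Ej|exact: ltW].
    have sj : s <= a + S j.+1 by case/andP: Ej => _ /ltW.
    have h1 := up _ _ jt tT; have h2 := down _ _ a_s sj.
    apply: le_trans (ler_distD (z j.+1) _ _) _; apply: le_trans (lerD h1 h2) _.
    lra.
  + move=> i.
    pose I k : set R := `[a + S k, a + S k.+1[%classic.
    have IE k t : I k t <-> E k t by rewrite /I /= in_itv.
    have mI k : measurable (I k : set (measurableTypeR R)) by exact: measurable_itv.
    (* A countable measurable cover of the line: the pieces and, at index 0, the complement of their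
       union, where the controls vanish. *)
    pose F k : set (measurableTypeR R) := if k is k'.+1 then I k' else ~` (\bigcup_k I k).
    have mF k : measurable (F k).
      by case: k => [|k] /=; [apply: measurableC; exact: bigcup_measurable|exact: mI].
    have <- : \bigcup_k F k = setT.
      apply/seteqP; split=> // t _; have [[k Ek]|nE] := pselect (exists k, E k t).
        by exists k.+1 => //=; apply/IE.
      by exists 0%N => //= -[k _ /IE Ek]; apply: nE; exists k.
    apply/measurable_fun_bigcup => // -[|k] /=.
      apply: (@eq_measurable_fun _ _ (measurableTypeR R) (measurableTypeR R) _ (cst 0)); last exact: measurable_cst.
      move=> t; rewrite inE /= => nI; rewrite /u; case: ifPn => // /asboolP[k Ek].
      by case: nI; exists k => //; apply/IE.
    apply: (@eq_measurable_fun _ _ (measurableTypeR R) (measurableTypeR R) _ ((c k).1.2 i)).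
      by move=> t; rewrite inE => /IE Ek; rewrite (uE _ _ _ Ek).
    apply: measurable_funTS; have [st _ _] := cP k; exact: steered_measurable st i.
  + move=> i t; rewrite /u; case: ifPn => _; last by rewrite normr0.
    by have [st _ _] := cP (ix t); exact: steered_bounded st i t.
  + have -> : a |` \bigcup_k (c k).2 =
        \bigcup_k (if k is k'.+1 then (c k').2 else [set a]).
      apply/seteqP; split=> t.
        by move=> [->|[k _ kt]]; [exists 0%N|exists k.+1].
      by move=> [[|k] _ /= kt]; [left|right; exists k].
    by apply: bigcup_countable => // -[|k] _; [exact: countable1|exact: cN].
  + by left.
  + move=> t /andP[a_t tT] Nt.
    have [k Ek] := act_in t (ltW a_t) tT; have [st _ _] := cP k.
    have Nk : ~ (c k).2 t by move=> kt; apply: Nt; right; exists k.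
    have kt : a + S k < t < a + S k.+1.
      case/andP: Ek => kt tk; rewrite tk andbT lt_neqAle kt andbT; apply/eqP => tE.
      by apply: Nk; rewrite -tE; exact: steered_start st.
    have := steered_derive st kt Nk; rewrite /control_field -(gE _ _ Ek).
    under eq_bigr do rewrite -(uE _ _ _ Ek).
    apply: near_eq_is_derive; near=> s; apply/esym/gE; rewrite /E.
    apply/andP; split.
      by apply/ltW; near: s; case/andP: kt => kt _; exact: lt_nbhsr.
    by near: s; case/andP: kt => _ kt; exact: lt_nbhsl.
- have [[j Ej]|[aE ->]] := act_cases a (lexx _) (ler_wpDr T0 (lexx _)).
    have := down 0%N a (lexx _); rewrite S0 addr0 subrr => /(_ (lexx _)).
    by rewrite normr_le0 subr_eq0 => /eqP.
  have := y_dist 0%N; rewrite S0 subr0; have -> : T = 0.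
    by apply/eqP; move/eqP: aE; rewrite -[X in X == _]addr0 (inj_eq (addrI a)) eq_sym.
  by rewrite normr_le0 subr_eq0 => /eqP.
- by have [[j /andP[_]]|[]//] := act_cases (a + T) (ler_wpDr T0 (lexx _)) (lexx _); rewrite ltrD2l ltNge S_le.
Unshelve. all: by end_near. Qed.

End reach_limit.

Section reach_trans.
Context {R : realType} {n : nat}.
Local Notation V := 'rV[R]_n.
Implicit Types (fs : seq (V -> V)) (z : V).

(** An infinite concatenation in which all later pieces are rests of duration 0 at [z3]. *)
Lemma reach_trans fs T1 T2 z1 z2 z3 : reach fs T1 z1 z2 -> reach fs T2 z2 z3 ->
  reach fs (T1 + T2) z1 z3.
Proof.
move=> r1 r2.
pose z k := if k is k'.+1 then if k' is _.+1 then z3 else z2 else z1.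
pose d k := if k is k'.+1 then if k' is _.+1 then 0 else T2 else T1.
have near_cst (W : pseudoMetricNormedZmodType R) (w : nat -> W) l :
    (forall k, w k.+2 = l) -> w @ \oo --> l.
  move=> wl; apply: cvg_near_cst; exists 2 => // -[|[|k]]//= _; exact: wl.
apply: (@reach_lim _ _ fs z d).
- move=> [|[|k]] //=; exact: reach_rest.
- exact: near_cst.
- apply: near_cst => k; elim: k => [|k IH].
    by rewrite !seriesSr /series /= big_geq// add0r.
  by rewrite seriesSr IH /= addr0.
Qed.

Lemma reach_le fs T T' z z' : T <= T' -> reach fs T z z' -> reach fs T' z z'.
Proof.
move=> TT r; rewrite -(subrKC T T'); apply: reach_trans r _.
by apply: reach_rest; rewrite subr_ge0.
Qed.

End reach_trans.
(** * Accessible fields *)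

Section accessibility.
Context {R : realType} {n : nat}.
Local Notation V := 'rV[R]_n.
Implicit Types (fs : seq (V -> V)) (z : V) (P : set (V -> V)).

Definition all_in P fs := forall i, (i < size fs)%N -> P (nth (fun _ => 0) fs i).

(* From every point [z] near [z0] one can move by [lam * sg ^+ N *: Y z], up to an
   error of higher order in [sg], along a curve of length [O(sg)]. *)
Definition access fs N (C d : R) z0 (Y : V -> V) : Prop :=
  forall z (lam sg : R), `|z - z0| < d -> `|lam| <= 1 -> 0 < sg < d ->
  exists2 z', reach fs (C * sg) z z' &
    `|z' - z - (lam * sg ^+ N) *: Y z| <= C * sg ^+ N.+1.

(** [d <= 1] makes the powers of [sg] decrease with the exponent, and [1 <= C] lets constants be
    absorbed into powers of [C]. *)
Definition accessible P z0 (Y : V -> V) : Prop :=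
  exists fs N C d, [/\ all_in P fs, (0 < N)%N, 1 <= C, 0 < d <= 1 & access fs N C d z0 Y].

Lemma access_weaken fs N C C' d d' z0 Y : C <= C' -> d' <= d ->
  access fs N C d z0 Y -> access fs N C' d' z0 Y.
Proof.
move=> CC dd aY z lam sg zd lam1 /andP[sg0 sgd].
have [|z' r e] := aY z lam sg (lt_le_trans zd dd) lam1; first by rewrite sg0 (lt_le_trans sgd dd).
exists z'; first by apply: reach_le r; rewrite ler_wpM2r// ltW.
by apply: le_trans e _; rewrite ler_wpM2r// exprn_ge0// ltW.
Qed.

Lemma access_cat_l fs gs N C d z0 Y : access fs N C d z0 Y -> access (fs ++ gs) N C d z0 Y.
Proof.
move=> aY z lam sg zd lam1 sgd; have [z' r e] := aY z lam sg zd lam1 sgd.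
by exists z' => //; exact: reach_cat_l.
Qed.

Lemma access_cat_r fs gs N C d z0 Y : access gs N C d z0 Y -> access (fs ++ gs) N C d z0 Y.
Proof.
move=> aY z lam sg zd lam1 sgd; have [z' r e] := aY z lam sg zd lam1 sgd.
by exists z' => //; exact: reach_cat_r.
Qed.

Lemma all_in_cat P fs gs : all_in P fs -> all_in P gs -> all_in P (fs ++ gs).
Proof.
move=> Pf Pg i; rewrite size_cat nth_cat => ifg; case: ltnP => [|fi]; first exact: Pf.
by apply: Pg; rewrite ltn_subLR.
Qed.

(* Raises the order by substituting [sg ^+ m] for [sg]. *)
Lemma access_raise fs N m C d z0 Y : (0 < m)%N -> 0 <= C -> d <= 1 ->
  access fs N C d z0 Y -> access fs (N * m) C d z0 Y.
Proof.
move=> m0 C0 d1 aY z lam sg zd lam1 /andP[sg0 sgd].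
have sg1 : sg <= 1 by exact: ltW (lt_le_trans sgd d1).
have sgm : sg ^+ m <= sg by rewrite -[leRHS]expr1 ler_wiXn2l// ltW.
have [|z' r e] := aY z lam (sg ^+ m) zd lam1.
  by rewrite exprn_gt0//= (le_lt_trans sgm).
exists z'; first by apply: reach_le r; rewrite ler_wpM2l.
move: e; rewrite -!exprM mulnC => /le_trans; apply; rewrite ler_wpM2l// mulnS.
by rewrite mulnC (exprD sg m) exprSr mulrC ler_wpM2l// exprn_ge0// ltW.
Qed.

(** Both orders are raised to their product, and the two families are concatenated with zero
    controls on the foreign half. *)
Lemma accessible_pair P z0 Y1 Y2 : accessible P z0 Y1 -> accessible P z0 Y2 ->
  exists fs N C d, [/\ all_in P fs /\ (0 < N)%N, 1 <= C, 0 < d <= 1,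
    access fs N C d z0 Y1 & access fs N C d z0 Y2].
Proof.
move=> [f1 [N1 [C1 [d1 [P1 N10 C11 /andP[d10 d11] a1]]]]].
move=> [f2 [N2 [C2 [d2 [P2 N20 C21 /andP[d20 d21] a2]]]]].
exists (f1 ++ f2), (N1 * N2)%N, (Num.max C1 C2), (Num.min d1 d2).
split.
- by split; [exact: all_in_cat|rewrite muln_gt0 N10].
- by rewrite le_max C11.
- by rewrite lt_min d10 d20 ge_min d11.
- apply: access_cat_l; apply: access_raise => //.
  + by rewrite le_max (le_trans ler01).
  + by rewrite ge_min d11.
  + by apply: access_weaken a1; [rewrite le_max lexx|rewrite ge_min lexx].
- apply: access_cat_r; rewrite mulnC; apply: access_raise => //.
  + by rewrite le_max (le_trans ler01).
  + by rewrite ge_min d11.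
  + by apply: access_weaken a2; [rewrite le_max lexx orbT|rewrite ge_min lexx orbT].
Qed.

Lemma accessible_ext P z0 Y Y' d : 0 < d -> (forall x, `|x - z0| < d -> Y x = Y' x) ->
  accessible P z0 Y -> accessible P z0 Y'.
Proof.
move=> d0 YY [fs [N [C [d' [Pf N0 C1 /andP[d'0 d'1] aY]]]]].
exists fs, N, C, (Num.min d d'); split=> //; first by rewrite lt_min d0 d'0 ge_min d'1 orbT.
move=> z lam sg; rewrite !lt_min => /andP[zd zd'] lam1 /and3P[sg0 _ sgd'].
have [|z' r e] := aY z lam sg zd' lam1; first by rewrite sg0.
by exists z' => //; rewrite -YY.
Qed.

Lemma accessible_flow P z0 r C X : 0 < r -> 1 <= C -> tame z0 r C X -> P X -> accessible P z0 X.
Proof.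
move=> r0 C1 tX PX; have [T [d [T0 CT d0 fl]]] := tame_flow r0 C1 tX.
have C0 : 0 < C by exact: lt_le_trans C1.
exists [:: X], 1%N, (C * C), (Num.min T (Num.min d 1)); split=> //.
- by move=> [|i].
- by apply: mulr_ege1.
- by rewrite !lt_min T0 d0 ltr01/= !ge_min lexx !orbT.
move=> z lam sg; rewrite !lt_min => /and3P[zT zd _] lam1 /and4P[sg0 sgT _ sg1].
have tsg : `|lam * sg| <= sg by rewrite normrM (gtr0_norm sg0) ler_piMl// ltW.
have [p [p0 sp]] := fl z zd; have tT := le_trans tsg (ltW sgT).
exists (p (lam * sg)).
  rewrite -p0; apply: reach_le (reach_flow C1 sp tT).
  by rewrite -mulrA ler_pM2l//; apply: le_trans tsg _; rewrite ler_peMl// ltW.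
have TT : `|0 : R| <= T by rewrite normr0 ltW.
have := solution_quadratic sp TT tT; rewrite subr0 p0 expr1 => /le_trans; apply.
by rewrite ler_wpM2l ?mulr_ge0 ?(ltW C0)// lerXn2r// nnegrE ltW.
Qed.

(** The leg along [Y2] starts at distance [O(sg)] from [z], where [Y2] has changed by [O(sg)] only;
    this goes into the error. *)
Lemma accessible_linear P z0 r C (a : R) Y1 Y2 : 0 < r -> 1 <= C -> tame z0 r C Y2 ->
  accessible P z0 Y1 -> accessible P z0 Y2 -> accessible P z0 (fun x => a *: Y1 x + Y2 x).
Proof.
move=> r0 C1 tY2 /accessible_pair h /h.
move=> [fs [N [K [d [[Pf N0] K1 /andP[d0 d1] a1 a2]]]]].
have K0 : 0 < K by exact: lt_le_trans K1.
have C0 : 0 < C by exact: lt_le_trans C1.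
(* Coefficients are limited to absolute value 1, so a large [a] is absorbed by running the first leg
   with parameter [k * sg] and coefficient [lam * a / k ^+ N]. *)
pose k := Num.max 1 `|a|; have k1 : 1 <= k by rewrite le_max lexx.
have k0 : 0 < k by exact: lt_le_trans k1.
have ak : `|a| <= k ^+ N.
  apply: (@le_trans _ _ k); first by rewrite le_max lexx orbT.
  by rewrite -[leLHS]expr1 ler_weXn2l.
pose D := Num.min d r; have D0 : 0 < D by rewrite lt_min d0.
pose d' := D / (2 * K * k).
have den1 : 1 <= 2 * K * k.
  by rewrite -mulrA; apply: mulr_ege1; [rewrite ler1n|exact: mulr_ege1].
have den0 : 0 < 2 * K * k by exact: lt_le_trans den1.
have d'0 : 0 < d' by rewrite divr_gt0.
have d'E : K * k * d' = D / 2 by rewrite /d'; field; rewrite !gt_eqF.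
have d'D : d' <= D / 2.
  by rewrite -d'E ler_peMl ?(ltW d'0)//; exact: mulr_ege1.
have DD : D / 2 < D by rewrite ltr_pdivrMr// ltr_pMr// ltr1n.
have Dd : D <= d by rewrite ge_min lexx.
have Dr : D <= r by rewrite ge_min lexx orbT.
pose M := K * k ^+ N.+1 + K + C * (K * k).
have Kk0 : 0 <= K * k by rewrite mulr_ge0// ltW.
have M0 : 0 <= M.
  apply: addr_ge0; last by apply: mulr_ge0 => //; exact: ltW.
  by apply: addr_ge0; [apply: mulr_ge0; [|apply: exprn_ge0]|]; exact: ltW.
exists fs, N, (K * k + K + M), d'; split=> //.
- by apply: (le_trans K1); rewrite addrAC lerDr addr_ge0.
- by rewrite d'0/= (le_trans d'D)// (le_trans (ltW DD))// (le_trans Dd).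
move=> z lam sg zd lam1 /andP[sg0 sgd].
have sgd' : k * sg < d.
  apply: (@lt_le_trans _ _ (D / 2)); last exact: le_trans (ltW DD) Dd.
  rewrite -d'E -mulrA; apply: (@lt_le_trans _ _ (k * d')); first by rewrite ltr_pM2l.
  by rewrite ler_peMl// mulr_ge0// ltW.
have sgd'' : sg < d by apply: le_lt_trans sgd'; rewrite ler_peMl// ltW.
have zd' : `|z - z0| < D / 2 by exact: lt_le_trans zd d'D.
have la : `|lam * a / k ^+ N| <= 1.
  rewrite normrM normfV normrM (ger0_norm (exprn_ge0 _ (ltW k0))).
  rewrite ler_pdivrMr ?exprn_gt0// mul1r; apply: le_trans ak.
  by rewrite ler_piMl.
have [||z' r1 e1] := a1 z (lam * a / k ^+ N) (k * sg) _ la.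
- by apply: lt_le_trans zd' _; exact: le_trans (ltW DD) Dd.
- by rewrite mulr_gt0.
have z'z : `|z' - z| <= K * k * sg by rewrite -mulrA; exact: reach_dist r1.
have z'D : `|z' - z0| < D.
  apply: le_lt_trans (ler_distD z _ _) _; rewrite [ltRHS]splitr; apply: ler_ltD zd'.
  by apply: le_trans z'z _; rewrite -d'E ler_pM2l ?mulr_gt0// ltW.
have zD : `|z - z0| < D by exact: lt_trans zd' DD.
have [|z'' r2 e2] := a2 z' lam sg (lt_le_trans z'D Dd) lam1; first by rewrite sg0.
exists z''.
  apply: reach_le (reach_trans r1 r2); rewrite [K * (k * sg)]mulrA -mulrDl ler_pM2r//.
  by rewrite lerDl.
have lY := tame_lipschitz tY2 (lt_le_trans zD Dr) (lt_le_trans z'D Dr).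
have -> : z'' - z - (lam * sg ^+ N) *: (a *: Y1 z + Y2 z) =
    (z' - z - (lam * a / k ^+ N * (k * sg) ^+ N) *: Y1 z) +
    (z'' - z' - (lam * sg ^+ N) *: Y2 z') + (lam * sg ^+ N) *: (Y2 z' - Y2 z).
  rewrite exprMn; have -> : lam * a / k ^+ N * (k ^+ N * sg ^+ N) = lam * sg ^+ N * a.
    by field; rewrite expf_neq0// gt_eqF.
  by apply/rowP => j; rewrite !mxE; ring.
have e3 : `|(lam * sg ^+ N) *: (Y2 z' - Y2 z)| <= C * (K * k) * sg ^+ N.+1.
  rewrite normrZ normrM (ger0_norm (exprn_ge0 _ (ltW sg0))) exprSr.
  apply: (@le_trans _ _ (sg ^+ N * (C * (K * k * sg)))); last first.
    by rewrite le_eqVlt; apply/orP; left; apply/eqP; ring.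
  apply: ler_pM; rewrite ?mulr_ge0 ?exprn_ge0 ?(ltW sg0)//.
    by rewrite ler_piMl// exprn_ge0// ltW.
  by apply: le_trans lY _; rewrite ler_pM2l.
apply: le_trans (ler_normD _ _) _; refine (le_trans (lerD (ler_normD _ _) (lexx _)) _).
refine (le_trans (lerD (lerD e1 e2) e3) _).
have -> : K * (k * sg) ^+ N.+1 + K * sg ^+ N.+1 + C * (K * k) * sg ^+ N.+1 = M * sg ^+ N.+1.
  by rewrite exprMn /M; move: (k ^+ N.+1) (sg ^+ N.+1) => u v; ring.
apply: ler_wpM2r; first by apply: exprn_ge0; exact: ltW.
by rewrite lerDr addr_ge0// ltW.
Qed.

End accessibility.

(** * Commutator of a flow with a displacement *)

Section bracket.
Context {R : realType} {n : nat}.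
Local Notation V := 'rV[R]_n.
Implicit Types (fs : seq (V -> V)) (z : V) (P : set (V -> V)).

(* Flow of [X] for time [t], displacement along [Y], flow for time [- t] and displacement back:
   the constants make every error a multiple of [S * t ^+ 2]. *)
Lemma commutator_estimate z0 r C (X Y : V -> V) T p q z1 z3 z4 (t s S : R) :
  1 <= C -> 0 < T -> C * T <= 2^-1 ->
  tame z0 r C X -> tame z0 r C Y -> tame z0 r C (br X Y) ->
  solution X z0 r C T p -> solution X z0 r C T q ->
  0 < t <= 1 -> t <= T -> `|s| <= S -> S <= t ^+ 2 ->
  p 0 = z1 -> q (- t) = z3 -> `|z3 - z0| < r ->
  `|q 0 - z1 - s *: Y z1| <= C * (S * t ^+ 2) ->
  `|q 0 - z1| <= C * t ^+ 2 -> `|q 0 - z1| <= 2 * C * S ->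
  `|z4 - z3 + s *: Y z3| <= C * (S * t ^+ 2) ->
  `|z4 - p (- t) - (s * t) *: br X Y (p (- t))| <= 500 * C ^+ 9 * (S * t ^+ 2).
Proof.
move=> C1 T0 CT tX tY tB sp sq /andP[t0 t1] tT sS St p0 qt z3r he ht hS h4.
have C0 : 0 < C by exact: lt_le_trans C1.
have C0' := ltW C0; have t0' := ltW t0.
have tT' : `|- t| <= T by rewrite normrN ger0_norm.
have TT : `|0 : R| <= T by rewrite normr0 ltW.
have S0 : 0 <= S by exact: le_trans sS.
have t20 : 0 <= t ^+ 2 by exact: exprn_ge0.
set z := p (- t); set W := S * t ^+ 2.
have W0 : 0 <= W by rewrite mulr_ge0.
have Wt : W <= t ^+ 2.
  by rewrite /W ler_piMl// (le_trans St)// expr_le1.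
have z1r : `|z1 - z0| < r by rewrite -p0; exact (solution_ball sp TT).
have zr : `|z - z0| < r by exact (solution_ball sp tT').
have Cpow i j : (i <= j)%N -> C ^+ i <= C ^+ j by move=> ij; exact: ler_weXn2l.
(* [p] is centred at [z1], so the starting point is [z = p (- t)]; [h] is the displacement along [Y]
   and [e] its error. Below, [E1] measures how the backward flow turns [h] into
   [h - t *: 'd X z1 h]. *)
set h := q 0 - z1; set e := h - s *: Y z1.
pose E1 := z3 - z - h + t *: 'd X z1 h.
have hE1 : `|E1| <= 16 * C ^+ 4 * W.
  have := solution_compare C1 T0 CT tX sp sq tT'.
  rewrite p0 qt -/z -/h normrN (ger0_norm t0') scaleNr opprK -/E1 => /le_trans; apply.
  apply: (@le_trans _ _ (4 * C * C * (2 * C ^+ 2 * W + 2 * C * W))).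
    apply: ler_wpM2l; first by rewrite !mulr_ge0.
    apply: lerD.
      apply: (@le_trans _ _ (1 * (2 * C * S * (C * t ^+ 2)))); last first.
        by rewrite /W le_eqVlt; apply/orP; left; apply/eqP; ring.
      rewrite expr2; refine (ler_pM t0' (mulr_ge0 (normr_ge0 _) (normr_ge0 _)) t1 _).
      exact (ler_pM (normr_ge0 _) (normr_ge0 _) hS ht).
    have -> : 2 * C * W = t ^+ 2 * (2 * C * S) by rewrite /W; ring.
    by apply: ler_wpM2l.
  have -> : 4 * C * C * (2 * C ^+ 2 * W + 2 * C * W) = (8 * C ^+ 4 + 8 * C ^+ 3) * W by ring.
  apply: ler_wpM2r => //; have := Cpow 3%N 4%N isT; lra.
have dXh v : `|'d X z1 v| <= C * `|v| by exact (tame_diff_bounded tX v z1r).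
have dYv v : `|'d Y z1 v| <= C * `|v| by exact (tame_diff_bounded tY v z1r).
have h3 : `|z3 - z| <= 18 * C ^+ 4 * t ^+ 2.
  have -> : z3 - z = E1 + h - t *: 'd X z1 h.
    by rewrite /E1; apply/rowP => j; rewrite !mxE; ring.
  apply: le_trans (ler_normB _ _) _; refine (le_trans (lerD (ler_normD _ _) (lexx _)) _).
  have f1 : `|E1| <= 16 * C ^+ 4 * t ^+ 2.
    by apply: le_trans hE1 _; rewrite ler_wpM2l// mulr_ge0// exprn_ge0.
  have f2 : `|h| <= C ^+ 4 * t ^+ 2.
    by apply: le_trans ht _; rewrite ler_wpM2r// -[leLHS]expr1; exact: Cpow.
  have f3 : `|t *: 'd X z1 h| <= C ^+ 4 * t ^+ 2.
    rewrite normrZ (ger0_norm t0'); apply: (@le_trans _ _ (1 * (C * (C * t ^+ 2)))).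
      refine (ler_pM t0' (normr_ge0 _) t1 (le_trans (dXh h) _)).
      exact: ler_wpM2l ht.
    by rewrite mul1r mulrA ler_wpM2r// -expr2; exact: Cpow.
  apply: le_trans (lerD (lerD f1 f2) f3) _; lra.
pose rho := z3 - z1 + t *: X z1.
have hrho : `|rho| <= 19 * C ^+ 4 * t ^+ 2.
  have -> : rho = (z3 - z) + (z - z1 + t *: X z1).
    by rewrite /rho; apply/rowP => j; rewrite !mxE; ring.
  apply: le_trans (ler_normD _ _) _.
  have f1 : `|z - z1 + t *: X z1| <= C ^+ 4 * t ^+ 2.
    have := solution_quadratic sp TT tT'.
    rewrite p0 subr0 -/z scaleNr opprK normrN (ger0_norm t0') => /le_trans; apply.
    by rewrite ler_wpM2r// -expr2; exact: Cpow.
  apply: le_trans (lerD h3 f1) _; lra.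
have z31 : `|z3 - z1| <= 20 * C ^+ 4 * t.
  have -> : z3 - z1 = rho - t *: X z1.
    by rewrite /rho; apply/rowP => j; rewrite !mxE; ring.
  apply: le_trans (ler_normB _ _) _.
  have f1 : `|t *: X z1| <= C ^+ 4 * t.
    rewrite normrZ (ger0_norm t0') mulrC ler_wpM2r//.
    apply: le_trans (tame_bounded tX z1r) _.
    by rewrite -[leLHS]expr1; exact: Cpow.
  have f2 : 19 * C ^+ 4 * t ^+ 2 <= 19 * C ^+ 4 * t.
    by rewrite ler_wpM2l ?mulr_ge0 ?exprn_ge0// expr2 ler_piMl.
  apply: le_trans (lerD (le_trans hrho f2) f1) _; lra.
(* The change of [Y] between the two displacements, to first order, since [z3] is [z1 - t *: X z1]
   up to [rho]. *)
pose E4 := Y z3 - Y z1 + t *: 'd Y z1 (X z1).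
have hE4 : `|E4| <= 419 * C ^+ 9 * t ^+ 2.
  have -> : E4 = (Y z3 - Y z1 - 'd Y z1 (z3 - z1)) + 'd Y z1 rho.
    have L : 'd Y z1 rho = 'd Y z1 (z3 - z1) + t *: 'd Y z1 (X z1).
      exact: etrans (linearD _ _ _) (f_equal2 (fun a b : V => a + b) erefl (linearZ _ _)).
    rewrite L /E4; move: ('d Y z1 (z3 - z1)) ('d Y z1 (X z1)) => u v.
    by apply/rowP => j; rewrite !mxE; ring.
  apply: le_trans (ler_normD _ _) _.
  have f1 : `|Y z3 - Y z1 - 'd Y z1 (z3 - z1)| <= 400 * C ^+ 9 * t ^+ 2.
    apply: le_trans (tame_taylor tY z1r z3r) _.
    apply: (@le_trans _ _ (C * (20 * C ^+ 4 * t) ^+ 2)).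
      by rewrite ler_pM2l//; apply: lerXn2r; rewrite ?nnegrE ?mulr_ge0 ?exprn_ge0.
    by rewrite le_eqVlt; apply/orP; left; apply/eqP; ring.
  have f2 : `|'d Y z1 rho| <= 19 * C ^+ 9 * t ^+ 2.
    apply: le_trans (dYv rho) _; apply: (@le_trans _ _ (C * (19 * C ^+ 4 * t ^+ 2))).
      by rewrite ler_pM2l.
    have -> : C * (19 * C ^+ 4 * t ^+ 2) = 19 * C ^+ 5 * t ^+ 2 by ring.
    by rewrite ler_wpM2r// ler_pM2l//; exact: Cpow.
  apply: le_trans (lerD f1 f2) _; lra.
have he' : `|e| <= C * W by [].
have hXe : `|t *: 'd X z1 e| <= C ^+ 2 * W.
  rewrite normrZ (ger0_norm t0'); apply: (@le_trans _ _ (1 * (C * (C * W)))).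
    exact (ler_pM t0' (normr_ge0 _) t1 (le_trans (dXh e) (ler_wpM2l C0' he'))).
  by rewrite le_eqVlt; apply/orP; left; apply/eqP; ring.
have hsE : `|s *: E4| <= 419 * C ^+ 9 * W.
  rewrite normrZ; apply: (@le_trans _ _ (S * (419 * C ^+ 9 * t ^+ 2))).
    exact (ler_pM (normr_ge0 _) (normr_ge0 _) sS hE4).
  by rewrite le_eqVlt /W; apply/orP; left; apply/eqP; ring.
have hB : `|(s * t) *: (br X Y z1 - br X Y z)| <= C ^+ 2 * W.
  rewrite normrZ normrM (ger0_norm t0').
  apply: (@le_trans _ _ ((S * t) * (C * (C * t)))); last first.
    by rewrite le_eqVlt /W; apply/orP; left; apply/eqP; ring.
  have f1 := tame_lipschitz tB zr z1r.
  have f2 := solution_lipschitz sp tT' TT; rewrite p0 -/z opprK add0r (ger0_norm t0') in f2.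
  exact (ler_pM (mulr_ge0 (normr_ge0 _) t0') (normr_ge0 _) (ler_wpM2r t0' sS)
    (le_trans f1 (ler_wpM2l C0' f2))).
have XhE : 'd X z1 h = 'd X z1 e + s *: 'd X z1 (Y z1).
  have -> : h = e + s *: Y z1 by rewrite /e subrK.
  exact: etrans (linearD _ _ _) (f_equal2 (fun a b : V => a + b) erefl (linearZ _ _)).
have brE : br X Y z1 = 'd Y z1 (X z1) - 'd X z1 (Y z1) by [].
(* To first order the way back gives [- s *: Y z1 + (s * t) *: 'd Y z1 (X z1)] and the backward flow
   [- (s * t) *: 'd X z1 (Y z1)]; added to the way out they leave [s * t] times the bracket. *)
have tele (w4 w w3 h' e' Xh Xe Xy Yx y1 y3 b bz : V) : h' = e' + s *: y1 ->
    Xh = Xe + s *: Xy -> b = Yx - Xy ->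
    w4 - w - (s * t) *: bz = (w4 - w3 + s *: y3) + (w3 - w - h' + t *: Xh) + e'
      - s *: (y3 - y1 + t *: Yx) - t *: Xe + (s * t) *: (b - bz).
  by move=> -> -> ->; apply/rowP => j; rewrite !mxE; ring.
have hE : h = e + s *: Y z1 by rewrite /e subrK.
(* The six errors have numerical coefficients 1, 16, 1, 419, 1 and 1, so 500 leaves room; the
   exponent 9 comes from the Taylor term [C * (20 * C ^+ 4 * t) ^+ 2]. *)
rewrite (tele z4 z z3 _ _ _ _ _ _ _ (Y z3) _ (br X Y z) hE XhE brE).
have c1 : C <= C ^+ 9 by rewrite -[leLHS]expr1; exact: Cpow.
have c2 : C ^+ 2 <= C ^+ 9 by exact: Cpow.
have c4 : C ^+ 4 <= C ^+ 9 by exact: Cpow.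
refine (le_trans (ler_normD _ _) (le_trans (lerD _ hB) _)).
  refine (le_trans (ler_normB _ _) (lerD _ hXe)).
  refine (le_trans (ler_normB _ _) (lerD _ hsE)).
  refine (le_trans (ler_normD _ _) (lerD _ he')).
  exact (le_trans (ler_normD _ _) (lerD h4 hE1)).
rewrite -/W -!mulrDl; apply: ler_wpM2r => //; move: (C ^+ 9) (C ^+ 4) (C ^+ 2) c1 c2 c4.
move: C1; clear; move=> C1 x y w; lra.
Qed.

End bracket.
Section accessible_bracket.
Context {R : realType} {n : nat}.
Local Notation V := 'rV[R]_n.
Implicit Types (fs : seq (V -> V)) (z : V) (P : set (V -> V)).

(** The new order is the exponent in [s * t = lam * t ^+ (N * 2).+1], where
    [s = lam * (t ^+ 2) ^+ N]; the commutator error [S * t ^+ 2] is one power of [t] smaller. *)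
Lemma accessible_br P z0 r C X Y : 0 < r -> 1 <= C ->
  tame z0 r C X -> tame z0 r C Y -> tame z0 r C (br X Y) ->
  P X -> accessible P z0 Y -> accessible P z0 (br X Y).
Proof.
move=> r0 C1 tX tY tB PX [fs [N [K [d [Pf N0 K1 /andP[d0 d1] aY]]]]].
wlog CK : C K C1 K1 tX tY tB aY / C = K.
  have C0 : 0 <= C by exact: le_trans C1.
  have CM : C <= Num.max C K by rewrite le_max lexx.
  have KM : K <= Num.max C K by rewrite le_max lexx orbT.
  have M1 : 1 <= Num.max C K by exact: le_trans CM.
  move=> /(_ (Num.max C K) (Num.max C K) M1 M1); apply => //.
  - exact: tame_weaken tX.
  - exact: tame_weaken tY.
  - exact: tame_weaken tB.
  - exact: access_weaken aY.
move: aY K1; rewrite -CK => aY _ {K CK}.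
have C0 : 0 < C by exact: lt_le_trans C1.
have [T [df [T0 CT df0 fl]]] := tame_flow r0 C1 tX.
pose D := Num.min (Num.min d df) (Num.min r (Num.min (T / 2) 1)).
have T20 : 0 < T / 2 by rewrite divr_gt0.
have D0 : 0 < D by rewrite !lt_min d0 df0 r0 T20 ltr01.
have [Dd [Ddf [Dr [DT D1]]]] : D <= d /\ D <= df /\ D <= r /\ D <= T / 2 /\ D <= 1.
  by have := lexx D; rewrite {2}/D !le_min => /andP[/andP[-> ->] /and3P[-> -> ->]].
have C80 : 0 < 8 * C by rewrite mulr_gt0.
(* Each of the four legs is shorter than [D / 8], so every corner stays in the ball of radius
   [D]. *)
pose d' := D / (8 * C).
have d'0 : 0 < d' by rewrite divr_gt0.
have Cd' : C * d' = D / 8 by rewrite /d'; field; rewrite gt_eqF.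
have d'D : d' <= D / 8 by rewrite -Cd' ler_peMl// ltW.
have C9 : C <= C ^+ 9 by rewrite -[leLHS]expr1 ler_weXn2l.
exists ([:: X] ++ fs), (N * 2).+1, (500 * C ^+ 9), d'; split=> //.
- by apply: all_in_cat => // -[|i].
- by lra.
- by rewrite d'0 (le_trans d'D)//; lra.
move=> z lam t zd lam1 /andP[t0 td].
have t0' := ltW t0.
have tD : t < D / 8 by exact: lt_le_trans td d'D.
have CtD : C * t < D / 8 by rewrite -Cd' ltr_pM2l.
have tT : t <= T / 2 by lra.
have t1 : t <= 1 by lra.
have t2t : t ^+ 2 <= t by rewrite expr2 ler_piMl.
have t20 : 0 < t ^+ 2 by rewrite exprn_gt0.
have Ct2 : C * t ^+ 2 < D / 8 by apply: le_lt_trans CtD; rewrite ler_pM2l.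
have zD : `|z - z0| < D / 8 by exact: lt_le_trans zd d'D.
have at_T : `|t| <= T by rewrite ger0_norm//; lra.
have at_T' : `|- t| <= T by rewrite normrN.
have step w1 w2 b c : `|w2 - w1| <= b -> b < D / 8 -> `|w1 - z0| < c -> `|w2 - z0| < c + D / 8.
  move=> h1 h2 h3; apply: le_lt_trans (ler_distD w1 _ _) _.
  by rewrite addrC; exact: ltrD h3 (le_lt_trans h1 h2).
have [|p1 [p10 sp1]] := fl z; first by apply: lt_le_trans Ddf; lra.
pose z1 := p1 t.
have r1 : reach [:: X] (C * t) z z1.
  by have := reach_flow C1 sp1 at_T; rewrite p10 (ger0_norm t0').
have z1D := step _ _ _ _ (reach_dist r1) CtD zD.
have sg2 : 0 < t ^+ 2 < d by rewrite t20 (le_lt_trans t2t)//; lra.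
have [|z2 r2 e2] := aY z1 lam (t ^+ 2) _ lam1 sg2; first by apply: lt_le_trans Dd; lra.
have z2D := step _ _ _ _ (reach_dist r2) Ct2 z1D.
have [|q [q0 sq]] := fl z2; first by apply: lt_le_trans Ddf; lra.
pose z3 := q (- t).
have r3 : reach [:: X] (C * t) z2 z3.
  by have := reach_flow C1 sq at_T'; rewrite q0 normrN (ger0_norm t0').
have z3D := step _ _ _ _ (reach_dist r3) CtD z2D.
have lam1' : `|- lam| <= 1 by rewrite normrN.
have [|z4 r4 e4] := aY z3 (- lam) (t ^+ 2) _ lam1' sg2; first by apply: lt_le_trans Dd; lra.
exists z4.
  have r12 := reach_trans (reach_cat_l fs r1) (reach_cat_r [:: X] r2).
  have r34 := reach_trans (reach_cat_l fs r3) (reach_cat_r [:: X] r4).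
  apply: reach_le (reach_trans r12 r34).
  apply: (@le_trans _ _ (4 * (C * t))).
    have : C * t ^+ 2 <= C * t by rewrite ler_pM2l.
    move: (C * t ^+ 2) (C * t) => u v; lra.
  by rewrite mulrA ler_wpM2r//; lra.
pose S := (t ^+ 2) ^+ N; pose s := lam * S.
have S0 : 0 <= S by rewrite exprn_ge0// ltW.
have sS : `|s| <= S by rewrite normrM (ger0_norm S0) ler_piMl.
have St : S <= t ^+ 2.
  by rewrite -[leRHS]expr1 ler_wiXn2l// ?(ltW t20)// (le_trans t2t).
(* The estimate wants the first trajectory centred at [z1]; the shift by [t <= T / 2] costs half of
   the time interval, and [q] is restricted to match. *)
have sp : solution X z0 r C (T / 2) (fun u => p1 (u + t)).
  by apply: (solution_shift _ sp1); rewrite (ger0_norm t0'); lra.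
have sq' : solution X z0 r C (T / 2) (fun u => q (u + 0)).
  by apply: (solution_shift _ sq); rewrite normr0 add0r; lra.
have CT2 : C * (T / 2) <= 2^-1.
  by apply: le_trans CT; rewrite ler_pM2l//; lra.
have z1r : `|z1 - z0| < r by apply: lt_le_trans Dr; lra.
have he : `|z2 - z1 - s *: Y z1| <= C * (S * t ^+ 2).
  by move: e2; rewrite -/S -/s exprSr.
have h2 : `|z2 - z1| <= 2 * C * S.
  have -> : z2 - z1 = (z2 - z1 - s *: Y z1) + s *: Y z1 by rewrite subrK.
  apply: le_trans (ler_normD _ _) _.
  have f1 : `|s *: Y z1| <= C * S.
    rewrite normrZ mulrC.
    exact (ler_pM (normr_ge0 _) (normr_ge0 _) (tame_bounded tY z1r) sS).
  have f2 : C * (S * t ^+ 2) <= C * S.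
    by rewrite ler_pM2l// ler_piMr// (le_trans t2t).
  apply: le_trans (lerD (le_trans he f2) f1) _; rewrite -mulrA.
  by move: (C * S) => u; lra.
have h4 : `|z4 - z3 + s *: Y z3| <= C * (S * t ^+ 2).
  by move: e4; rewrite -/S mulNr -/s scaleNr opprK exprSr.
have z3r : `|z3 - z0| < r by apply: lt_le_trans Dr; lra.
have t01 : 0 < t <= 1 by rewrite t0.
have := @commutator_estimate _ _ z0 r C X Y (T / 2) _ _ z1 z3 z4 t s S
  C1 T20 CT2 tX tY tB sp sq' t01 tT sS St.
rewrite /= add0r addr0 addNr p10 addr0 q0 => /(_ erefl erefl z3r he (reach_dist r2) h2 h4).
have -> : lam * t ^+ (N * 2).+1 = s * t by rewrite exprSr mulnC exprM mulrA.
suff -> : t ^+ (N * 2).+2 = S * t ^+ 2 by [].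
by rewrite mulnC -addn2 exprD exprM.
Qed.

End accessible_bracket.

(** * Fields whose brackets preserve reachability *)

Section reachable_fields.
Context {R : realType} {n : nat}.
Local Notation V := 'rV[R]_n.
Implicit Types (fs : seq (V -> V)) (z w : V) (P : set (V -> V)).

Definition smooth_near z0 (Y : V -> V) := exists U, [/\ open U, U z0 & smooth_on U Y].

Definition reachable_field P z0 (Y : V -> V) := smooth_near z0 Y /\ accessible P z0 Y.

(* By the Jacobi identity these fields are closed under brackets, which is not
   clear for the reachable ones. *)
Definition normalizing_field P z0 (Y : V -> V) :=
  reachable_field P z0 Y /\
  forall Z, reachable_field P z0 Z -> reachable_field P z0 (br Y Z).

Lemma open_ball_sub (U : set V) z0 : open U -> U z0 ->
  exists2 r : R, 0 < r & forall x, `|x - z0| < r -> U x.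
Proof.
move=> oU Uz0; have [r r0 rU] := near_normP (open_nbhs_nbhs (conj oU Uz0)).
by exists r => // x; rewrite distrC; exact: rU.
Qed.

Lemma dist_ball_open z0 (r : R) : open [set x : V | `|x - z0| < r].
Proof.
have -> : [set x : V | `|x - z0| < r] = ball z0 r.
  by apply/seteqP; split=> x; rewrite -ball_normE /= distrC.
exact: ball_open.
Qed.

Lemma smooth_near_br z0 Y Z : smooth_near z0 Y -> smooth_near z0 Z -> smooth_near z0 (br Y Z).
Proof.
move=> [U [oU Uz sY]] [W [oW Wz sZ]]; have oUW := openI oU oW.
exists (U `&` W); split=> //; apply: smooth_on_br => // k.
  by apply: Ck_on_subset (sY k) => x [].
by apply: Ck_on_subset (sZ k) => x [].
Qed.

Lemma smooth_near_linear z0 a Y Z : smooth_near z0 Y -> smooth_near z0 Z ->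
  smooth_near z0 (fun x => a *: Y x + Z x).
Proof.
move=> [U [oU Uz sY]] [W [oW Wz sZ]]; have oUW := openI oU oW.
exists (U `&` W); split=> // k; apply: (@Ck_onD _ _ _ _ _ (a \*: Y) Z) => //.
  by apply: Ck_onZ => //; apply: Ck_on_subset (sY k) => x [].
by apply: Ck_on_subset (sZ k) => x [].
Qed.

Lemma smooth_near_tame z0 Y : smooth_near z0 Y ->
  exists r C, [/\ 0 < r, 1 <= C & tame z0 r C Y].
Proof.
by move=> [U [oU Uz /(smooth_tame oU Uz)[r [C [r0 C1 _ tY]]]]]; exists r, C.
Qed.

Lemma smooth_near_ext z0 d Y Z : 0 < d -> (forall x, `|x - z0| < d -> Y x = Z x) ->
  smooth_near z0 Y -> smooth_near z0 Z.
Proof.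
move=> d0 YZ [U [oU Uz sY]]; have oB := openI oU (@dist_ball_open z0 d).
exists (U `&` [set x | `|x - z0| < d]); split=> //.
  by split=> //=; rewrite subrr normr0.
move=> k; apply: (@Ck_on_ext _ _ _ _ _ Y) => //.
  by move=> x [_ /=]; exact: YZ.
by apply: Ck_on_subset (sY k) => x [].
Qed.

Lemma reachable_field_ext P z0 d Y Z : 0 < d -> (forall x, `|x - z0| < d -> Y x = Z x) ->
  reachable_field P z0 Y -> reachable_field P z0 Z.
Proof.
by move=> d0 YZ [sY aY]; split; [exact: (smooth_near_ext d0 YZ sY)|exact: (accessible_ext d0 YZ aY)].
Qed.

Lemma reachable_field_linear P z0 a Y Z : reachable_field P z0 Y -> reachable_field P z0 Z ->
  reachable_field P z0 (fun x => a *: Y x + Z x).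
Proof.
move=> [sY aY] [sZ aZ]; split; first exact: smooth_near_linear.
have [r [C [r0 C1 tZ]]] := smooth_near_tame sZ.
exact: (accessible_linear a r0 C1 tZ aY aZ).
Qed.

Lemma reachable_field0 P z0 : reachable_field P z0 (fun _ => 0).
Proof.
split.
  by exists setT; split; [exact: openT| |move=> k; exact: Ck_on_cst openT].
exists [::], 1%N, 1, 1; split=> //; first by rewrite ltr01 lexx.
move=> z lam sg _ _ /andP[sg0 _]; exists z.
  by apply: reach_rest; rewrite mul1r ltW.
by rewrite subrr scaler0 subr0 normr0 mul1r exprn_ge0// ltW.
Qed.

(** A field of [P] may be followed along its flow, so [accessible_br] applies once [X], [Z] and
    their bracket share a ball and a constant. *)
Lemma normalizing_generator P z0 X : smooth_near z0 X -> P X -> normalizing_field P z0 X.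
Proof.
move=> sX PX; split.
  split=> //; have [r [C [r0 C1 tX]]] := smooth_near_tame sX.
  exact: (accessible_flow r0 C1 tX PX).
move=> Z [sZ aZ]; have sB := smooth_near_br sX sZ; split=> //.
have [rX [CX [rX0 CX1 tX]]] := smooth_near_tame sX.
have [rZ [CZ [rZ0 CZ1 tZ]]] := smooth_near_tame sZ.
have [rB [CB [rB0 CB1 tB]]] := smooth_near_tame sB.
pose r := Num.min rX (Num.min rZ rB); pose C := Num.max CX (Num.max CZ CB).
have r0 : 0 < r by rewrite !lt_min rX0 rZ0.
have C1 : 1 <= C by rewrite le_max CX1.
have w f rf Cf : r <= rf -> 1 <= Cf -> Cf <= C -> tame z0 rf Cf f -> tame z0 r C f.
  by move=> h1 h2 h3; apply: tame_weaken => //; exact: le_trans h2.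
refine (@accessible_br _ _ P z0 r C X Z r0 C1 _ _ _ PX aZ).
- by apply: w tX => //; rewrite ?ge_min ?le_max lexx.
- by apply: w tZ => //; rewrite ?ge_min ?le_max lexx !orbT.
- by apply: w tB => //; rewrite ?ge_min ?le_max lexx !orbT.
Qed.

Lemma normalizing_br P z0 Y1 Y2 : normalizing_field P z0 Y1 -> normalizing_field P z0 Y2 ->
  normalizing_field P z0 (br Y1 Y2).
Proof.
move=> [r1 h1] [r2 h2]; split; first exact: h1.
move=> Z rZ; have r12 := h1 _ (h2 _ rZ); have r21 := h2 _ (h1 _ rZ).
have [U1 [op1 Uz1 s1]] := r1.1; have [U2 [op2 Uz2 s2]] := r2.1; have [UZ [opZ UzZ sZ]] := rZ.1.
have oU := openI op1 (openI op2 opZ).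
have [r r0 rU] := @open_ball_sub _ z0 oU (conj Uz1 (conj Uz2 UzZ)).
(* By Jacobi the bracket with [Z] is [br Y1 (br Y2 Z) - br Y2 (br Y1 Z)] near [z0], a combination of
   reachable fields. *)
apply: (reachable_field_ext r0 _ (reachable_field_linear (-1) r21 r12)) => x /rU Ux.
rewrite scaleN1r addrC; apply/esym/(br_jacobi oU Ux).
- by move=> k; apply: Ck_on_subset (s1 k) => y [].
- by move=> k; apply: Ck_on_subset (s2 k) => y [_ []].
- by move=> k; apply: Ck_on_subset (sZ k) => y [_ []].
Qed.

(** Serves for bracket fields on the manifold, whose coordinate form is known to agree with [br]
    only near the point. *)
Lemma normalizing_ext P z0 d Y Y' : 0 < d -> (forall x, `|x - z0| < d -> Y x = Y' x) ->
  normalizing_field P z0 Y -> normalizing_field P z0 Y'.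
Proof.
move=> d0 YY [rY hY]; split; first exact: (reachable_field_ext d0 YY rY).
move=> Z rZ.
have [U [oU Uz sY]] := rY.1.
have oB := openI oU (@dist_ball_open z0 d).
have z0d : `|z0 - z0| < d by rewrite subrr normr0.
have [r r0 rU] := @open_ball_sub _ z0 oB (conj Uz z0d).
apply: (reachable_field_ext r0 _ (hY Z rZ)) => x /rU [Ux xd].
have YE : {near x, Y =1 Y'} by apply: near_eq_open (@dist_ball_open z0 d) xd _.
have dY : differentiable Y x := smooth_differentiable sY Ux.
have dY' := near_eq_differentiable YE dY.
have E : 'd Y x (Z x) = 'd Y' x (Z x).
  exact: etrans (esym (deriveE (Z x) dY)) (etrans (near_eq_derive (Z x) YE) (deriveE (Z x) dY')).
exact: (f_equal2 (fun a b : V => a - b) (f_equal (fun v => 'd Z x v) (YY x xd)) E).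
Qed.

End reachable_fields.

(** * Local controllability by successive approximation *)

Section local_controllability.
Context {R : realType} {n : nat}.
Local Notation V := 'rV[R]_n.
Local Notation e_ i := (delta_mx (0 : 'I_1) i : V).
Implicit Types (fs : seq (V -> V)) (z w : V) (P : set (V -> V)) (W : set V).

(** A version of [access] with constant displacement vectors, uniform over the set [W]; the term
    [|z - z0|] in the error pays for replacing [Y z] by [Y z0]. *)
Definition access_dir fs N (C d : R) z0 W : Prop :=
  forall z w (sg : R), `|z - z0| < d -> W w -> 0 < sg < d ->
  exists2 z', reach fs (C * sg) z z' &
    `|z' - z - sg ^+ N *: w| <= C * (sg ^+ N * (sg + `|z - z0|)).

Definition accessible_dir P z0 W : Prop :=
  exists fs N C d, [/\ all_in P fs, (0 < N)%N, 1 <= C, 0 < d <= 1 & access_dir fs N C d z0 W].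

Lemma access_dir_weaken fs N C C' d d' z0 W : C <= C' -> d' <= d ->
  access_dir fs N C d z0 W -> access_dir fs N C' d' z0 W.
Proof.
move=> CC dd aY z w sg zd Ww /andP[sg0 sgd].
have [|z' r e] := aY z w sg (lt_le_trans zd dd) Ww; first by rewrite sg0 (lt_le_trans sgd dd).
exists z'; first by apply: reach_le r; rewrite ler_wpM2r// ltW.
apply: le_trans e _; apply: ler_wpM2r => //.
by apply: mulr_ge0; [apply: exprn_ge0|apply: addr_ge0 => //]; exact: ltW.
Qed.

Lemma access_dir_raise fs N m C d z0 W : (0 < m)%N -> 0 <= C -> d <= 1 ->
  access_dir fs N C d z0 W -> access_dir fs (N * m) C d z0 W.
Proof.
move=> m0 C0 d1 aY z w sg zd Ww /andP[sg0 sgd].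
have sg1 : sg <= 1 by exact: ltW (lt_le_trans sgd d1).
have sgm : sg ^+ m <= sg by rewrite -[leRHS]expr1 ler_wiXn2l// ltW.
have [|z' r e] := aY z w (sg ^+ m) zd Ww.
  by rewrite exprn_gt0//= (le_lt_trans sgm).
exists z'; first by apply: reach_le r; rewrite ler_wpM2l.
move: e; rewrite -!exprM mulnC => /le_trans; apply; apply: ler_wpM2l => //.
by apply: ler_wpM2l; [apply: exprn_ge0; exact: ltW|rewrite lerD2r].
Qed.

Lemma access_dir_cat_l fs gs N C d z0 W : access_dir fs N C d z0 W ->
  access_dir (fs ++ gs) N C d z0 W.
Proof.
move=> aY z w sg zd Ww sgd; have [z' r e] := aY z w sg zd Ww sgd.
by exists z' => //; exact: reach_cat_l.
Qed.

Lemma access_dir_cat_r fs gs N C d z0 W : access_dir gs N C d z0 W ->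
  access_dir (fs ++ gs) N C d z0 W.
Proof.
move=> aY z w sg zd Ww sgd; have [z' r e] := aY z w sg zd Ww sgd.
by exists z' => //; exact: reach_cat_r.
Qed.

(** The second leg starts at some [z1] with [|z1 - z0| <= C * sg + |z - z0|]; this produces the
    summand [C * C], and the radius [d / (2 * C)] keeps [z1] within [d] of [z0]. *)
Lemma access_dirD fs N C d z0 W1 W2 : 1 <= C ->
  access_dir fs N C d z0 W1 -> access_dir fs N C d z0 W2 ->
  access_dir fs N (2 * C + C * C) (d / (2 * C)) z0 [set w1 + w2 | w1 in W1 & w2 in W2].
Proof.
move=> C1 a1 a2 z _ sg zd [w1 Ww1 [w2 Ww2 <-]] /andP[sg0 sgd].
have C0 : 0 < C by exact: lt_le_trans C1.
have d0 : 0 < d.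
  by have := lt_trans sg0 sgd; rewrite pmulr_lgt0// invr_gt0 mulr_gt0.
have dE : C * (d / (2 * C)) = d / 2 by field; rewrite gt_eqF.
have dd : d / (2 * C) <= d / 2.
  by rewrite -dE ler_peMl// divr_ge0 ?ltW// mulr_gt0.
have Csg : C * sg < d / 2 by rewrite -dE ltr_pM2l.
have d2 : d / 2 < d by lra.
have sgd1 : 0 < sg < d by rewrite sg0 (lt_trans (lt_le_trans sgd dd)).
have zd1 : `|z - z0| < d / 2 by exact: lt_le_trans dd.
have [z1 r1 e1] := a1 z w1 sg (lt_trans zd1 d2) Ww1 sgd1.
have z1d : `|z1 - z0| <= C * sg + `|z - z0|.
  by apply: le_trans (ler_distD z _ _) _; rewrite lerD2r; exact: reach_dist r1.
have z1d' : `|z1 - z0| < d.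
  by apply: le_lt_trans z1d _; rewrite [ltRHS]splitr; exact: ltrD.
have [z2 r2 e2] := a2 z1 w2 sg z1d' Ww2 sgd1.
exists z2.
  apply: reach_le (reach_trans r1 r2); rewrite -mulrDl ler_pM2r//.
  have : 0 <= C * C by rewrite mulr_ge0// ltW.
  by move: (C * C) => u; lra.
have -> : z2 - z - sg ^+ N *: (w1 + w2) =
   (z1 - z - sg ^+ N *: w1) + (z2 - z1 - sg ^+ N *: w2).
  by apply/rowP => j; rewrite !mxE; ring.
apply: le_trans (ler_normD _ _) _; apply: le_trans (lerD e1 e2) _.
set p := sg ^+ N; have p0 : 0 <= p by apply: exprn_ge0; exact: ltW.
have h : p * (sg + `|z1 - z0|) <= p * (sg + (C * sg + `|z - z0|)).
  by apply: ler_wpM2l => //; rewrite lerD2l.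
apply: (@le_trans _ _ (C * (p * (sg + `|z - z0|)) + C * (p * (sg + (C * sg + `|z - z0|))))).
  by rewrite lerD2l ler_pM2l.
rewrite -subr_ge0.
have -> : (2 * C + C * C) * (p * (sg + `|z - z0|)) -
   (C * (p * (sg + `|z - z0|)) + C * (p * (sg + (C * sg + `|z - z0|)))) =
   C * C * (p * `|z - z0|) by ring.
by rewrite mulr_ge0 ?mulr_ge0// ltW.
Qed.

Lemma accessible_dirD P z0 W1 W2 : accessible_dir P z0 W1 -> accessible_dir P z0 W2 ->
  accessible_dir P z0 [set w1 + w2 | w1 in W1 & w2 in W2].
Proof.
move=> [f1 [N1 [C1 [d1 [P1 N10 C11 /andP[d10 d11] a1]]]]].
move=> [f2 [N2 [C2 [d2 [P2 N20 C21 /andP[d20 d21] a2]]]]].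
pose C := Num.max C1 C2; pose d := Num.min d1 d2.
have CM : 1 <= C by rewrite le_max C11.
have C0 : 0 < C by exact: lt_le_trans CM.
have d0 : 0 < d by rewrite lt_min d10.
exists (f1 ++ f2), (N1 * N2)%N, (2 * C + C * C), (d / (2 * C)); split.
- exact: all_in_cat.
- by rewrite muln_gt0 N10.
- have : 0 <= C * C by rewrite mulr_ge0// ltW.
  by move: (C * C) => u; lra.
- rewrite divr_gt0 ?mulr_gt0//= ler_pdivrMr ?mulr_gt0// mul1r.
  have : d <= 1 by rewrite ge_min d11.
  by lra.
apply: access_dirD => //.
- apply: access_dir_cat_l; apply: access_dir_raise => //.
  + exact: ltW.
  + by rewrite ge_min d11.
  + by apply: access_dir_weaken a1; [rewrite le_max lexx|rewrite ge_min lexx].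
- apply: access_dir_cat_r; rewrite mulnC; apply: access_dir_raise => //.
  + exact: ltW.
  + by rewrite ge_min d11.
  + by apply: access_dir_weaken a2; [rewrite le_max lexx orbT|rewrite ge_min lexx orbT].
Qed.

Lemma accessible_dir0 P z0 : accessible_dir P z0 [set 0].
Proof.
exists [::], 1%N, 1, 1; split=> //; first by rewrite ltr01 lexx.
move=> z _ sg _ -> /andP[sg0 _]; exists z.
  by apply: reach_rest; rewrite mul1r ltW.
rewrite subrr scaler0 subr0 normr0 mul1r mulr_ge0 ?addr_ge0 ?exprn_ge0//; exact: ltW.
Qed.

Lemma accessible_dir_field P z0 Y : reachable_field P z0 Y ->
  accessible_dir P z0 [set lam *: Y z0 | lam in [set lam : R | `|lam| <= 1]].
Proof.
move=> [sY [fs [N [K [d [Pf N0 K1 /andP[d0 d1] aY]]]]]].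
have [r [C [r0 C1 tY]]] := smooth_near_tame sY.
have C0 : 0 < C by exact: lt_le_trans C1.
have K0 : 0 < K by exact: lt_le_trans K1.
exists fs, N, (K + C), (Num.min d r); split=> //.
- by lra.
- by rewrite lt_min d0 r0 ge_min d1.
move=> z w sg; rewrite !lt_min => /andP[zd zr] [lam lam1 <-] /and3P[sg0 sgd sgr].
have [|z' re e] := aY z lam sg zd lam1; first by rewrite sg0.
exists z'; first by apply: reach_le re; rewrite ler_pM2r// lerDl ltW.
have z0r : `|z0 - z0| < r by rewrite subrr normr0.
set p := sg ^+ N in e *; have p0 : 0 <= p by apply: exprn_ge0; exact: ltW.
have -> : z' - z - p *: (lam *: Y z0) =
   (z' - z - (lam * p) *: Y z) + (lam * p) *: (Y z - Y z0).
  by apply/rowP => j; rewrite !mxE; ring.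
have e2 : `|(lam * p) *: (Y z - Y z0)| <= C * (p * `|z - z0|).
  rewrite normrZ normrM (ger0_norm p0) mulrCA.
  apply: ler_pM; rewrite ?mulr_ge0//; first by rewrite ler_piMl.
  exact (tame_lipschitz tY z0r zr).
apply: le_trans (ler_normD _ _) _; apply: le_trans (lerD e e2) _.
rewrite exprSr -/p -subr_ge0.
have -> : (K + C) * (p * (sg + `|z - z0|)) - (K * (p * sg) + C * (p * `|z - z0|)) =
  K * (p * `|z - z0|) + C * (p * sg) by ring.
by rewrite addr_ge0// !mulr_ge0// ltW.
Qed.

Lemma accessible_dir_sub P z0 W W' : W' `<=` W -> accessible_dir P z0 W -> accessible_dir P z0 W'.
Proof.
move=> WW [fs [N [C [d [Pf N0 C1 d01 aW]]]]].
by exists fs, N, C, d; split=> // z w sg zd /WW Ww; exact: aW.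
Qed.

(** For the maximum norm the unit ball is the sum of the segments [[-1, 1]] along the basis vectors,
    each of which is the value at [z0] of a reachable field. *)
Lemma accessible_dir_ball P z0 : (forall w, exists2 Y, reachable_field P z0 Y & Y z0 = w) ->
  accessible_dir P z0 [set w | `|w| <= 1].
Proof.
move=> span.
pose W (l : seq 'I_n) := [set \sum_(i <- l) w 0 i *: e_ i | w in [set w : V | `|w| <= 1]].
suff : accessible_dir P z0 (W (index_enum 'I_n)).
  apply: accessible_dir_sub => w w1; exists w => //; exact/esym/row_sum_delta.
elim: (index_enum 'I_n) => [|i l IH].
  apply: accessible_dir_sub (accessible_dir0 P z0) => _ [w _ <-] /=.
  by rewrite big_nil.
have [Y rY Yi] := span (e_ i).
apply: accessible_dir_sub (accessible_dirD (accessible_dir_field rY) IH) => _ [w w1 <-] /=.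
rewrite big_cons; exists (w 0 i *: e_ i).
  by exists (w 0 i); rewrite ?Yi//=; exact: le_trans (norm_coord_le w i) w1.
by exists (\sum_(j <- l) w 0 j *: e_ j) => //; exists w.
Qed.

(** The family [fs] is chosen before the length bound [e], because the common domain of its fields
    decides how short the curves must be. *)
Lemma locally_controllable P z0 : (forall w, exists2 Y, reachable_field P z0 Y & Y z0 = w) ->
  exists2 fs, all_in P fs & forall e : R, 0 < e -> exists2 d : R, 0 < d &
    forall z y, `|z - z0| < d -> `|y - z0| < d -> exists2 T, T <= e & reach fs T z y.
Proof.
move=> /accessible_dir_ball[fs [N [C [d [Pf N0 C1 /andP[d0 d1] aW]]]]].
exists fs => // e e0.
have C0 : 0 < C by exact: lt_le_trans C1.
(* While [s] and [|x - z0|] are below [eta], the relative error [C * (s + |x - z0|)] is at most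
   [2^-1 ^+ N], the ratio of [(s / 2) ^+ N] to [s ^+ N]. *)
pose eta := Num.min (2^-1 ^+ N / (2 * C)) (d / 2).
have eta0 : 0 < eta by rewrite lt_min !divr_gt0 ?exprn_gt0 ?invr_gt0 ?mulr_gt0.
have etaC : 2 * C * eta <= 2^-1 ^+ N.
  by rewrite mulrC -ler_pdivlMr ?mulr_gt0// ge_min lexx.
have etad : eta <= d / 2 by rewrite ge_min lexx orbT.
(* The total length is the geometric sum of [C * s0 * 2^-1 ^+ k], which is [2 * C * s0 <= e]. *)
pose s0 := Num.min (eta / 2) (e / (2 * C)).
have s00 : 0 < s0 by rewrite lt_min !divr_gt0 ?mulr_gt0.
have s0eta : s0 <= eta / 2 by rewrite ge_min lexx.
have s0e : 2 * C * s0 <= e by rewrite mulrC -ler_pdivlMr ?mulr_gt0// ge_min lexx orbT.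
have s01 : s0 <= 1 by lra.
(* The second bound puts [z] and [y] at distance at most [s0 ^+ N], as the iteration requires at its
   start; the first, applied to [y], keeps all iterates within [eta] of [z0]. *)
pose D := Num.min (eta / 2) (s0 ^+ N / 2).
have D0 : 0 < D by rewrite lt_min !divr_gt0 ?exprn_gt0.
exists D => // z y; rewrite !lt_min => /andP[zeta zs] /andP[yeta ys].
exists (2 * C * s0) => //.
pose s k : R := s0 * 2^-1 ^+ k.
have spos k : 0 < s k by rewrite mulr_gt0// exprn_gt0.
have s_le k : s k <= s0 by rewrite ler_piMr ?(ltW s00)// exprn_ile1// invf_le1// ler1n.
have step k x : exists x', `|y - x| <= s k ^+ N ->
    reach fs (C * s k) x x' /\ `|y - x'| <= s k.+1 ^+ N.
  have [yx|] := boolP (`|y - x| <= s k ^+ N); last by exists x.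
  have p0 : 0 < s k ^+ N by exact: exprn_gt0.
  have ske : s k <= eta / 2 by exact: le_trans s0eta.
  have pe : s k ^+ N <= s k.
    by rewrite -[leRHS]expr1 ler_wiXn2l// ?(ltW (spos k))// (le_trans (s_le k)).
  have xz0 : `|x - z0| < eta.
    apply: le_lt_trans (ler_distD y _ _) _; rewrite (distrC x).
    by have := le_trans yx pe; move: yeta ske; move: `|y - z0| `|y - x| => a b; lra.
  pose w := (s k ^+ N)^-1 *: (y - x).
  have w1 : `|w| <= 1.
    by rewrite normrZ normfV (gtr0_norm p0) ler_pdivrMl// mulr1.
  have [||x' r ex] := aW x w (s k) _ w1.
  - by lra.
  - by rewrite spos/=; lra.
  exists x' => _; split=> //.
  have -> : y - x' = - (x' - x - s k ^+ N *: w).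
    rewrite /w scalerA divff ?gt_eqF// scale1r.
    by apply/rowP => j; rewrite !mxE; ring.
  have sS : s k.+1 ^+ N = 2^-1 ^+ N * s k ^+ N by rewrite -exprMn /s exprS mulrCA.
  rewrite normrN; apply: le_trans ex _; rewrite sS [leLHS]mulrCA [leLHS]mulrC.
  apply: ler_wpM2r; first exact: ltW.
  apply: le_trans etaC; rewrite -mulrA mulrCA ler_pM2l//.
  by move: ske xz0; move: `|x - z0| => a; lra.
have [f fP] := choice (fun kx : nat * V => step kx.1 kx.2).
pose x := fix x k := if k is k'.+1 then f (k', x k') else z.
have xP k : `|y - x k| <= s k ^+ N.
  elim: k => [|k IH] /=; last by have [] := fP (k, x k) IH.
  rewrite /s expr0 mulr1; apply: le_trans (ler_distD z0 _ _) _.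
  by rewrite (distrC z0); move: zs ys; move: `|z - z0| `|y - z0| (s0 ^+ N) => a b c; lra.
have s_cvg : s @ \oo --> (0 : R).
  rewrite -[X in _ --> X](mulr0 s0); apply: cvgZl_tmp.
  by apply: cvg_expr; rewrite ger0_norm ?invr_ge0// invf_lt1// ltr1n.
apply: (@reach_lim _ _ fs x (fun k => C * s k)).
- by move=> k; have [] := fP (k, x k) (xP k).
- apply/cvgrPdist_le => e' e'0; move/cvgrPdist_le : s_cvg => /(_ e' e'0).
  apply: filterS => k; rewrite sub0r normrN (gtr0_norm (spos k)); apply: le_trans.
  apply: le_trans (xP k) _.
  by rewrite -[leRHS]expr1 ler_wiXn2l// ?(ltW (spos k))// (le_trans (s_le k)).
- have -> : (fun k => C * s k) = geometric (C * s0) (2^-1).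
    by apply/funext => k; rewrite /s /geometric /= mulrA.
  have -> : 2 * C * s0 = C * s0 / (1 - 2^-1) by field.
  by apply: cvg_geometric_series; rewrite ger0_norm ?invr_ge0// invf_lt1// ltr1n.
Qed.

End local_controllability.
(** * Horizontal curves on a manifold *)

Section charts.
Context {R : realType} {n : nat} {M : manifold R n}.
Local Notation V := 'rV[R]_n.
Implicit Types (p q : chart R n M) (x : M) (O : set M).

Lemma chart_image_open p O : open O -> open (p @` (cdom p `&` O)).
Proof.
move=> oO; rewrite openE => _ [x [px Ox] <-].
have np : nbhs (p x) (p @` cdom p).
  by apply: open_nbhs_nbhs; split; [exact: cimg_open|exists x].
have nO : nbhs (p x) (cinv p @^-1` O).
  apply: (cinv_continuous (ex_intro2 _ _ x px erefl)); rewrite cmapK//.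
  exact: open_nbhs_nbhs.
apply: filterS (filterI np nO) => _ [[x' px' <-] /=]; rewrite /preimage /= cmapK// => Ox'.
by exists x'.
Qed.

Lemma chart_nbhs p (W : set V) x : cdom p x -> nbhs (p x) W -> nbhs x [set x' | cdom p x' /\ W (p x')].
Proof.
move=> px nO; apply: filterI; first by apply: open_nbhs_nbhs; split; [exact: cdom_open|].
exact: (cmap_continuous px).
Qed.

Lemma in_chart_cmap (X : M -> tvector M) p x : cdom p x -> in_chart X p (p x) = X x p.
Proof. by move=> px; rewrite /in_chart cmapK. Qed.

Lemma transition_domain_open p q : open (p @` (cdom p `&` cdom q)).
Proof. by apply: chart_image_open; exact: cdom_open. Qed.

Lemma transition_differentiable p q x : chart_at x p -> chart_at x q ->
  differentiable (q \o cinv p) (p x).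
Proof.
move=> [ap px] [aq qx]; apply: (smooth_differentiable (atlas_compatible ap aq)).
by exists x.
Qed.

Lemma transition_near p q q' x : chart_at x p -> chart_at x q -> chart_at x q' ->
  {near p x, (q' \o cinv q) \o (q \o cinv p) =1 q' \o cinv p}.
Proof.
move=> [ap px] [aq qx] _; have Ux : (p @` (cdom p `&` cdom q)) (p x) by exists x.
have E y : (p @` (cdom p `&` cdom q)) y ->
    ((q' \o cinv q) \o (q \o cinv p)) y = (q' \o cinv p) y.
  by move=> [x' [px' qx'] <-] /=; rewrite !cmapK.
exact (near_eq_open (@transition_domain_open p q) Ux E).
Qed.

Lemma diff_near_eq (f g : V -> V) z w : {near z, f =1 g} -> differentiable f z ->
  'd f z w = 'd g z w.
Proof.
move=> fg df; have dg := near_eq_differentiable fg df.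
exact: etrans (esym (deriveE w df)) (etrans (near_eq_derive w fg) (deriveE w dg)).
Qed.

Lemma transition_diff_comp p q q' x w : chart_at x p -> chart_at x q -> chart_at x q' ->
  'd (q' \o cinv p) (p x) w = 'd (q' \o cinv q) (q x) ('d (q \o cinv p) (p x) w).
Proof.
move=> cp cq cq'; have E := transition_near cp cq cq'.
have d1 := transition_differentiable cp cq.
have px : (q \o cinv p) (p x) = q x by rewrite /= cmapK//; case: cp.
have d2 : differentiable (q' \o cinv q) ((q \o cinv p) (p x)).
  by rewrite px; exact: transition_differentiable.
have d12 : differentiable ((q' \o cinv q) \o (q \o cinv p)) (p x) by exact: differentiable_comp.
refine (etrans (esym (diff_near_eq w E d12)) _).
refine (etrans (f_equal (fun h : V -> V => h w) (diff_comp d1 d2)) _).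
exact (f_equal (fun y => 'd (q' \o cinv q) y ('d (q \o cinv p) (p x) w)) px).
Qed.

Lemma transition_diff_id p x w : chart_at x p -> 'd (p \o cinv p) (p x) w = w.
Proof.
move=> cp; have E : {near p x, p \o cinv p =1 id}.
  have Ux : (p @` cdom p) (p x) by exists x => //; case: cp.
  apply: near_eq_open (@cimg_open _ _ _ p) Ux _.
  by move=> _ [x' px' <-] /=; rewrite cmapK.
refine (etrans (diff_near_eq w E (transition_differentiable cp cp)) _).
have D : 'd id (p x) = id :> (V -> V) by exact (@diff_val _ _ _ _ _ _ _ (is_diff_id (p x))).
exact (f_equal (fun h : V -> V => h w) D).
Qed.

(** The tangent vector at [x] with coordinates [w] in [p]; the value 0 in the other case is imposed
    by the normalization in [tangent_space]. *)
Definition tangent_vector x p (w : V) : tvector M :=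
  fun q => if `[< chart_at x q >] then 'd (q \o cinv p) (p x) w else 0.

Lemma tangent_vector_tangent x p w : chart_at x p -> tangent_space x (tangent_vector x p w).
Proof.
move=> cp; split=> [q nq|q q' cq cq']; first by rewrite /tangent_vector; case: asboolP.
rewrite /tangent_vector; case: asboolP => // _; case: asboolP => // _.
exact: transition_diff_comp.
Qed.

Lemma tangent_vector_chart x p w : chart_at x p -> tangent_vector x p w p = w.
Proof.
by move=> cp; rewrite /tangent_vector; case: asboolP => // _; exact: transition_diff_id.
Qed.

Lemma tangent_space_subspace x : linear_subspace (@tangent_space R n M x).
Proof.
split.
  by split=> // p q _ _; exact: esym (linear0 _).
move=> c v w [v0 vE] [w0 wE]; split=> [p np|p q cp cq].
  by change (c *: v p + w p = 0); rewrite v0// w0// scaler0 addr0.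
change (c *: v q + w q = 'd (q \o cinv p) (p x) (c *: v p + w p)).
by rewrite (vE p q cp cq) (wE p q cp cq) linearP.
Qed.

End charts.

(** * The Lie hull in a chart *)

Section horizontal_in_chart.
Context {R : realType} {n : nat} {M : manifold R n}.
Variable H : tangent_distribution M.
Local Notation V := 'rV[R]_n.
Variables (x0 : M) (p : chart R n M).
Hypothesis cp : chart_at x0 p.

Definition horizontal_germ : set (V -> V) :=
  [set f | exists X, [/\ horizontal_fields H X, ldom X x0 & f = in_chart X p]].

Lemma in_chart_smooth_near (X : local_vfield M) : ldom X x0 -> smooth_near (p x0) (in_chart X p).
Proof.
move=> Xx; exists (p @` (cdom p `&` ldom X)); split.
- by apply: chart_image_open; exact: ldom_open.
- by exists x0 => //; split=> //; case: cp.
- by apply: lfield_smooth; case: cp.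
Qed.

(** The hull is contained in every involutive set containing the horizontal fields, in particular in
    [G]. Membership in [G] is conditional on [ldom Z x0] because fields of the hull need not be
    defined at [x0]. *)
Lemma lie_hull_normalizing (Z : local_vfield M) :
  lie_hull (horizontal_fields H) Z -> ldom Z x0 ->
  normalizing_field horizontal_germ (p x0) (in_chart Z p).
Proof.
pose G := [set Z : local_vfield M | ldom Z x0 ->
  normalizing_field horizontal_germ (p x0) (in_chart Z p)].
move=> hZ; suff : G Z by []; apply: (hZ G); split.
  move=> X Y W GX GY [dW WE] Wx; have [Xx Yx] : ldom X x0 /\ ldom Y x0.
    by move: Wx; rewrite dW.
  have oW := @chart_image_open _ _ _ p _ (@ldom_open _ _ _ W).
  have Wz : (p @` (cdom p `&` ldom W)) (p x0) by exists x0 => //; split=> //; case: cp.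
  have [r r0 rW] := open_ball_sub oW Wz.
  apply: (normalizing_ext r0 _ (normalizing_br (GX Xx) (GY Yx))) => _ /rW[x [px Wx'] <-].
  have cx : chart_at x p by split=> //; case: cp.
  rewrite in_chart_cmap// (WE x p Wx' cx).
  by rewrite /br /lie !in_chart_cmap.
by move=> X HX Xx; apply: normalizing_generator; [exact: in_chart_smooth_near|exists X].
Qed.

(** The vectors whose [p]-coordinates are values of reachable fields form a linear subspace
    containing the values of the Lie hull at [x0], hence also their linear hull, the tangent
    space. *)
Lemma reachable_span w : bracket_generating H ->
  exists2 Y, reachable_field horizontal_germ (p x0) Y & Y (p x0) = w.
Proof.
move=> bg; have := tangent_vector_tangent w cp; rewrite (bg x0).
pose S := [set v : tvector M | exists2 Y, reachable_field horizontal_germ (p x0) Y & Y (p x0) = v p].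
move=> hv; have : S (tangent_vector x0 p w).
  apply: hv; split.
    split; first by exists (fun _ => 0) => //; exact: reachable_field0.
    move=> c v v' [Y rY Yv] [Y' rY' Yv'].
    exists (fun x => c *: Y x + Y' x); first exact: reachable_field_linear.
    by rewrite Yv Yv'.
  move=> _ [Z [hZ Zx] <-]; exists (in_chart Z p).
    by have [] := lie_hull_normalizing hZ Zx.
  by rewrite in_chart_cmap//; case: cp.
by move=> [Y rY]; rewrite tangent_vector_chart// => Yw; exists Y.
Qed.

End horizontal_in_chart.

(** * Lipschitz functions on segments *)

Section lipschitz_segment.
Context {R : realType} {n : nat}.
Local Notation V := 'rV[R]_n.
Implicit Types (f : R -> V) (a b c d : R).

Definition lipschitz_between f c d := exists2 K : R, 0 <= K &
  forall s t, c <= s -> s <= t -> t <= d -> `|f t - f s| <= K * (t - s).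

Lemma lipschitz_between_cat f a b b' c : b' <= b -> a <= b -> b' <= c ->
  lipschitz_between f a b -> lipschitz_between f b' c -> lipschitz_between f a c.
Proof.
move=> b'b ab b'c [K K0 fK] [L L0 fL]; exists (K + L); first exact: addr_ge0.
move=> s t sa st tc; have ts0 : 0 <= t - s by rewrite subr_ge0.
have [tb|/ltW bt] := leP t b.
  by apply: le_trans (fK s t sa st tb) _; rewrite ler_wpM2r// lerDl.
have [b's|/ltW sb'] := leP b' s.
  by apply: le_trans (fL s t b's st tc) _; rewrite ler_wpM2r// lerDr.
have sb := le_trans sb' b'b.
apply: le_trans (ler_distD (f b) _ _) _.
apply: le_trans (lerD (fL b t b'b bt tc) (fK s b sa sb (lexx _))) _.
rewrite addrC mulrDl; apply: lerD; apply: ler_wpM2l => //; first by rewrite lerD2r.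
by rewrite lerD2l lerN2.
Qed.

(** By a supremum argument: [A] collects the right ends up to which [f] is Lipschitz, and the local
    bound at [sup A] carries beyond it unless [sup A = d]. *)
Lemma lipschitz_local_segment f c d : c <= d ->
  (forall t, c <= t <= d -> exists2 r, 0 < r &
    forall a b, c <= a -> b <= d -> t - r < a -> b < t + r -> lipschitz_between f a b) ->
  lipschitz_between f c d.
Proof.
move=> cd loc.
pose A := [set e | c <= e <= d /\ lipschitz_between f c e].
have Ac : A c.
  split; first by rewrite lexx.
  exists 0 => // s t cs st tc.
  have -> : t = s by apply/eqP; rewrite eq_le st (le_trans tc cs).
  by rewrite !subrr normr0 mulr0.
have supA : has_sup A by split; [exists c|exists d => e [/andP[]]].
have cS : c <= sup A by apply: ub_le_sup => //; case: supA.
have Sd : sup A <= d by apply: ge_sup; [exists c|move=> e [/andP[]]].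
have [r r0 lr] := loc (sup A) (introT andP (conj cS Sd)).
have [e [/andP[ce ed] eA] Se] := sup_adherent r0 supA.
have eS : e <= sup A by apply: ub_le_sup; [case: supA|split=> //; rewrite ce].
pose e' := Num.min d (sup A + r / 2).
have Se' : sup A <= e' by rewrite le_min Sd lerDl ltW// divr_gt0.
have e'd : e' <= d by rewrite ge_min lexx.
have Ae' : A e'.
  split; first by rewrite (le_trans cS Se').
  apply: (lipschitz_between_cat (lexx e) ce (le_trans eS Se') eA).
  apply: lr => //; rewrite /e' gt_min; apply/orP; right.
  by rewrite ltrD2l ltr_pdivrMr// ltr_pMr// ltr1n.
have e'S : e' <= sup A by apply: ub_le_sup => //; case: supA.
suff <- : e' = d by case: Ae'.
have : ~~ (sup A + r / 2 <= sup A) by rewrite -ltNge ltrDl divr_gt0.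
by move: e'S; rewrite /e'; have [_ //|_ -> //] := leP d (sup A + r / 2).
Qed.

Lemma lipschitz_absolutely_continuous f c d : lipschitz_between f c d ->
  absolutely_continuous c d f.
Proof.
move=> [K K0 fK] e e0; exists (e / (K + 1)); first by rewrite divr_gt0// ltr_wpDl.
move=> k s r sr _ lt_d; apply: (@le_lt_trans _ _ (\sum_(i < k) K * (r i - s i))).
  by apply: ler_sum => i _; have [] := sr i; exact: fK.
rewrite -mulr_sumr; move: lt_d; set S := \sum_(i < k) _ => lt_d.
have S0 : 0 <= S by apply: sumr_ge0 => i _; have [_ + _] := sr i; rewrite subr_ge0.
apply: (@le_lt_trans _ _ ((K + 1) * S)); first by rewrite ler_wpM2r// lerDl.
by rewrite mulrC -ltr_pdivlMr// ltr_wpDl.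
Qed.

End lipschitz_segment.

(** * From steered curves in a chart to controlled curves *)

Section steered_controlled.
Context {R : realType} {n : nat} {M : manifold R n}.
Local Notation V := 'rV[R]_n.
Variables (p : chart R n M) (k : nat) (X : 'I_k -> local_vfield M) (fs : seq (V -> V)).
Variables (a b : R) (g : R -> V) (u : nat -> R -> R) (N : set R).
Hypotheses (ap : atlas p) (sfs : size fs = k).
Hypothesis fsX : forall i : 'I_k, nth (fun _ => 0) fs i = in_chart (X i) p.
Hypothesis st : steered fs a b g u N.
Hypothesis gU : forall t, a <= t <= b ->
  exists2 x, cdom p x /\ (forall i, ldom (X i) x) & p x = g t.

Local Notation curve := (cinv p \o g).

Let gdom t : a <= t <= b -> [/\ cdom p (curve t), (forall i, ldom (X i) (curve t)) & p (curve t) = g t].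
Proof. by move=> /gU[x [px Xx] pxE]; rewrite /= -pxE cmapK. Qed.

Let g_dist s t : a <= s <= b -> a <= t <= b -> `|g t - g s| <= `|t - s|.
Proof.
move=> /andP[sa sb] /andP[ta tb]; have [h|/ltW h] := leP s t.
  by rewrite (@ger0_norm _ (t - s)) ?subr_ge0//; exact (steered_lipschitz st sa h tb).
rewrite distrC (distrC t) (@ger0_norm _ (s - t)) ?subr_ge0//.
exact (steered_lipschitz st ta h sb).
Qed.

Let g_continuous t : a <= t <= b -> g @ within [set` `[a, b]] (nbhs t) --> g t.
Proof.
move=> tab; apply/cvgrPdist_lt => e e0; rewrite near_withinE.
apply/nbhs_ballP; exists e => //= s; rewrite -ball_normE /= => ts.
rewrite in_itv => sab; apply: le_lt_trans (g_dist sab tab) ts.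
Qed.

(** Absolute continuity is required in every chart [q]. The curve is Lipschitz in [p] and transition
    maps are locally Lipschitz, so it is locally Lipschitz in [q], hence Lipschitz on [[c, d]]. *)
Lemma steered_ac_curve : ac_curve a b curve.
Proof.
split.
  apply/subspace_continuousP => t; rewrite /= in_itv => tab.
  have [pt _ ptE] := gdom tab.
  apply: (cvg_comp _ _ (g_continuous tab)).
  have : (p @` cdom p) (g t) by rewrite -ptE; exists (curve t).
  by move=> /cinv_continuous.
move=> q c d aq ac cd db qdom; apply: lipschitz_absolutely_continuous.
apply: lipschitz_local_segment => // t /andP[ct td].
have tab : a <= t <= b by rewrite (le_trans ac) ?(le_trans td).
have [pt _ ptE] := gdom tab.
have qt : cdom q (curve t) by apply: qdom; rewrite in_itv/= ct.
have Ut : (p @` (cdom p `&` cdom q)) (g t) by rewrite -ptE; exists (curve t).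
have [r [C [r0 C1 _ tq]]] := smooth_tame (@transition_domain_open _ _ _ p q) Ut
  (atlas_compatible ap aq).
exists r => // c' d' cc' d'd tc' d't; exists C; first exact: le_trans C1.
move=> s s' c's ss s'd'.
have sab : a <= s <= b.
  by rewrite (le_trans ac (le_trans cc' c's)) (le_trans ss (le_trans s'd' (le_trans d'd db))).
have sab' : a <= s' <= b.
  by rewrite (le_trans ac (le_trans cc' (le_trans c's ss))) (le_trans s'd' (le_trans d'd db)).
have near v : a <= v <= b -> c' <= v -> v <= d' -> `|g v - g t| < r.
  move=> vab c'v vd'; apply: le_lt_trans (g_dist tab vab) _.
  rewrite ltr_norml; apply/andP; split.
    by rewrite ltrBrDl; exact: lt_le_trans c'v.
  by rewrite ltrBlDl; exact: le_lt_trans vd' d't.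
have := tame_lipschitz tq (near s sab c's (le_trans ss s'd')) (near s' sab' (le_trans c's ss) s'd').
move=> /le_trans; apply; rewrite ler_wpM2l//; first exact: le_trans C1.
by apply: le_trans (g_dist sab sab') _; rewrite ger0_norm// subr_ge0.
Qed.

Lemma steered_velocity t : a < t < b -> ~ N t ->
  velocity curve t (\sum_(i < k) u i t *: (X i (curve t) : tvector M)).
Proof.
move=> tab Nt; have tab' : a <= t <= b by case/andP: tab => /ltW -> /ltW ->.
have [pt Xt ptE] := gdom tab'.
have cp : chart_at (curve t) p by [].
have [T0 TS] := tangent_space_subspace (curve t).
have sumE (q : chart R n M) : (\sum_(i < k) u i t *: (X i (curve t) : tvector M)) q =
    \sum_(i < k) u i t *: X i (curve t) q.
  elim: (index_enum _) => [|i l IH]; first by rewrite !big_nil.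
  by rewrite !big_cons -IH.
split.
  elim/big_rec: _ => [//|i v _ Tv]; apply: TS => //.
  exact: lfield_tangent.
move=> q cq; rewrite sumE.
have dg := steered_derive st tab Nt.
have dq := transition_differentiable cp cq; rewrite ptE in dq.
have dg' : differentiable g t by apply/derivable1_diffP; case: dg.
have dqg : differentiable ((q \o cinv p) \o g) t by exact: differentiable_comp.
split; first exact: diff_derivable.
have E1 : 'D_1 ((q \o cinv p) \o g) t = 'd ((q \o cinv p) \o g) t (1 : R) by exact: deriveE.
have E2 : 'D_1 g t = 'd g t (1 : R) by exact: deriveE.
refine (etrans E1 _).
refine (etrans (f_equal (fun h : R -> V => h 1) (diff_comp dg' dq)) _).
have [_ gE] := dg.
refine (etrans (f_equal (fun v => 'd (q \o cinv p) (g t) v) (etrans (esym E2) gE)) _).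
rewrite /control_field sfs linear_sum; apply: eq_bigr => i _.
rewrite fsX linearZ; congr (_ *: _).
have [_ TE] := lfield_tangent (Xt i).
refine (esym (etrans (TE p q cp cq) _)).
have XE : in_chart (X i) p (g t) = X i (curve t) p by [].
by rewrite XE ptE.
Qed.

(** Bounded measurable controls are integrable on a segment, and the countable set [N] is null. *)
Lemma steered_controlled : controlled a b curve X.
Proof.
split; [|exact: steered_ac_curve|].
  by move=> i t; rewrite in_itv => tab; have [_ + _] := gdom tab; exact.
exists (fun i => u i); split=> [i|].
  apply: measurable_bounded_integrable => //.
  - exact: compact_finite_measure (@segment_compact _ a b).
  - by apply: measurable_funTS; exact: (steered_measurable st i).
  - exists 1; split=> // K K1 t _; apply: le_trans (ltW K1).
    exact: (steered_bounded st).
have cN := steered_countable st.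
have nN : (@lebesgue_measure R).-negligible N.
  exists N; split=> //; last exact: countable_lebesgue_measure0.
  by apply: countable_measurable => // t; exact: measurable_set1.
apply: negligibleS nN => t /=; apply: contra_notP => Nt; rewrite in_itv => tab.
exact: steered_velocity.
Qed.

End steered_controlled.

(** * Joining points locally and globally *)

Section connecting_curves.
Context {R : realType} {n : nat} {M : manifold R n}.
Variable H : tangent_distribution M.

(* The starting time is arbitrary so that curves can be concatenated without reparametrization. *)
Definition joinable (x y : M) : Prop := forall a : R, exists b g,
  [/\ a < b, horizontal H g a b, g a = x & g b = y].

Lemma locally_joinable (x0 : M) : bracket_generating H ->
  exists2 O, nbhs x0 O & forall x y, O x -> O y -> joinable x y.
Proof.
move=> bg; have [p ap px0] := atlas_cover x0.
have cp : chart_at x0 p by [].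
have [fs Pfs ctrl] := locally_controllable (fun w => reachable_span cp w bg).
have [X XP] := choice (fun i : 'I_(size fs) => Pfs i (ltn_ord i)).
pose O := [set x | forall i, ldom (X i) x]°.
have Ox0 : O x0.
  apply: (@filter_forall _ _ (fun i x => ldom (X i) x) (nbhs x0)) => i.
  by apply: open_nbhs_nbhs; split; [exact: ldom_open|have [] := XP i].
have oO : open O by exact: open_interior.
have [r r0 rO] := open_ball_sub (@chart_image_open _ _ _ p O oO)
  (ex_intro2 _ _ x0 (conj px0 Ox0) erefl).
have r20 : 0 < r / 2 by rewrite divr_gt0.
(* Starting within [r / 2] of [p x0] and of length at most [r / 2], the curves stay in the ball of
   radius [r], over the common domain of the fields. *)
have [d d0 dP] := ctrl (r / 2) r20.
pose B := [set z | `|z - p x0| < Num.min d (r / 2)].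
have nB : nbhs (p x0) B.
  apply: open_nbhs_nbhs; split; first exact: dist_ball_open.
  by rewrite /B /= subrr normr0 lt_min d0.
exists [set x | cdom p x /\ B (p x)]; first exact: chart_nbhs.
move=> x y [px]; rewrite /B /= lt_min => /andP[xd xr] [py].
rewrite lt_min => /andP[yd yr] a.
have [T Tr re] := dP _ _ xd yd.
(* The curve is lengthened by a rest to duration [r / 2], so the time interval is nondegenerate even
   if [T = 0]. *)
have [_ /(_ a)[g [u [N [st ga gb]]]]] := reach_le Tr re.
have ab : a < a + r / 2 by rewrite ltrDl.
exists (a + r / 2), (cinv p \o g); split=> //; last 2 first.
- by rewrite /= ga cmapK.
- by rewrite /= gb cmapK.
apply: (@horizontal_controlled _ _ _ _ _ _ _ _ X) => //.
  by move=> i; have [] := XP i.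
apply: (steered_controlled ap erefl _ st); first by move=> i; have [_ _ ->] := XP i.
move=> t /andP[ta tb].
have [|x' [px' Ox'] x'E] := rO (g t); last first.
  by exists x' => //; split=> //; exact: (interior_subset Ox').
apply: le_lt_trans (ler_distD (g a) _ _) _; rewrite [ltRHS]splitr ga.
apply: ler_ltD xr; rewrite -ga.
apply: le_trans (steered_lipschitz st (lexx _) ta tb) _.
by rewrite lerBlDl.
Qed.

Lemma absolutely_continuous_ext (V : normedModType R) (c d : R) (f f' : R -> V) :
  (forall t, c <= t <= d -> f t = f' t) ->
  absolutely_continuous c d f -> absolutely_continuous c d f'.
Proof.
move=> ff acf e e0; have [dl dl0 dlP] := acf e e0; exists dl => // k s r sr tr lt.
have := dlP k s r sr tr lt; congr (_ < _); apply: eq_bigr => i _.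
by have [cs sr' rd] := sr i; rewrite !ff// ?cs ?(le_trans cs)// ?rd ?(le_trans sr').
Qed.

(** Curves are total functions, so gluing changes them outside their intervals. At an interior time
    the two functions agree on a neighbourhood and have the same derivative. *)
Lemma horizontal_ext (g g' : R -> M) a b : horizontal H g a b ->
  (forall t, a <= t <= b -> g t = g' t) -> horizontal H g' a b.
Proof.
have lt_h c d h : horizontal H h c d -> c < d.
  by elim=> // c' m d' _ + _; exact: lt_trans.
elim=> {a b} [a b k X ab HX [dX [cg acg] [u [iu velu]]]|a c b h1 IH1 h2 IH2] gg; last first.
  have ac := lt_h _ _ _ h1; have cb := lt_h _ _ _ h2.
  apply: (horizontal_concat (c := c)).
    by apply: IH1 => t /andP[ta tc]; apply: gg; rewrite ta (le_trans tc) ?ltW.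
  by apply: IH2 => t /andP[tc tb]; apply: gg; rewrite tb (le_trans (ltW ac) tc).
apply: (horizontal_controlled ab HX); split.
- by move=> i t tab; rewrite -gg//; exact: dX.
- split.
    apply: subspace_eq_continuous cg => t; rewrite inE /= in_itv => tab.
    exact: gg.
  move=> p c d ap ac cd db pg'.
  have cdab t : c <= t <= d -> a <= t <= b.
    by move=> /andP[ct td]; rewrite (le_trans ac ct) (le_trans td db).
  apply: (@absolutely_continuous_ext _ _ _ (p \o g)).
    by move=> t /cdab tab /=; rewrite gg.
  apply: acg => // t tcd; rewrite gg; first exact: pg'.
  by apply: cdab; move: tcd; rewrite in_itv.
exists u; split=> //.
apply: negligibleS velu => t /=; apply: contra_not => velt tab; have := velt tab.
have gt : g t = g' t by apply: gg; move: tab; rewrite in_itv => /andP[/ltW -> /ltW ->].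
have near_gg : \forall s \near t, g s = g' s.
  have : \forall s \near t, s \in `]a, b[ by apply: near_in_itvoo.
  by apply: filterS => s; rewrite in_itv => /andP[/ltW sa /ltW sb]; apply: gg; rewrite sa.
rewrite -gt => -[tv dv]; split=> [|p]; rewrite -gt// => cp.
apply: near_eq_is_derive (dv p cp).
by apply: filterS near_gg => s /= ->.
Qed.

Lemma joinable_trans x y z : joinable x y -> joinable y z -> joinable x z.
Proof.
move=> xy yz a; have [b [g [ab hg ga gb]]] := xy a.
have [c [g' [bc hg' gb' gc]]] := yz b.
pose h t := if t <= b then g t else g' t.
exists c, h; split; first exact: lt_trans bc.
- apply: (horizontal_concat (c := b)).
    by apply: horizontal_ext hg _ => t /andP[_ tb]; rewrite /h tb.
  apply: horizontal_ext hg' _ => t /andP[tb _]; rewrite /h.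
  by case: ifPn => // bt; have -> : t = b by [apply/eqP; rewrite eq_le bt]; rewrite gb.
- by rewrite /h (ltW ab).
- by rewrite /h leNgt bc.
Qed.

(** The points joinable from [x] form a nonempty open and closed set: near any [z] two points can be
    joined in either order, so joinability passes from [z] to its neighbours and back. *)
Lemma joinable_all : connected [set: M] -> bracket_generating H ->
  forall x y, joinable x y.
Proof.
move=> cM bg x y; suff E : [set y | joinable x y] = [set: M] by rewrite -[joinable x y]/([set y | joinable x y] y) E.
apply: cM.
- exists x => /=; have [W nW WP] := locally_joinable x bg.
  by apply: WP; exact: nbhs_singleton.
- exists [set y | joinable x y]; last by rewrite setTI.
  rewrite openE => z xz; have [W nW WP] := locally_joinable z bg.
  have Wz := nbhs_singleton nW.
  by apply: filterS nW => z' Wz'; apply: joinable_trans xz _; exact: WP.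
- exists [set y | joinable x y]; last by rewrite setTI.
  move=> z clz; have [W nW WP] := locally_joinable z bg.
  have [z' [xz' Wz']] := clz W nW.
  by apply: joinable_trans xz' _; exact: WP Wz' (nbhs_singleton nW).
Qed.

End connecting_curves.

Theorem theorem3p3 (R : realType) (n : nat) (M : manifold R n)
    (H : tangent_distribution M) :
  connected [set: M] ->
  smooth_distribution H ->
  bracket_generating H ->
  forall x y : M,
    exists (a b : R) (g : R -> M),
      [/\ a < b, horizontal H g a b, g a = x & g b = y].
Proof.
move=> cM _ bg x y.
have [b [g [ab Hg ga gb]]] := joinable_all cM bg x y 0.
by exists 0, b, g.
Qed.
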